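(* Let $\mathbb K$ be a field of characteristic $0$, let $(\mathfrak g,\mu)$ be a Lie algebra over $\mathbb K$ and let $\varphi\in\wedge^3(\mathfrak g)^{\mathfrak g}$, so that $(\mathfrak g,\mu,\delta=0,\varphi)$ is a Lie quasi-bialgebra. 1) There exists a lift of $(\mathfrak g,\mu,\delta=0,\varphi)$ of the form $$(\widehat S^\cdot(\mathfrak g),m_0,P_{\mathfrak g^*},\Delta_0,\widetilde\varphi),\qquad( * )$$ where $P_{\mathfrak g^*}$ is the Kostant–Kirillov Poisson structure on $\mathfrak g^*$ and $\Delta_0$ is the coproduct for which the elements of $\mathfrak g$ are primitive. 2) Any two lifts of $(\mathfrak g,\mu,\delta=0,\varphi)$ of the form $( * )$ are related by a $\mathfrak g$-invariant twist.
   Context: $\widehat S^\cdot(\mathfrak g)=\prod_kS^k(\mathfrak g)$ with product $m_0$; $\widehat\otimes$ denotes completed tensor products (e.g. $\widehat S^\cdot(\mathfrak g)^{\widehat\otimes k}=\widehat S^\cdot(\mathfrak g^{\oplus k})$). $P_{\mathfrak g^*}$ is the Poisson bracket on $\widehat S^\cdot(\mathfrak g)$ extending the Lie bracket $\mu$. A Drinfeld algebra is a quintuple $(A,m_0,P,\Delta,\widetilde\varphi)$ where: $(A,m_0)$ is a formal series algebra with maximal ideal $\mathfrak m_A$; $P$ is a Poisson structure on $A$ with $\mathrm{Im}(P)\subset\mathfrak m_A$; $\Delta:A\to A\widehat\otimes A$ is a continuous Poisson algebra morphism with $(\epsilon\otimes\mathrm{id})\circ\Delta=(\mathrm{id}\otimes\epsilon)\circ\Delta=\mathrm{id}$,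 where $\epsilon:A\to A/\mathfrak m_A=\mathbb K$ is the projection; and $\widetilde\varphi\in(\mathfrak m_A)^{\widehat\otimes3}$ satisfies $$(\mathrm{id}\otimes\Delta)(\Delta(a))=\widetilde\varphi\star(\Delta\otimes\mathrm{id})(\Delta(a))\star(-\widetilde\varphi)\quad(a\in A),$$ $$\widetilde\varphi^{1,2,34}\star\widetilde\varphi^{12,3,4}=\widetilde\varphi^{2,3,4}\star\widetilde\varphi^{1,23,4}\star\widetilde\varphi^{1,2,3},$$ where $f\star g=f+g+\frac12P(f,g)+\cdots$ is the Campbell–Baker–Hausdorff series for the Poisson bracket (on the relevant $A^{\widehat\otimes k}$), so that $f\star b\star(-f)=\exp(P(f,-))(b)$. Here $\widetilde\varphi^{12,3,4}=(\Delta\otimes\mathrm{id}\otimes\mathrm{id})(\widetilde\varphi)$, $\widetilde\varphi^{1,23,4}=(\mathrm{id}\otimes\Delta\otimes\mathrm{id})(\widetilde\varphi)$, $\widetilde\varphi^{1,2,34}=(\mathrm{id}\otimes\mathrm{id}\otimes\Delta)(\widetilde\varphi)$, $\widetilde\varphi^{1,2,3}=\widetilde\varphi\otimes1$, $\widetilde\varphi^{2,3,4}=1\otimes\widetilde\varphi$. Twist by $\widetilde f\in\mathfrak m_A^{\widehat\otimes2}$: replaces the Drinfeld algebra by $(A,m_0,P,{}^{\widetilde f}\Delta,{}^{\widetilde f}\widetilde\varphi)$ with ${}^{\widetilde f}\Delta(a)=\widetilde f\star\Delta(a)\star(-\widetilde f)$ and ${}^{\widetilde f}\widetilde\varphi=\widetilde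 f^{2,3}\star\widetilde f^{1,23}\star\widetilde\varphi\star(-\widetilde f^{12,3})\star(-\widetilde f^{1,2})$, where $\widetilde f^{12,3}=(\Delta\otimes\mathrm{id})(\widetilde f)$, $\widetilde f^{1,23}=(\mathrm{id}\otimes\Delta)(\widetilde f)$, $\widetilde f^{1,2}=\widetilde f\otimes1$, $\widetilde f^{2,3}=1\otimes\widetilde f$. Reduction: for a Drinfeld algebra, set $\mathfrak g=\mathfrak m_A/\mathfrak m_A^2$; $P$ induces a Lie bracket $\mu$ on $\mathfrak g$, $\Delta-\Delta^{2,1}$ induces $\delta:\mathfrak g\to\Lambda^2(\mathfrak g)$, and the class of $\mathrm{Alt}(\widetilde\varphi)$ in $\mathfrak g^{\otimes3}$ is an element $\varphi\in\Lambda^3(\mathfrak g)$; $(\mathfrak g,\mu,\delta,\varphi)$ is a Lie quasi-bialgebra. A lift of a Lie quasi-bialgebra is a Drinfeld algebra whose reduction is that Lie quasi-bialgebra. $\mathrm{Alt}=\frac16\sum_{\sigma\in\mathfrak S_3}\mathrm{sgn}(\sigma)\sigma$. *)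

(* Defs.v *)
From HB Require Import structures.
From mathcomp Require Import all_boot all_order all_algebra all_fingroup.
From mathcomp Require Import generic_quotient boolp.

Set Implicit Arguments.
Unset Strict Implicit.
Unset Printing Implicit Defensive.

Import GRing.Theory.
Local Open Scope ring_scope.
Local Open Scope quotient_scope.

Inductive span (K : fieldType) (M : lmodType K) (S : M -> Prop) : M -> Prop :=
| span0 : span S 0
| spanD x y : span S x -> span S y -> span S (x + y)
| spanZ c x : S x -> span S (c *: x).

(* The symmetric algebra of a vector space V of arbitrary dimension, as the   *)
(* commutative K-algebra generated by the elements of V subject to the linear *)
(* relations of V: terms in these generators modulo the least congruence      *)
(* containing the algebra axioms.  Its universal property is sym_lift below.  *)

Section SymmetricAlgebra.
Variables (K : fieldType) (V : lmodType K).

Inductive sterm : Type :=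
| SVar of V
| SCst of K
| SAdd of sterm & sterm
| SMul of sterm & sterm.

Inductive scong : sterm -> sterm -> Prop :=
| scong_refl a : scong a a
| scong_sym a b : scong a b -> scong b a
| scong_trans a b c : scong a b -> scong b c -> scong a c
| scong_add a a' b b' :
    scong a a' -> scong b b' -> scong (SAdd a b) (SAdd a' b')
| scong_mul a a' b b' :
    scong a a' -> scong b b' -> scong (SMul a b) (SMul a' b')
| scong_addA a b c : scong (SAdd a (SAdd b c)) (SAdd (SAdd a b) c)
| scong_addC a b : scong (SAdd a b) (SAdd b a)
| scong_add0 a : scong (SAdd (SCst 0) a) a
| scong_addN a : scong (SAdd (SMul (SCst (-1)) a) a) (SCst 0)
| scong_mulA a b c : scong (SMul a (SMul b c)) (SMul (SMul a b) c)
| scong_mulC a b : scong (SMul a b) (SMul b a)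
| scong_mul1 a : scong (SMul (SCst 1) a) a
| scong_mulD a b c :
    scong (SMul (SAdd a b) c) (SAdd (SMul a c) (SMul b c))
| scong_cstD c d : scong (SCst (c + d)) (SAdd (SCst c) (SCst d))
| scong_cstM c d : scong (SCst (c * d)) (SMul (SCst c) (SCst d))
| scong_varD u v : scong (SVar (u + v)) (SAdd (SVar u) (SVar v))
| scong_varZ c v : scong (SVar (c *: v)) (SMul (SCst c) (SVar v)).

HB.instance Definition _ := gen_eqMixin sterm.
HB.instance Definition _ := gen_choiceMixin sterm.

Definition sequiv : rel sterm := fun a b => `[< scong a b >].

Lemma sequiv_refl : reflexive sequiv.
Proof. by move=> a; apply/asboolP; exact: scong_refl. Qed.

Lemma sequiv_sym : symmetric sequiv.
Proof. by move=> a b; apply/asboolP/asboolP; exact: scong_sym. Qed.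

Lemma sequiv_trans : transitive sequiv.
Proof.
move=> b a c /asboolP ab /asboolP bc; apply/asboolP.
exact: scong_trans ab bc.
Qed.

Canonical sequiv_equiv := EquivRel sequiv sequiv_refl sequiv_sym sequiv_trans.

Definition symAlg : Type := {eq_quot sequiv}.

HB.instance Definition _ : EqQuotient sterm sequiv_equiv symAlg :=
  EqQuotient.on symAlg.
HB.instance Definition _ := Choice.on symAlg.

Lemma sym_eqP a b : \pi_symAlg a = \pi_symAlg b <-> scong a b.
Proof. by split=> [/eqmodP/asboolP|ab]; last exact/eqmodP/asboolP. Qed.

Lemma scong_repr a : scong (repr (\pi_symAlg a)) a.
Proof. by apply/sym_eqP; rewrite reprK. Qed.

Definition sym_cst (c : K) : symAlg :=
  \pi_symAlg (SCst c).
Definition sym_add (x y : symAlg) : symAlg :=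
  \pi_symAlg (SAdd (repr x) (repr y)).
Definition sym_mul (x y : symAlg) : symAlg :=
  \pi_symAlg (SMul (repr x) (repr y)).
Definition sym_opp (x : symAlg) : symAlg := sym_mul (sym_cst (-1)) x.
Definition sym_scale (c : K) (x : symAlg) : symAlg := sym_mul (sym_cst c) x.

Lemma pi_add a b :
  \pi_symAlg (SAdd a b) = sym_add (\pi_symAlg a) (\pi_symAlg b).
Proof. by apply/sym_eqP/scong_sym/scong_add; exact: scong_repr. Qed.

Lemma pi_mul a b :
  \pi_symAlg (SMul a b) = sym_mul (\pi_symAlg a) (\pi_symAlg b).
Proof. by apply/sym_eqP/scong_sym/scong_mul; exact: scong_repr. Qed.

Lemma sym_ind0 (P : symAlg -> Prop) :
  (forall a, P (\pi_symAlg a)) -> forall x, P x.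
Proof. by move=> H x; rewrite -[x]reprK. Qed.

Lemma sym_addA : associative sym_add.
Proof.
elim/sym_ind0=> a; elim/sym_ind0=> b; elim/sym_ind0=> c.
by rewrite -!pi_add; apply/sym_eqP; constructor.
Qed.

Lemma sym_addC : commutative sym_add.
Proof.
elim/sym_ind0=> a; elim/sym_ind0=> b.
by rewrite -!pi_add; apply/sym_eqP; constructor.
Qed.

Lemma sym_add0 : left_id (sym_cst 0) sym_add.
Proof. by elim/sym_ind0=> a; rewrite -pi_add; apply/sym_eqP; constructor. Qed.

Lemma sym_addN : left_inverse (sym_cst 0) sym_opp sym_add.
Proof.
elim/sym_ind0=> a.
by rewrite /sym_opp -pi_mul -pi_add; apply/sym_eqP; constructor.
Qed.

HB.instance Definition _ :=
  GRing.isZmodule.Build symAlg sym_addA sym_addC sym_add0 sym_addN.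

Lemma sym_mulA : associative sym_mul.
Proof.
elim/sym_ind0=> a; elim/sym_ind0=> b; elim/sym_ind0=> c.
by rewrite -!pi_mul; apply/sym_eqP; constructor.
Qed.

Lemma sym_mulC : commutative sym_mul.
Proof.
elim/sym_ind0=> a; elim/sym_ind0=> b.
by rewrite -!pi_mul; apply/sym_eqP; constructor.
Qed.

Lemma sym_mul1 : left_id (sym_cst 1) sym_mul.
Proof. by elim/sym_ind0=> a; rewrite -pi_mul; apply/sym_eqP; constructor. Qed.

Lemma sym_mulD : left_distributive sym_mul +%R.
Proof.
elim/sym_ind0=> a; elim/sym_ind0=> b; elim/sym_ind0=> c.
rewrite -[_ + _]pi_add -[RHS]/(sym_add _ _) -!pi_mul -pi_add.
by apply/sym_eqP; constructor.
Qed.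

Fixpoint sterm_eval (B : lalgType K) (u : V -> B) (a : sterm) : B :=
  match a with
  | SVar v => u v
  | SCst c => c%:A
  | SAdd a b => sterm_eval u a + sterm_eval u b
  | SMul a b => sterm_eval u a * sterm_eval u b
  end.

Lemma sterm_eval_cong (B : comAlgType K) (u : V -> B) a b :
  linear u -> scong a b -> sterm_eval u a = sterm_eval u b.
Proof.
move=> ul; have uD v w : u (v + w) = u v + u w.
  by rewrite -[v]scale1r ul !scale1r.
have u0 : u 0 = 0 by apply: (addIr (u 0)); rewrite -uD !add0r.
have uZ c v : u (c *: v) = c *: u v by rewrite -[_ *: v]addr0 ul u0 addr0.
elim=> //= *.
- by congruence.
- by congruence.
- by congruence.
- exact: addrA.
- exact: addrC.
- by rewrite scale0r add0r.
- by rewrite scaleN1r mulN1r addNr scale0r.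
- exact: mulrA.
- exact: mulrC.
- by rewrite scale1r mul1r.
- exact: mulrDl.
- exact: scalerDl.
- by rewrite -scalerAl mul1r scalerA.
- by rewrite uZ -scalerAl mul1r.
Qed.

Lemma sym_1_neq0 : sym_cst 1 != 0.
Proof.
have l0 : linear (fun _ : V => 0 : K^o) by move=> c v w; rewrite scaler0 addr0.
apply/eqP => /sym_eqP /(@sterm_eval_cong K^o _ _ _ l0) /= /eqP.
by rewrite scale1r scale0r oner_eq0.
Qed.

HB.instance Definition _ :=
  GRing.Zmodule_isComNzRing.Build symAlg sym_mulA sym_mulC sym_mul1 sym_mulD
    sym_1_neq0.

Lemma sym_cstM c d : sym_cst (c * d) = sym_cst c * sym_cst d.
Proof. by rewrite -[RHS]pi_mul; apply/sym_eqP; constructor. Qed.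

Lemma sym_cstD c d : sym_cst (c + d) = sym_cst c + sym_cst d.
Proof. by rewrite -[RHS]pi_add; apply/sym_eqP; constructor. Qed.

Lemma sym_scaleA c d x : sym_scale c (sym_scale d x) = sym_scale (c * d) x.
Proof. by rewrite /sym_scale sym_cstM sym_mulA. Qed.

Lemma sym_scale1 : left_id 1 sym_scale.
Proof. exact: sym_mul1. Qed.

Lemma sym_scaleDr : right_distributive sym_scale +%R.
Proof. by move=> c x y; exact: (mulrDr (sym_cst c)). Qed.

Lemma sym_scaleDl x : {morph sym_scale^~ x : c d / c + d}.
Proof. by move=> c d; rewrite /sym_scale sym_cstD; exact: mulrDl. Qed.

HB.instance Definition _ := GRing.Zmodule_isLmodule.Build K symAlg
  sym_scaleA sym_scale1 sym_scaleDr sym_scaleDl.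

Lemma sym_scaleAl c (x y : symAlg) : c *: (x * y) = c *: x * y.
Proof. exact: (mulrA (sym_cst c)). Qed.

HB.instance Definition _ := GRing.Lmodule_isLalgebra.Build K symAlg sym_scaleAl.
HB.instance Definition _ := GRing.Lalgebra_isComAlgebra.Build K symAlg.

Definition sym_var (v : V) : symAlg :=
  \pi_symAlg (SVar v).

Lemma sym_cstE c : sym_cst c = c%:A.
Proof. by rewrite -[RHS]/(sym_cst c * 1) mulr1. Qed.

Lemma sym_var_linear : linear sym_var.
Proof.
move=> c u v.
rewrite -[RHS]/(sym_add (sym_mul (sym_cst c) (sym_var u)) (sym_var v)).
rewrite -pi_mul -pi_add; apply/sym_eqP.
apply: scong_trans (scong_varD _ _) _.
by apply: scong_add; constructor.
Qed.

HB.instance Definition _ :=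
  GRing.isLinear.Build K V symAlg _ sym_var sym_var_linear.

Lemma sym_ind (P : symAlg -> Prop) :
  (forall v, P (sym_var v)) -> (forall c, P c%:A) ->
  (forall x y, P x -> P y -> P (x + y)) ->
  (forall x y, P x -> P y -> P (x * y)) -> forall x, P x.
Proof.
move=> Hv Hc Ha Hm; elim/sym_ind0; elim=> [v|c|a Pa b Pb|a Pa b Pb].
- exact: Hv.
- by rewrite -[\pi_symAlg _]/(sym_cst c) sym_cstE; exact: Hc.
- by rewrite pi_add; exact: Ha.
- by rewrite pi_mul; exact: Hm.
Qed.

(* For a linear u, sym_lift u is the algebra morphism extending u; the value  *)
(* of sym_lift at a non-linear u is irrelevant.                               *)
Definition sym_lift (B : comAlgType K) (u : V -> B) (x : symAlg) : B :=
  sterm_eval u (repr x).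

Section Lift.
Variables (B : comAlgType K) (u : V -> B).
Hypothesis u_linear : linear u.

Lemma sym_liftE a : sym_lift u (\pi_symAlg a) = sterm_eval u a.
Proof. exact/sterm_eval_cong/scong_repr. Qed.

Lemma sym_lift_var v : sym_lift u (sym_var v) = u v.
Proof. exact: sym_liftE. Qed.

Lemma sym_lift_cst c : sym_lift u c%:A = c%:A.
Proof. by rewrite -sym_cstE; exact: sym_liftE. Qed.

Lemma sym_liftD x y : sym_lift u (x + y) = sym_lift u x + sym_lift u y.
Proof.
elim/sym_ind0: x => a; elim/sym_ind0: y => b.
by rewrite -[_ + _]pi_add !sym_liftE.
Qed.

Lemma sym_liftM x y : sym_lift u (x * y) = sym_lift u x * sym_lift u y.
Proof.
elim/sym_ind0: x => a; elim/sym_ind0: y => b.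
by rewrite -[_ * _]pi_mul !sym_liftE.
Qed.

Lemma sym_lift_unique (h : {lrmorphism symAlg -> B}) :
  (forall v, h (sym_var v) = u v) -> h =1 sym_lift u.
Proof.
move=> hu; elim/sym_ind=> [v|c|x y hx hy|x y hx hy].
- by rewrite hu sym_lift_var.
- by rewrite linearZ_LR rmorph1 sym_lift_cst.
- by rewrite rmorphD sym_liftD; congr (_ + _).
- by rewrite rmorphM sym_liftM; congr (_ * _).
Qed.

End Lift.

(* For an algebra morphism r and a linear d, sym_der r d is the derivation    *)
(* along r that extends d: D (x * y) = D x * r y + r x * D y.                 *)
Fixpoint sterm_der (B : comAlgType K) (r : symAlg -> B) (d : V -> B) (a : sterm)
    : B :=
  match a with
  | SVar v => d v
  | SCst _ => 0
  | SAdd a b => sterm_der r d a + sterm_der r d b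
  | SMul a b =>
      sterm_der r d a * r (\pi_symAlg b) + r (\pi_symAlg a) * sterm_der r d b
  end.

Definition sym_der (B : comAlgType K) (r : symAlg -> B) (d : V -> B)
    (x : symAlg) : B := sterm_der r d (repr x).

Section Derivation.
Variables (B : comAlgType K) (r : {lrmorphism symAlg -> B}) (d : V -> B).
Hypothesis d_linear : linear d.

Lemma sterm_der_cong a b : scong a b -> sterm_der r d a = sterm_der r d b.
Proof.
have rD x y : r (\pi_symAlg (SAdd x y)) = r (\pi_symAlg x) + r (\pi_symAlg y).
  by rewrite pi_add -rmorphD.
have rM x y : r (\pi_symAlg (SMul x y)) = r (\pi_symAlg x) * r (\pi_symAlg y).
  by rewrite pi_mul -rmorphM.
have rC c : r (\pi_symAlg (SCst c)) = c%:A.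
  by rewrite -[\pi_symAlg _]/(sym_cst c) sym_cstE linearZ_LR rmorph1.
have dD v w : d (v + w) = d v + d w.
  by rewrite -[v]scale1r d_linear !scale1r.
have d0 : d 0 = 0 by apply: (addIr (d 0)); rewrite -dD !add0r.
have dZ c v : d (c *: v) = c *: d v.
  by rewrite -[_ *: v]addr0 d_linear d0 addr0.
elim=> {a b} //=.
- by move=> a b c _ -> _ ->.
- by move=> a a' b b' _ -> _ ->.
- by move=> a a' b b' /sym_eqP -> -> /sym_eqP -> ->.
- by move=> a b c; rewrite addrA.
- by move=> a b; rewrite addrC.
- by move=> a; rewrite add0r.
- by move=> a; rewrite mul0r add0r rC scaleN1r mulN1r addNr.
- move=> a b c; rewrite !rM mulrDr mulrDl !mulrA -!addrA; congr (_ + _).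
- by move=> a b; rewrite addrC mulrC [X in _ + X]mulrC.
- by move=> a; rewrite rC mul0r add0r scale1r mul1r.
- by move=> a b c; rewrite rD !mulrDl addrACA.
- by rewrite addr0.
- by move=> c e; rewrite mul0r mulr0 addr0.
- by move=> c v; rewrite dZ rC mul0r add0r -scalerAl mul1r.
Qed.

Lemma sym_derE a : sym_der r d (\pi_symAlg a) = sterm_der r d a.
Proof. exact/sterm_der_cong/scong_repr. Qed.

Lemma sym_der_var v : sym_der r d (sym_var v) = d v.
Proof. exact: sym_derE. Qed.

Lemma sym_der_cst c : sym_der r d c%:A = 0.
Proof. by rewrite -sym_cstE; exact: sym_derE. Qed.

Lemma sym_derD x y : sym_der r d (x + y) = sym_der r d x + sym_der r d y.
Proof.
elim/sym_ind0: x => a; elim/sym_ind0: y => b.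
by rewrite -[_ + _]pi_add !sym_derE.
Qed.

Lemma sym_derM x y :
  sym_der r d (x * y) = sym_der r d x * r y + r x * sym_der r d y.
Proof.
elim/sym_ind0: x => a; elim/sym_ind0: y => b.
by rewrite -[_ * _]pi_mul !sym_derE.
Qed.

End Derivation.

(* S^n(V) inside S(V) *)
Definition homog (n : nat) : symAlg -> Prop :=
  span (fun x => exists t : n.-tuple V, x = \prod_(v <- t) sym_var v).

Lemma homogZ n c x : homog n x -> homog n (c *: x).
Proof.
elim=> [|y z _ IHy _ IHz|e y Sy]; first by rewrite scaler0; exact: span0.
- by rewrite scalerDr; exact: spanD.
- by rewrite scalerA; exact: spanZ.
Qed.

Lemma homog_sum n I (r : seq I) (P : pred I) (F : I -> symAlg) :
  (forall i, P i -> homog n (F i)) -> homog n (\sum_(i <- r | P i) F i).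
Proof. by move=> HF; elim/big_ind: _ => //; [exact: span0|exact: spanD]. Qed.

Lemma homogM m n x y : homog m x -> homog n y -> homog (m + n) (x * y).
Proof.
move=> hx hy; elim: hx => [|x1 x2 _ IH1 _ IH2|c _ [s ->]].
- by rewrite mul0r; exact: span0.
- by rewrite mulrDl; exact: spanD.
- rewrite -scalerAl; apply: homogZ; elim: hy => [|y1 y2 _ IH1 _ IH2|e _ [t ->]].
  + by rewrite mulr0; exact: span0.
  + by rewrite mulrDr; exact: spanD.
  + rewrite -scalerAr; apply: spanZ; exists [tuple of s ++ t].
    by rewrite big_cat.
Qed.

Lemma homog_var v : homog 1 (sym_var v).
Proof.
rewrite -[sym_var v]scale1r; apply: spanZ; exists [tuple v].
by rewrite big_seq1.
Qed.

Lemma homog_cst c : homog 0 c%:A.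
Proof. by apply: spanZ; exists [tuple]; rewrite big_nil. Qed.

End SymmetricAlgebra.

Arguments sym_var {K V} v.
Arguments homog {K V} n x.

Section CompletedSymmetricAlgebra.
Variables (K : fieldType) (V : lmodType K).

Record Shat : Type := MkShat {
  scomp :> nat -> symAlg V;
  scomp_homog : forall n, homog n (scomp n)
}.

HB.instance Definition _ := gen_eqMixin Shat.
HB.instance Definition _ := gen_choiceMixin Shat.

Lemma shatP (f g : Shat) : (forall n, f n = g n) -> f = g.
Proof.
case: f g => [f hf] [g hg] /= /funext fg.
by move: hf hg; rewrite fg => hf hg; congr MkShat; exact: Prop_irrelevance.
Qed.

Fact shat_zero_subproof n : homog n (0 : symAlg V).
Proof. exact: span0. Qed.
Fact shat_one_subproof n : homog n ((n == 0%N)%:R : symAlg V).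
Proof.
by case: n => [|n] /=; [rewrite -[1]scale1r; exact: homog_cst|exact: span0].
Qed.
Fact shat_add_subproof (f g : Shat) n : homog n (f n + g n).
Proof. by apply: spanD; exact: scomp_homog. Qed.
Fact shat_scale_subproof c (f : Shat) n : homog n (c *: f n).
Proof. by apply: homogZ; exact: scomp_homog. Qed.
Fact shat_opp_subproof (f : Shat) n : homog n (- f n).
Proof. by rewrite -scaleN1r; exact: shat_scale_subproof. Qed.
Fact shat_mul_subproof (f g : Shat) n :
  homog n (\sum_(i < n.+1) f i * g (n - i)%N).
Proof.
apply: homog_sum => i _; rewrite -{1}(subnKC (leq_ord i)).
by apply: homogM; exact: scomp_homog.
Qed.
Fact shat_var_subproof (v : V) n : homog n (if n == 1%N then sym_var v else 0).
Proof. by case: eqP => [->|_]; [exact: homog_var|exact: span0]. Qed.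

Definition shat_zero := MkShat shat_zero_subproof.
Definition shat_one := MkShat shat_one_subproof.
Definition shat_add f g := MkShat (shat_add_subproof f g).
Definition shat_opp f := MkShat (shat_opp_subproof f).
Definition shat_scale c f := MkShat (shat_scale_subproof c f).
Definition shat_mul f g := MkShat (shat_mul_subproof f g).

Lemma shat_addA : associative shat_add.
Proof. by move=> f g h; apply: shatP => n /=; rewrite addrA. Qed.
Lemma shat_addC : commutative shat_add.
Proof. by move=> f g; apply: shatP => n /=; rewrite addrC. Qed.
Lemma shat_add0 : left_id shat_zero shat_add.
Proof. by move=> f; apply: shatP => n /=; rewrite add0r. Qed.
Lemma shat_addN : left_inverse shat_zero shat_opp shat_add.
Proof. by move=> f; apply: shatP => n /=; rewrite addNr. Qed.

HB.instance Definition _ :=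
  GRing.isZmodule.Build Shat shat_addA shat_addC shat_add0 shat_addN.

Lemma shat_mulE N (f g : Shat) n : (n < N)%N ->
  shat_mul f g n = ((\poly_(i < N) f i) * (\poly_(i < N) g i))`_n.
Proof.
move=> nN; rewrite coefM /=; apply: eq_bigr => i _; rewrite !coef_poly.
by rewrite (leq_ltn_trans (leq_ord i)) // (leq_ltn_trans (leq_subr _ _)).
Qed.

Lemma shat_mulC : commutative shat_mul.
Proof.
by move=> f g; apply: shatP => n; rewrite !(@shat_mulE n.+1) // mulrC.
Qed.

Lemma shat_mulA : associative shat_mul.
Proof.
move=> f g h; apply: shatP => n; rewrite !(@shat_mulE n.+1) //.
transitivity (((\poly_(i < n.+1) f i) *
               ((\poly_(i < n.+1) g i) * (\poly_(i < n.+1) h i)))`_n).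
  rewrite !coefM; apply: eq_bigr => i _; congr (_ * _).
  have lt : (n - i < n.+1)%N by rewrite ltnS leq_subr.
  by rewrite coef_poly lt (@shat_mulE n.+1).
rewrite mulrA !coefM; apply: eq_bigr => i _; congr (_ * _).
by rewrite coef_poly ltn_ord (@shat_mulE n.+1).
Qed.

Lemma shat_mul1 : left_id shat_one shat_mul.
Proof.
move=> f; apply: shatP => n /=.
rewrite big_ord_recl /= mul1r subn0 big1 ?addr0 // => i _.
by rewrite mul0r.
Qed.

Lemma shat_mulD : left_distributive shat_mul +%R.
Proof.
move=> f g h; apply: shatP => n /=; rewrite -big_split /=.
by apply: eq_bigr => i _; rewrite mulrDl.
Qed.

Lemma shat_1_neq0 : shat_one != 0.
Proof.
by apply/eqP => /(congr1 (fun f : Shat => f 0%N)) /eqP; rewrite oner_eq0.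
Qed.

HB.instance Definition _ :=
  GRing.Zmodule_isComNzRing.Build Shat shat_mulA shat_mulC shat_mul1 shat_mulD
    shat_1_neq0.

Lemma shat_scaleA c d f : shat_scale c (shat_scale d f) = shat_scale (c * d) f.
Proof. by apply: shatP => n /=; rewrite scalerA. Qed.
Lemma shat_scale1 : left_id 1 shat_scale.
Proof. by move=> f; apply: shatP => n /=; rewrite scale1r. Qed.
Lemma shat_scaleDr : right_distributive shat_scale +%R.
Proof. by move=> c f g; apply: shatP => n /=; rewrite scalerDr. Qed.
Lemma shat_scaleDl f : {morph shat_scale^~ f : c d / c + d}.
Proof. by move=> c d; apply: shatP => n /=; rewrite scalerDl. Qed.

HB.instance Definition _ := GRing.Zmodule_isLmodule.Build K Shat
  shat_scaleA shat_scale1 shat_scaleDr shat_scaleDl.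

Lemma shat_scaleAl c (f g : Shat) : c *: (f * g) = c *: f * g.
Proof.
apply: shatP => n /=; rewrite scaler_sumr.
by apply: eq_bigr => i _; rewrite scalerAl.
Qed.

HB.instance Definition _ := GRing.Lmodule_isLalgebra.Build K Shat shat_scaleAl.
HB.instance Definition _ := GRing.Lalgebra_isComAlgebra.Build K Shat.

Definition shat_var (v : V) : Shat := MkShat (shat_var_subproof v).

(* The limit of a sequence S such that S m and S n agree in degree n for all  *)
(* m >= n, in particular of the partial sums of a series whose n-th term has  *)
(* order at least n.                                                          *)
Definition shat_lim (S : nat -> Shat) : Shat :=
  MkShat (fun n => scomp_homog (S n) n).

(* The elements of order at least n, i.e. the closure of m_A ^ n. *)
Definition order_ge (n : nat) (f : Shat) : Prop :=
  forall k, (k < n)%N -> f k = 0.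

Definition max_ideal (f : Shat) : Prop := f 0%N = 0.

End CompletedSymmetricAlgebra.

Arguments shat_var {K V} v.
Arguments shat_lim {K V} S.
Arguments order_ge {K V} n f.
Arguments max_ideal {K V} f.

Definition shat_continuous (K : fieldType) (V W : lmodType K)
    (T : Shat V -> Shat W) : Prop :=
  forall n, exists m, forall f, order_ge m f -> order_ge n (T f).

(* For a linear u with values in the maximal ideal, the continuous algebra    *)
(* morphism extending u.                                                      *)
Definition shat_lift (K : fieldType) (V W : lmodType K) (u : V -> Shat W)
    (f : Shat V) : Shat W :=
  shat_lim (fun n => \sum_(k < n.+1) sym_lift u (f k)).

(* For a bilinear p, the biderivation of S(V) with values in its completion,  *)
(* resp. the continuous biderivation of the completion, extending p.  In the  *)
(* latter, the terms f k, g l contribute in degrees at least k + l - 2 only,  *)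
(* and not at all when k = 0 or l = 0.                                        *)
Definition sym_bider (K : fieldType) (V : lmodType K) (p : V -> V -> Shat V)
    (x y : symAlg V) : Shat V :=
  let r := sym_lift (@shat_var K V) in
  sym_der r (fun v => sym_der r (fun u => p u v) x) y.

Definition shat_bider (K : fieldType) (V : lmodType K) (p : V -> V -> Shat V)
    (f g : Shat V) : Shat V :=
  shat_lim (fun n => \sum_(k < n.+2) \sum_(l < n.+2) sym_bider p (f k) (g l)).

(* The k-th completed tensor power of Shat V is Shat (dsum V k).        *)

Notation dsum V k := {ffun 'I_k -> V}.

Section TensorPowers.
Variables (K : fieldType) (V : lmodType K).

Definition inj k (i : 'I_k) (v : V) : dsum V k :=
  [ffun j => if j == i then v else 0].

(* moves the i-th summand to the s i-th one *)
Definition push m n (s : 'I_m -> 'I_n) (v : dsum V m) : dsum V n :=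
  [ffun j => \sum_(i | s i == j) v i].

(* a |-> 1 (x) .. (x) a (x) .. (x) 1, with a in position i *)
Definition shat_inj k (i : 'I_k) : Shat V -> Shat (dsum V k) :=
  shat_lift (fun v => shat_var (inj i v)).

Definition shat_push m n (s : 'I_m -> 'I_n)
    : Shat (dsum V m) -> Shat (dsum V n) :=
  shat_lift (fun v => shat_var (push s v)).

(* applies the counit to all the factors but the i-th one *)
Definition shat_proj k (i : 'I_k) : Shat (dsum V k) -> Shat V :=
  shat_lift (fun v : dsum V k => shat_var (v i)).

Definition sym_inj k (i : 'I_k) : symAlg V -> symAlg (dsum V k) :=
  sym_lift (fun v => sym_var (inj i v)).

Definition sym_perm k (s : 'S_k) : symAlg (dsum V k) -> symAlg (dsum V k) :=
  sym_lift (fun v => sym_var (push s v)).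

(* the k-th completed tensor power of the maximal ideal *)
Definition max_ideal_tensor k (f : Shat (dsum V k)) : Prop :=
  forall n, span (fun x : symAlg (dsum V k) => exists2 t : 'I_k -> symAlg V,
      forall i, exists2 d, (0 < d)%N & homog d (t i) &
      x = \prod_i sym_inj i (t i)) (f n).

(* The k-th tensor power of V, spanned in the k-th tensor power of S(V) by    *)
(* the v_1 (x) .. (x) v_k, and its k-th exterior power, viewed as the space   *)
(* of antisymmetric tensors.                                                  *)
Definition tensor k : symAlg (dsum V k) -> Prop :=
  span (fun x : symAlg (dsum V k) => exists t : 'I_k -> V,
    x = \prod_i sym_var (inj i (t i))).

Definition exterior k (x : symAlg (dsum V k)) : Prop :=
  tensor x /\ forall s : 'S_k, sym_perm s x = (-1) ^+ s *: x.

Definition shat_alt3 (f : Shat (dsum V 3)) : Shat (dsum V 3) :=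
  6%:R^-1 *: \sum_(s : 'S_3) (-1) ^+ s *: shat_push s f.

(* the extension of a bracket on A to the k-th completed tensor power of A *)
Definition tensor_bracket (P : Shat V -> Shat V -> Shat V) k
    : Shat (dsum V k) -> Shat (dsum V k) -> Shat (dsum V k) :=
  shat_bider (fun v w : dsum V k =>
    \sum_i shat_inj i (P (shat_var (v i)) (shat_var (w i)))).

(* D applied to the i-th factor (from 0) of the k-th completed tensor power,  *)
(* the new factors being i and i+1; lift (lift ord0 i) : 'I_k -> 'I_k.+1 is   *)
(* the increasing map that avoids i+1.                                        *)
Definition coproduct_at (D : Shat V -> Shat (dsum V 2)) k (i : 'I_k)
    : Shat (dsum V k) -> Shat (dsum V k.+1) :=
  let skip (j : 'I_k) : 'I_k.+1 := lift (lift ord0 i) j in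
  let pair (j : 'I_2) : 'I_k.+1 := if j == ord0 then skip i else lift ord0 i in
  shat_lift (fun v : dsum V k => \sum_j
    if j == i then shat_push pair (D (shat_var (v j)))
    else shat_inj (skip j) (shat_var (v j))).

End TensorPowers.

(* The Campbell-Baker-Hausdorff product, by Dynkin's formula                  *)
(*   \sum_N \sum_n (-1)^(n-1) / n \sum_(r_1+s_1>0, .., r_n+s_n>0,             *)
(*      \sum_i (r_i+s_i) = N) [f^r_1 g^s_1 .. f^r_n g^s_n]                    *)
(*         / (N \prod_i r_i! s_i!)                                            *)
(* with right-nested brackets.  It is used for f and g of order at least 2    *)
(* and brackets P such that P(f, g) has order at least the sum of the orders  *)
(* minus 1; its N-th term is then of order at least N + 1.  For such f and    *)
(* arbitrary b, bexp P f b = exp(P(f, -))(b) stands for the iterated product  *)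
(* of f, b and - f, for which Dynkin's series need not converge.              *)

Section CBH.
Variables (K : fieldType) (V : lmodType K) (P : Shat V -> Shat V -> Shat V).
Implicit Types f g b : Shat V.

Fixpoint nested_bracket (w : seq (Shat V)) : Shat V :=
  match w with
  | [::] => 0
  | [:: f] => f
  | f :: w' => P f (nested_bracket w')
  end.

Definition cbh_term (N : nat) f g : Shat V :=
  let I : Type := ('I_N.+1 * 'I_N.+1)%type in
  \sum_(n < N) ((-1) ^+ n / n.+1%:R) *:
    \sum_(t : n.+1.-tuple ('I_N.+1 * 'I_N.+1)
           | all (fun rs : I => 0 < rs.1 + rs.2)%N t
             && (\sum_(rs <- t) (rs.1 + rs.2) == N)%N)
      (N * \prod_(rs <- t) (rs.1`! * rs.2`!))%N%:R^-1 *: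
        nested_bracket
          (flatten [seq nseq rs.1 f ++ nseq rs.2 g | rs : I <- t]).

Definition cbh f g : Shat V :=
  shat_lim (fun n => \sum_(1 <= N < n.+1) cbh_term N f g).

Definition bexp f b : Shat V :=
  shat_lim (fun n => \sum_(k < n.+1) k`!%:R^-1 *: iter k (P f) b).

End CBH.

(* Every formal series algebra A is isomorphic to Shat V for V = m_A / m_A^2, *)
(* so we take A = Shat V in the definition of Drinfeld algebras.              *)

Section Drinfeld.
Variables (K : fieldType) (V : lmodType K).

Record lie_bracket (mu : V -> V -> V) : Prop := {
  lie_linearl : forall v, linear (mu^~ v);
  lie_linearr : forall u, linear (mu u);
  lie_alt : forall u, mu u u = 0;
  lie_jacobi : forall u v w, mu u (mu v w) + mu v (mu w u) + mu w (mu u v) = 0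
}.

Record poisson_structure (P : Shat V -> Shat V -> Shat V) : Prop := {
  poisson_linearl : forall g, linear (P^~ g);
  poisson_linearr : forall f, linear (P f);
  poisson_alt : forall f, P f f = 0;
  poisson_jacobi : forall f g h, P f (P g h) + P g (P h f) + P h (P f g) = 0;
  poisson_leibniz : forall f g h, P f (g * h) = P f g * h + g * P f h;
  poisson_continuous : forall n, exists m, forall f g,
    order_ge m f -> order_ge n (P f g)
}.

Variables (P : Shat V -> Shat V -> Shat V) (D : Shat V -> Shat (dsum V 2)).

Let o2 : 'I_2 := ord_max.
Let m3 : 'I_3 := Ordinal (isT : (1 < 3)%N).

Local Notation P_ k := (@tensor_bracket K V P k).

Record drinfeld_algebra (phi : Shat (dsum V 3)) : Prop := {
  drinfeld_poisson : poisson_structure P;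
  drinfeld_poisson_max : forall f g, max_ideal (P f g);
  drinfeld_coprod_linear : linear D;
  drinfeld_coprod1 : D 1 = 1;
  drinfeld_coprodM : forall f g, D (f * g) = D f * D g;
  drinfeld_coprod_continuous : shat_continuous D;
  drinfeld_coprod_poisson : forall f g, D (P f g) = P_ 2 (D f) (D g);
  drinfeld_counitl : forall f, shat_proj o2 (D f) = f;
  drinfeld_counitr : forall f, shat_proj ord0 (D f) = f;
  drinfeld_assoc_max : max_ideal_tensor phi;
  drinfeld_quasi_coassoc : forall a,
    coproduct_at D o2 (D a) = bexp (P_ 3) phi (coproduct_at D ord0 (D a));
  drinfeld_pentagon :
    cbh (P_ 4) (coproduct_at D ord_max phi) (coproduct_at D ord0 phi) =
    cbh (P_ 4) (cbh (P_ 4) (shat_push (lift ord0) phi) (coproduct_at D m3 phi))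
               (shat_push (lift ord_max) phi)
}.

(* The reduction of a Drinfeld algebra: V = m_A / m_A ^ 2 by means of the     *)
(* component of degree 1.  In Shat (dsum V 2), the class in V (x) V of        *)
(* D a - D^{2,1} a is its component of degree 2; the class of an element of   *)
(* the third tensor power of m_A in that of V is its component of degree 3.   *)
Record reduces_to (phi : Shat (dsum V 3)) (mu : V -> V -> V)
    (delta : V -> symAlg (dsum V 2)) (phi0 : symAlg (dsum V 3)) : Prop := {
  reduction_bracket : forall a b u v, max_ideal a -> max_ideal b ->
    a 1%N = sym_var u -> b 1%N = sym_var v -> P a b 1%N = sym_var (mu u v);
  reduction_cobracket : forall a u, max_ideal a -> a 1%N = sym_var u ->
    (D a - shat_push (@rev_ord 2) (D a)) 2%N = delta u;
  reduction_assoc : shat_alt3 phi 3%N = phi0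
}.

Definition is_lift (phi : Shat (dsum V 3)) (mu : V -> V -> V)
    (delta : V -> symAlg (dsum V 2)) (phi0 : symAlg (dsum V 3)) : Prop :=
  drinfeld_algebra phi /\ reduces_to phi mu delta phi0.

Definition twist_coproduct (f : Shat (dsum V 2)) (a : Shat V)
    : Shat (dsum V 2) := bexp (P_ 2) f (D a).

Definition twist_associator (f : Shat (dsum V 2)) (phi : Shat (dsum V 3))
    : Shat (dsum V 3) :=
  let star := cbh (P_ 3) in
  star (star (star (star (shat_push (lift ord0) f) (coproduct_at D o2 f)) phi)
             (- coproduct_at D ord0 f))
       (- shat_push (lift ord_max) f).

End Drinfeld.

Section LieAlgebra.
Variables (K : fieldType) (g : lmodType K) (mu : g -> g -> g).

Definition kostant_kirillov : Shat g -> Shat g -> Shat g :=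
  shat_bider (fun u v => shat_var (mu u v)).

Definition primitive_coproduct : Shat g -> Shat (dsum g 2) :=
  shat_lift (fun v => \sum_(i < 2) shat_inj i (shat_var v)).

Definition sym_ad k (x : g) : symAlg (dsum g k) -> symAlg (dsum g k) :=
  sym_der id (fun v : dsum g k => sym_var [ffun i => mu x (v i)]).

Definition sym_invariant k (f : symAlg (dsum g k)) : Prop :=
  forall x, sym_ad x f = 0.

Definition shat_invariant k (f : Shat (dsum g k)) : Prop :=
  forall n, sym_invariant (f n).

End LieAlgebra.

(* Main.v *)
From HB Require Import structures.
Require Import Defs.
From mathcomp Require Import all_boot all_order all_algebra all_fingroup.
From mathcomp Require Import boolp ring zify.

Set Implicit Arguments.
Unset Strict Implicit.
Unset Printing Implicit Defensive.

Import GRing.Theory.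
Local Open Scope ring_scope.

(** On elements of order at least 2 the product [star] is a group law: sending
    f to the operator m |-> P(f, m) + (deg - 1)(f) m, cut off above degree N,
    is a representation of the Poisson bracket by nilpotent endomorphisms from
    which f can be recovered, and it turns [star] into the product of
    exponentials by Dynkin's formula (obtained, following the classical proof,
    from the derivation t d/dt of log(e^(tX) e^(tY))).

    As Delta_0 is diagonal, quasi-coassociativity says that the associator is
    g-invariant, so that only the pentagon is left, and invariant elements
    commute with everything that fills the slots they meet by one iterated
    coproduct.  If the pentagon holds in degrees < N, going around the boundary
    of the associahedron K_5 shows that its defect in degree N is a cocycle of
    the co-Hochschild complex of S(g).  The cohomology of this complex in n
    slots is the n-th exterior power, which lives in degree n: an explicit
    homotopy merges slots and moves linear factors into the last slot; it
    commutes with the action of g and preserves the vanishing of all counits.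
    Hence the defect in degree N > 4 can be corrected, which gives the lift
    degree by degree.  Likewise, if a twist of one lift agrees with another in
    degrees < N, they differ in degree N by a cocycle in three slots, which is
    a coboundary for N > 3, and also for N = 3 since its antisymmetrization
    vanishes; the twist is built degree by degree. *)

(** Every operator of the complex is an integer combination of algebra morphisms and of derivations
    along them, all induced by substitutions of slots. An identity between such operators on
    symmetric algebras of arbitrary vector spaces thus reduces to matching finite lists of labels,
    and only two sizes are needed: cochains in three slots for twists, in four for associators. The
    recursion of the homotopy passes through complexes with coefficient slots, frozen in degree one,
    and divides by the degree in the active slots; this is one use of characteristic 0. The Dynkin
    series is never manipulated directly afterwards. In the representation cut off at degree N, a
    perturbation of order N is absorbed by all other factors and enters additively, so that
    nonlinear equations vary by a coboundary. Vanishing counits in k slots force order at least k,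
    hence order at least 2, where [star] converges. The induction for the lift starts in degree 5
    because a bracket of two elements of order 3 has order 5: in degrees 3 and 4 the pentagon is
    still linear. *)

Section SymLiftMorphism.
Variables (K : fieldType) (V : lmodType K) (B : comAlgType K).
Variable u : {linear V -> B}.

Definition sym_ext : symAlg V -> B := sym_lift u.

Let u_lin : linear u. Proof. exact: linearP. Qed.

Fact sym_ext_is_zmod_morphism : zmod_morphism sym_ext.
Proof.
have sD := sym_liftD u_lin.
by move=> x y; apply: (addIr (sym_ext y)); rewrite -sD !subrK.
Qed.
HB.instance Definition _ :=
  GRing.isZmodMorphism.Build _ _ sym_ext sym_ext_is_zmod_morphism.

Fact sym_ext_is_monoid_morphism : monoid_morphism sym_ext.
Proof.
split; last exact: sym_liftM u_lin.
by have /= := sym_lift_cst u_lin 1; rewrite !scale1r.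
Qed.
HB.instance Definition _ :=
  GRing.isMonoidMorphism.Build _ _ sym_ext sym_ext_is_monoid_morphism.

Fact sym_ext_is_scalable : scalable sym_ext.
Proof.
move=> c x.
by rewrite -[x in c *: x]mul1r scalerAl rmorphM /= /sym_ext (sym_lift_cst u_lin)
  mulr_algl.
Qed.
HB.instance Definition _ :=
  GRing.isScalable.Build _ _ _ _ sym_ext sym_ext_is_scalable.

Lemma sym_ext_var v : sym_ext (sym_var v) = u v.
Proof. exact: sym_lift_var. Qed.

Lemma eq_sym_ext (h : {lrmorphism symAlg V -> B}) :
  (forall v, h (sym_var v) = u v) -> h =1 sym_ext.
Proof. exact: sym_lift_unique. Qed.

End SymLiftMorphism.

(** * Functoriality of the symmetric algebra and derivations along its morphisms *)

Section SymMap.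
Variables (K : fieldType) (V W : lmodType K).

Definition sym_map (A : {linear V -> W}) : symAlg V -> symAlg W :=
  sym_ext (sym_var \o A).

HB.instance Definition _ (A : {linear V -> W}) :=
  GRing.LRMorphism.on (sym_map A).

Lemma sym_map_var (A : {linear V -> W}) v : sym_map A (sym_var v) = sym_var (A v).
Proof. exact: sym_ext_var. Qed.

Lemma eq_sym_map (A B : {linear V -> W}) : A =1 B -> sym_map A =1 sym_map B.
Proof.
move=> AB; apply: (@eq_sym_ext _ _ _ _ (sym_map A)) => v.
by rewrite /= [LHS]sym_map_var AB.
Qed.

Variables (A B : {linear V -> W}).

(** This is the coefficient of e in [sym_map (A + e B)] with e ^ 2 = 0, i.e. the first-order
    variation of the morphism induced by [A]. *)
Definition tder : symAlg V -> symAlg W := sym_der (sym_map A) (sym_var \o B).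

Let B_lin : linear (sym_var \o B). Proof. exact: linearP. Qed.

Lemma tderM x y : tder (x * y) = tder x * sym_map A y + sym_map A x * tder y.
Proof. exact: sym_derM. Qed.

Lemma tder_var v : tder (sym_var v) = sym_var (B v).
Proof. exact: (sym_der_var _ B_lin). Qed.

Lemma tder_cst c : tder c%:A = 0.
Proof. exact: (sym_der_cst (sym_map A) B_lin). Qed.

Fact tder_is_zmod_morphism : zmod_morphism tder.
Proof.
have sD := sym_derD (sym_map A) B_lin.
by move=> x y; apply: (addIr (tder y)); rewrite -sD !subrK.
Qed.
HB.instance Definition _ :=
  GRing.isZmodMorphism.Build _ _ tder tder_is_zmod_morphism.

Fact tder_is_scalable : scalable tder.
Proof.
move=> c x; rewrite -[x in c *: x]mul1r scalerAl tderM tder_cst mul0r add0r.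
by rewrite linearZ_LR rmorph1 mulr_algl.
Qed.
HB.instance Definition _ :=
  GRing.isScalable.Build _ _ _ _ tder tder_is_scalable.

End SymMap.

Section TderTheory.
Variable K : fieldType.

Lemma tder_unique (V W : lmodType K) (A B : {linear V -> W})
    (D : {linear symAlg V -> symAlg W}) :
  (forall x y, D (x * y) = D x * sym_map A y + sym_map A x * D y) ->
  (forall v, D (sym_var v) = sym_var (B v)) -> D =1 tder A B.
Proof.
move=> DM Dv; have D1 : D 1 = 0.
  have := DM 1 1; rewrite !rmorph1 !mulr1 mul1r => /esym/eqP.
  by rewrite -subr_eq0 addrK => /eqP.
elim/sym_ind => [v|c|x y hx hy|x y hx hy].
- by rewrite Dv tder_var.
- by rewrite linearZ /= D1 scaler0 tder_cst.
- by rewrite !linearD hx hy.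
- by rewrite DM tderM hx hy.
Qed.

Lemma eq_tder (V W : lmodType K) (A B A' B' : {linear V -> W}) :
  A =1 A' -> B =1 B' -> tder A B =1 tder A' B'.
Proof.
move=> AA BB; apply: tder_unique => [x y|v] /=; last by rewrite [LHS]tder_var BB.
by rewrite [LHS]tderM !(eq_sym_map AA).
Qed.

Lemma sym_map_comp (U V W : lmodType K) (A : {linear V -> W})
    (B : {linear U -> V}) x : sym_map A (sym_map B x) = sym_map (A \o B) x.
Proof.
apply: (@eq_sym_ext _ _ _ _ (sym_map A \o sym_map B)) => v /=.
by rewrite !sym_map_var.
Qed.

Lemma sym_map_tder (U V W : lmodType K) (C : {linear V -> W})
    (A B : {linear U -> V}) x :
  sym_map C (tder A B x) = tder (C \o A) (C \o B) x.
Proof.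
apply: (@tder_unique _ _ _ _ (sym_map C \o tder A B)) => [y z|v] /=.
  by rewrite tderM rmorphD !rmorphM /= !sym_map_comp.
by rewrite tder_var sym_map_var.
Qed.

Lemma tder_sym_map (U V W : lmodType K) (A B : {linear V -> W})
    (C : {linear U -> V}) x :
  tder A B (sym_map C x) = tder (A \o C) (B \o C) x.
Proof.
apply: (@tder_unique _ _ _ _ (tder A B \o sym_map C)) => [y z|v] /=.
  by rewrite rmorphM tderM /= !sym_map_comp.
by rewrite sym_map_var tder_var.
Qed.

Lemma tderDr (V W : lmodType K) (A B C : {linear V -> W}) x :
  tder A (B \+ C) x = tder A B x + tder A C x.
Proof.
symmetry; apply: (@tder_unique _ _ _ _ (tder A B \+ tder A C)) => [y z|v] /=.
  by rewrite !tderM mulrDl mulrDr addrACA.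
by rewrite !tder_var /= linearD.
Qed.

Lemma tderZr (V W : lmodType K) (A B : {linear V -> W}) c x :
  tder A (c \*: B) x = c *: tder A B x.
Proof.
symmetry; apply: (@tder_unique _ _ _ _ (c \*: tder A B)) => [y z|v] /=.
  by rewrite !tderM scalerDr scalerAl scalerAr.
by rewrite !tder_var /= linearZ.
Qed.

Lemma tder0r (V W : lmodType K) (A B : {linear V -> W}) x :
  (forall v, B v = 0) -> tder A B x = 0.
Proof.
move=> B0; symmetry; apply: (@tder_unique _ _ _ _ \0) => [y z|v] /=.
  by rewrite mulr0 mul0r addr0.
by rewrite B0 linear0.
Qed.

(* The products of first-order terms match, so the difference of the two      *)
(* compositions is again a derivation.                                        *)
Lemma tder_comm (U V V' W : lmodType K) (A1 B1 : {linear V -> W})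
    (A2 B2 : {linear U -> V}) (A3 B3 : {linear V' -> W})
    (A4 B4 : {linear U -> V'}) (C : {linear U -> W}) x :
  A1 \o A2 =1 A3 \o A4 -> A1 \o B2 =1 B3 \o A4 -> B1 \o A2 =1 A3 \o B4 ->
  (forall v, C v = B1 (B2 v) - B3 (B4 v)) ->
  tder A1 B1 (tder A2 B2 x) - tder A3 B3 (tder A4 B4 x) = tder (A1 \o A2) C x.
Proof.
move=> h1 h2 h3 hC.
apply: (@tder_unique _ _ _ _
  ((tder A1 B1 \o tder A2 B2) \- (tder A3 B3 \o tder A4 B4))) => [y z|v] /=.
  have e0 t : sym_map A3 (sym_map A4 t) = sym_map A1 (sym_map A2 t).
    by rewrite !sym_map_comp (eq_sym_map h1).
  have e1 t : tder A3 B3 (sym_map A4 t) = sym_map A1 (tder A2 B2 t).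
    by rewrite tder_sym_map sym_map_tder (eq_tder h1 h2).
  have e2 t : sym_map A3 (tder A4 B4 t) = tder A1 B1 (sym_map A2 t).
    by rewrite tder_sym_map sym_map_tder (eq_tder h1 h3).
  rewrite !tderM !linearD /= !tderM !e0 !e1 !e2 -!sym_map_comp.
  by ring.
by rewrite !tder_var hC -linearB.
Qed.

End TderTheory.

(** * Substitutions of slots *)

(* A sequence s of labels encodes the linear map (v_1, .., v_m) |->           *)
(* (v_(s_1), .., v_(s_n)) with v_0 = 0: slots are numbered from 1, and the    *)
(* label 0 stands for an empty slot.                                          *)
Definition label_comp (s t : seq nat) : seq nat := [seq nth 0%N (0%N :: t) l | l <- s].

Section Blocks.
Variables (K : fieldType) (V : lmodType K).

(** Written as a sum so that labels can be plain naturals: label 0 and labels beyond m both read 0,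
    and linearity is immediate. *)
Definition slot m (v : dsum V m) (l : nat) : V :=
  \sum_(i < m) (l == i.+1)%:R *: v i.

Definition blk m n (s : seq nat) (v : dsum V m) : dsum V n :=
  [ffun j : 'I_n => slot v (nth 0%N s j)].

Fact blk_is_linear m n s : linear (@blk m n s).
Proof.
move=> c u v; apply/ffunP => j; rewrite !ffunE /slot scaler_sumr -big_split /=.
by apply: eq_bigr => i _; rewrite !ffunE scalerDr !scalerA mulrC.
Qed.
HB.instance Definition _ m n s :=
  GRing.isLinear.Build _ _ _ _ (@blk m n s) (@blk_is_linear m n s).

Lemma slot0 m (v : dsum V m) : slot v 0 = 0.
Proof. by rewrite /slot big1 // => i _; rewrite scale0r. Qed.

Lemma slot_ord m (v : dsum V m) (i : 'I_m) : slot v i.+1 = v i.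
Proof.
rewrite /slot (bigD1 i) //= eqxx scale1r big1 ?addr0 // => j /negPf ji.
by rewrite eqSS eq_sym (inj_eq val_inj) ji scale0r.
Qed.

Lemma slot_ge m (v : dsum V m) l : (m < l)%N -> slot v l = 0.
Proof.
move=> ml; rewrite /slot big1 // => i _.
by rewrite gtn_eqF ?scale0r // (leq_ltn_trans _ ml).
Qed.

Lemma slot_blk m n s (v : dsum V m) l : size s = n ->
  slot (blk n s v) l = slot v (nth 0%N (0%N :: s) l).
Proof.
case: l => [|l] sn /=; first by rewrite !slot0.
have [ln|nl] := ltnP l n; first by rewrite -[l]/(val (Ordinal ln)) slot_ord ffunE.
by rewrite slot_ge // nth_default ?slot0 // sn.
Qed.

Lemma blk_comp m n k s t (v : dsum V m) : size t = n ->
  blk k s (blk n t v) = blk k (label_comp s t) v.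
Proof.
move=> tn; apply/ffunP => j; rewrite !ffunE slot_blk //.
have [js|sj] := ltnP j (size s); first by rewrite (nth_map 0%N).
by rewrite !(@nth_default _ _ _ j) ?size_map.
Qed.

Lemma blk_iota n (v : dsum V n) : blk n (iota 1 n) v = v.
Proof. by apply/ffunP => j; rewrite ffunE nth_iota // add1n slot_ord. Qed.

Lemma blk_zero m n s (v : dsum V m) : all (pred1 0%N) s -> blk n s v = 0.
Proof.
move=> s0; apply/ffunP => j; rewrite !ffunE.
have [js|sj] := ltnP j (size s); last by rewrite nth_default ?slot0.
by rewrite (eqP (allP s0 _ (mem_nth 0%N js))) slot0.
Qed.

(** Operators are given by explicit lists of coefficients and labels, so that identities between
    them can be decided on the lists. The coefficients are integers to make the decision independent
    of the field. *)
Definition smap_op m n (f : seq (int * seq nat)) (x : symAlg (dsum V m)) :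
    symAlg (dsum V n) :=
  \sum_(p <- f) p.1%:~R *: sym_map (@blk m n p.2) x.

Definition tder_op m n (f : seq (int * (seq nat * seq nat)))
    (x : symAlg (dsum V m)) : symAlg (dsum V n) :=
  \sum_(p <- f) p.1%:~R *: tder (@blk m n p.2.1) (@blk m n p.2.2) x.

Fact smap_op_is_linear m n f : linear (@smap_op m n f).
Proof.
move=> c x y; rewrite /smap_op scaler_sumr -big_split /=; apply: eq_bigr => p _.
by rewrite linearP scalerDr !scalerA mulrC.
Qed.
HB.instance Definition _ m n f :=
  GRing.isLinear.Build _ _ _ _ (@smap_op m n f) (@smap_op_is_linear m n f).

Fact tder_op_is_linear m n f : linear (@tder_op m n f).
Proof.
move=> c x y; rewrite /tder_op scaler_sumr -big_split /=; apply: eq_bigr => p _.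
by rewrite linearP scalerDr !scalerA mulrC.
Qed.
HB.instance Definition _ m n f :=
  GRing.isLinear.Build _ _ _ _ (@tder_op m n f) (@tder_op_is_linear m n f).

End Blocks.

(** A fold rather than a big operator, so that the null tests below evaluate. *)
Definition int_sum (T : Type) (s : seq T) (F : T -> int) : int :=
  foldr (fun p z => F p + z) 0 s.

Lemma int_sumE T (s : seq T) F : int_sum s F = \sum_(p <- s) F p.
Proof. by elim: s => [|p s IH] /=; rewrite (big_nil, big_cons) ?IH. Qed.

Definition smap_null (f : seq (int * seq nat)) : bool :=
  all (fun a => int_sum f (fun p => if p.2 == a then p.1 else 0) == 0)
    (undup [seq p.2 | p <- f]).

(** [tder A B] is linear in [B] for fixed [A]. Terms are therefore grouped by their first label, and
    within each group the 0-1 matrices encoded by the second labels must add up to zero, entry by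
    entry. *)
Definition tder_null m n (f : seq (int * (seq nat * seq nat))) : bool :=
  all (fun a => all (fun j => all (fun i =>
      int_sum f (fun p => if (p.2.1 == a) && (nth 0%N p.2.2 j == i.+1)
                          then p.1 else 0) == 0) (iota 0 m)) (iota 0 n))
    (undup [seq p.2.1 | p <- f]).

Lemma sum_by_key (T : Type) (X : eqType) (M : zmodType) (key : T -> X)
    (f : seq T) (F : T -> M) :
  \sum_(p <- f) F p =
  \sum_(a <- undup (map key f)) \sum_(p <- f | key p == a) F p.
Proof.
rewrite (eq_bigr (fun a => \sum_(p <- f) (if key p == a then F p else 0)));
  last by move=> a _; rewrite big_mkcond.
rewrite exchange_big /=.
pose P (p : T) := key p \in undup (map key f).
have aux g : (forall a, a \in map key g -> a \in undup (map key f)) ->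
    \sum_(p <- g) F p =
    \sum_(p <- g) \sum_(a <- undup (map key f)) (if key p == a then F p else 0).
  elim: g => [|p g IH] sg; rewrite !(big_nil, big_cons) // -IH; last first.
    by move=> a ag; apply: sg; rewrite inE ag orbT.
  congr (_ + _).
  rewrite (bigD1_seq (key p)) ?undup_uniq ?sg ?mem_head //= eqxx big1 ?addr0 //.
  by move=> a /negPf; rewrite eq_sym => ->.
by apply: aux => a; rewrite mem_undup.
Qed.

Section Reflection.
Variables (K : fieldType) (V : lmodType K).
Implicit Types m n k : nat.

Lemma smap_nullP m n f : smap_null f ->
  forall x : symAlg (dsum V m), smap_op n f x = 0.
Proof.
move=> /allP f0 x; rewrite /smap_op (sum_by_key (fun p => p.2)) /= big_seq big1 //.
move=> a /f0; rewrite int_sumE -big_mkcond /= => /eqP fa.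
rewrite (eq_bigr (fun p => p.1%:~R *: sym_map (@blk K V m n a) x)); last first.
  by move=> p /eqP ->.
by rewrite -scaler_suml -rmorph_sum fa scale0r.
Qed.

(** The terms with a common first label add up to a derivation along one morphism, which vanishes as
    soon as it does on generators; there the sum is the one of matrices that the test evaluates. *)
Lemma tder_nullP m n f : tder_null m n f ->
  forall x : symAlg (dsum V m), tder_op n f x = 0.
Proof.
move=> /allP f0 x; rewrite /tder_op (sum_by_key (fun p => p.2.1)) /=.
rewrite big_seq big1 // => a /f0 {f0} /allP fa.
rewrite (eq_bigr (fun p => p.1%:~R *: tder (@blk K V m n a) (blk n p.2.2) x));
  last by move=> p /eqP ->.
elim/sym_ind: x => [v|c|x y hx hy|x y hx hy].
- under eq_bigr => p _ do rewrite tder_var -linearZ.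
  rewrite -linear_sum (_ : \sum_(p <- f | _) _ = 0) ?linear0 //.
  apply/ffunP => j; rewrite !ffunE sum_ffunE.
  under eq_bigr => p _ do rewrite !ffunE /slot scaler_sumr.
  rewrite exchange_big /= big1 // => i _.
  under eq_bigr => p _ do rewrite scalerA.
  rewrite -scaler_suml.
  have := allP (fa j _) i; rewrite !mem_iota /= !ltn_ord => /(_ isT isT)/eqP.
  rewrite int_sumE => e.
  rewrite (_ : \sum_(p <- f | _) _ = (\sum_(p <- f)
     (if (p.2.1 == a) && (nth 0%N p.2.2 j == i.+1) then p.1 else 0))%:~R :> K).
    by rewrite e scale0r.
  rewrite rmorph_sum /= big_mkcond /=; apply: eq_bigr => p _.
  by case: (_ == a) => //=; case: (_ == _); rewrite ?mulr1 ?mulr0.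
- by rewrite big1 // => p _; rewrite tder_cst scaler0.
- by under eq_bigr => p _ do rewrite linearD scalerDr; rewrite big_split /= hx hy addr0.
- under eq_bigr => p _ do rewrite tderM scalerDr scalerAl scalerAr.
  by rewrite big_split /= -mulr_suml -mulr_sumr hx hy mul0r mulr0 addr0.
Qed.

Lemma tder_op_cat m n f g (x : symAlg (dsum V m)) :
  tder_op n (f ++ g) x = tder_op n f x + tder_op n g x.
Proof. by rewrite /tder_op big_cat. Qed.

Definition tder_neg (f : seq (int * (seq nat * seq nat))) :=
  [seq (- p.1, p.2) | p <- f].

Lemma tder_op_neg m n f (x : symAlg (dsum V m)) :
  tder_op n (tder_neg f) x = - tder_op n f x.
Proof.
rewrite /tder_op big_map -sumrN; apply: eq_bigr => p _ /=.
by rewrite rmorphN scaleNr.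
Qed.

Lemma tder_op_eq m n f g (x : symAlg (dsum V m)) :
  tder_null m n (f ++ tder_neg g) -> tder_op n f x = tder_op n g x.
Proof.
move/tder_nullP/(_ x); rewrite tder_op_cat tder_op_neg => /eqP.
by rewrite subr_eq0 => /eqP.
Qed.

Definition smap_smap (f g : seq (int * seq nat)) :=
  [seq (p.1 * q.1, label_comp p.2 q.2) | p <- f, q <- g].
Definition smap_tder (f : seq (int * seq nat)) (g : seq (int * (seq nat * seq nat))) :=
  [seq (p.1 * q.1, (label_comp p.2 q.2.1, label_comp p.2 q.2.2)) | p <- f, q <- g].
Definition tder_smap (f : seq (int * (seq nat * seq nat))) (g : seq (int * seq nat)) :=
  [seq (p.1 * q.1, (label_comp p.2.1 q.2, label_comp p.2.2 q.2)) | p <- f, q <- g].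
Definition smap_wf n (g : seq (int * seq nat)) := all (fun p => size p.2 == n) g.
Definition tder_wf n (g : seq (int * (seq nat * seq nat))) :=
  all (fun p => (size p.2.1 == n) && (size p.2.2 == n)) g.

Lemma smap_smapE m n k f g (x : symAlg (dsum V m)) : smap_wf n g ->
  smap_op k f (smap_op n g x) = smap_op k (smap_smap f g) x.
Proof.
move=> /allP gn; rewrite /smap_op big_allpairs_dep; apply: eq_bigr => p _.
rewrite linear_sum scaler_sumr !big_seq; apply: eq_bigr => q /gn/eqP qn.
rewrite linearZ /= scalerA -intrM sym_map_comp; congr (_ *: _).
by apply: eq_sym_map => v /=; rewrite blk_comp.
Qed.

Lemma smap_tderE m n k f g (x : symAlg (dsum V m)) : tder_wf n g ->
  smap_op k f (tder_op n g x) = tder_op k (smap_tder f g) x.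
Proof.
move=> /allP gn; rewrite /smap_op /tder_op big_allpairs_dep; apply: eq_bigr => p _.
rewrite linear_sum scaler_sumr !big_seq; apply: eq_bigr => q /gn/andP[/eqP q1 /eqP q2].
rewrite linearZ /= scalerA -intrM sym_map_tder; congr (_ *: _).
by apply: eq_tder => v /=; rewrite blk_comp.
Qed.

Lemma tder_smapE m n k f g (x : symAlg (dsum V m)) : smap_wf n g ->
  tder_op k f (smap_op n g x) = tder_op k (tder_smap f g) x.
Proof.
move=> /allP gn; rewrite /smap_op /tder_op big_allpairs_dep; apply: eq_bigr => p _.
rewrite linear_sum scaler_sumr !big_seq; apply: eq_bigr => q /gn/eqP qn.
rewrite linearZ /= scalerA -intrM tder_sym_map; congr (_ *: _).
by apply: eq_tder => v /=; rewrite blk_comp.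
Qed.

Definition tder1 m n (ab : seq nat * seq nat) (x : symAlg (dsum V m)) :
    symAlg (dsum V n) := tder (blk n ab.1) (blk n ab.2) x.

Fact tder1_is_linear m n ab : linear (@tder1 m n ab).
Proof. by move=> c x y; rewrite /tder1 linearP. Qed.
HB.instance Definition _ m n ab :=
  GRing.isLinear.Build _ _ _ _ (@tder1 m n ab) (@tder1_is_linear m n ab).

Definition tder_comp1 (c : seq nat * seq nat) (f : seq (int * (seq nat * seq nat))) :=
  [seq (p.1, (label_comp c.1 p.2.1, label_comp c.2 p.2.2)) | p <- f].

Definition tder_linear_wf n (c : seq nat * seq nat) f :=
  tder_wf n f && all (fun p => all (pred1 0%N) (label_comp c.1 p.2.2)
                     && all (pred1 0%N) (label_comp c.2 p.2.1)) f.

(** A composite of two derivations has mixed terms, in which only one of the two differentiates a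
    given factor. Here these contain [c.1] after the second label or [c.2] after the first one, both
    zero, so the composite is a derivation again. *)
Lemma tder_op_linear m n k c f (x : symAlg (dsum V m)) : tder_linear_wf n c f ->
  tder1 k c (tder_op n f x) = tder_op k (tder_comp1 c f) x.
Proof.
case/andP => /allP fn /allP f0; rewrite /tder_op big_map linear_sum !big_seq.
apply: eq_bigr => p pf; have /andP[/eqP s1 /eqP s2] := fn _ pf.
have /andP[z1 z2] := f0 _ pf; rewrite linearZ /= /tder1; congr (_ *: _).
(* [tder_comm] compares two composites; the second one is chosen to vanish. *)
pose Z1 := (\0 : {linear dsum V m -> dsum V m}).
pose Z2 := (\0 : {linear dsum V m -> dsum V k}).
pose A : {linear dsum V m -> dsum V k} := blk k (label_comp c.1 p.2.1).
have h2 : @blk K V n k c.1 \o blk n p.2.2 =1 Z2 \o idfun.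
  by move=> v /=; rewrite blk_comp // blk_zero.
have h3 : @blk K V n k c.2 \o blk n p.2.1 =1 A \o Z1.
  by move=> v /=; rewrite blk_comp // blk_zero // linear0.
have h1 : @blk K V n k c.1 \o blk n p.2.1 =1 A \o idfun.
  by move=> v /=; rewrite blk_comp.
have hC v : @blk K V m k (label_comp c.2 p.2.2) v =
    @blk K V n k c.2 (blk n p.2.2 v) - Z2 (Z1 v) by rewrite blk_comp // subr0.
have := tder_comm x h1 h2 h3 hC.
rewrite (@tder0r _ _ _ idfun Z1) // linear0 subr0 => ->.
by apply: eq_tder => v //=; rewrite blk_comp.
Qed.

Definition tder_comm_wf m n (c d : seq nat * seq nat) f :=
  [&& tder_wf n f, size d.1 == m, size d.2 == m &
  all (fun p => [&& label_comp c.1 p.2.1 == label_comp p.2.1 d.1,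
     label_comp c.1 p.2.2 == label_comp p.2.2 d.1
   & label_comp c.2 p.2.1 == label_comp p.2.1 d.2]) f].

Definition tder_bracket (c d : seq nat * seq nat) f :=
  tder_comp1 c f ++ [seq (- p.1, (label_comp c.1 p.2.1, label_comp p.2.2 d.2)) | p <- f].

(** The compatibilities in [tder_comm_wf] make the second-order parts of the two composites equal.
    What is left of the commutator is of first order, hence again an explicit list to be tested. *)
Lemma tder_op_comm m n k c d f (x : symAlg (dsum V m)) : tder_comm_wf m n c d f ->
  tder1 k c (tder_op n f x) = tder_op k f (tder1 m d x) + tder_op k (tder_bracket c d f) x.
Proof.
case/and4P => /allP fn /eqP d1 /eqP d2 /allP f0.
apply/eqP; rewrite addrC -subr_eq tder_op_cat; apply/eqP.
rewrite /tder_op !big_map linear_sum -sumrB -big_split /= !big_seq.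
apply: eq_bigr => p pf; have /andP[/eqP s1 /eqP s2] := fn _ pf.
have /and3P[/eqP e1 /eqP e2 /eqP e3] := f0 _ pf; rewrite linearZ /= /tder1.
rewrite intrN scaleNr -scalerBr -scalerBr; congr (_ *: _).
rewrite (@tder_comm K _ _ _ _ (blk k c.1) (blk k c.2) (blk n p.2.1) (blk n p.2.2)
  (blk k p.2.1) (blk k p.2.2) (blk m d.1) (blk m d.2)
  (blk k (label_comp c.2 p.2.2) \- blk k (label_comp p.2.2 d.2)) x).
- rewrite -scaleN1r -tderZr -tderDr; apply: eq_tder => v /=; rewrite ?blk_comp //.
  by rewrite scaleN1r.
- by move=> v /=; rewrite !blk_comp // e1.
- by move=> v /=; rewrite !blk_comp // e2.
- by move=> v /=; rewrite !blk_comp // e3.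
- by move=> v /=; rewrite !blk_comp.
Qed.

End Reflection.

(** * The co-Hochschild complex of the symmetric algebra *)

(* Cochains of degree k in n slots: the slots k+1, .., n are coefficients.    *)
(* face k n m applies the coproduct to slot m (to the left or right of        *)
(* everything for m = 0 or m = k + 1).                                        *)
Definition face k n m : seq nat :=
  [seq (if (m <= k)%N then if (j <= m)%N then j else j.-1
        else if j == k.+1 then 0%N else if (j <= k)%N then j else j.-1)
  | j <- iota 1 n.+1].

Definition alt_sign (i : nat) : int := if odd i then -1 else 1.

Definition cobound k n : seq (int * seq nat) :=
  [seq (alt_sign m, face k n m) | m <- iota 0 k.+2].

(* Merges slot i into a later slot j <= k, keeping the other slots fixed.     *)
Definition homotopy k n : seq (int * (seq nat * seq nat)) :=
  [seq (alt_sign i, ([seq (if (j < i)%N then j else j.+1) | j <- iota 1 n],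
                    [seq (if (i <= j <= k)%N then i else 0%N) | j <- iota 1 n]))
  | i <- iota 1 k].

(* Moves a linear factor out of slot i <= k into the coefficient slot k.      *)
Definition to_end k n : seq (int * (seq nat * seq nat)) :=
  [seq (alt_sign (k - i),
     ([seq (if (j < i)%N then j else if (j < k)%N then j.+1
            else if j == k then 0%N else j) | j <- iota 1 n],
      [seq (if j == k then i else 0%N) | j <- iota 1 n]))
  | i <- iota 1 k].

Definition erase n p : seq nat := [seq (if j == p then 0%N else j) | j <- iota 1 n].

(** As a derivation this keeps slot p in one factor and erases it in all others: it is the
    projection onto the part of degree exactly one in slot p. *)
Definition lin_slot n p : seq nat * seq nat :=
  (erase n p, [seq (if j == p then j else 0%N) | j <- iota 1 n]).

(** The Euler operator of the first k slots, whose eigenvalues are the total degrees in these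
    slots. *)
Definition euler k n : seq nat * seq nat :=
  (iota 1 n, [seq (if (j <= k)%N then j else 0%N) | j <- iota 1 n]).

Definition avoids_label (p : nat) (ab : seq nat * seq nat) :=
  (p \notin ab.1) && (p \notin ab.2).

(** After erasing output slot p, each term either loses its differentiated factor or no longer reads
    some input slot q. In the latter case it factors through the counit of slot q and kills whatever
    that counit kills. *)
Definition erase_stable m n (f : seq (int * (seq nat * seq nat))) :=
  all (fun p => all (fun c =>
    let ab := (label_comp (erase n p) c.2.1, label_comp (erase n p) c.2.2) in
    all (pred1 0%N) ab.2 || has (fun q => avoids_label q ab) (iota 1 m)) f)
  (iota 1 n).

(* All the identities between operators needed to go from k + 1 to k.         *)
Definition contraction_check k n : bool :=
  let K := k.+1 in let N := n.+1 in
  [&& [&& smap_wf N.+1 (cobound K N), tder_wf n (homotopy k n), tder_wf N (to_end K N)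
       & tder_null N N ((tder_smap (homotopy K N) (cobound K N) ++
           smap_tder (cobound k n) (homotopy k n)) ++
           tder_neg ((1, euler K N) :: tder_neg (to_end K N)))],
      smap_wf N (cobound k n) &&
      smap_null (smap_smap (cobound K N) (cobound k n)),
      tder_comm_wf N N (euler k N) (euler K N) (to_end K N) &&
      tder_null N N (tder_bracket (euler k N) (euler K N) (to_end K N) ++ to_end K N),
      tder_linear_wf N (lin_slot N K) (to_end K N) &&
      tder_null N N (tder_comp1 (lin_slot N K) (to_end K N) ++ tder_neg (to_end K N)),
      all (fun p => tder_comm_wf N N (lin_slot N p) (lin_slot N p) (to_end K N) &&
        tder_null N N (tder_bracket (lin_slot N p) (lin_slot N p) (to_end K N)))
        (iota K.+1 (N - K)),
      all (fun p => tder_comm_wf N n (lin_slot n p) (lin_slot N p.+1) (homotopy k n) &&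
        tder_null N n (tder_bracket (lin_slot n p) (lin_slot N p.+1) (homotopy k n)))
        (iota K (n - k)),
      tder_wf N [:: (1, lin_slot N K)] &&
      tder_null N N.+1 (smap_tder (cobound K N) [:: (1, lin_slot N K)] ++
         tder_neg (smap_tder (cobound k N) [:: (1, lin_slot N K)])),
      (k == 0%N) || tder_wf n [:: (1, lin_slot n k)] &&
      tder_null n N (smap_tder (cobound k n) [:: (1, lin_slot n k)] ++
         tder_neg (smap_tder (cobound k.-1 n) [:: (1, lin_slot n k)]))
    & erase_stable N N (to_end K N) && erase_stable N n (homotopy k n)].

(** With k at most n there are only seven cases, three for n = 2 and four for n = 3. *)
Lemma contraction_checks k n : (k <= n)%N -> n \in [:: 2; 3]%N -> contraction_check k n.
Proof.
rewrite !inE => kn /orP[] /eqP En; move: kn; rewrite {}En;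
  by do 4?[case: k => [|k]] => // _; vm_compute.
Qed.

Section Contraction.
Variables (K : fieldType) (V : lmodType K) (n : nat).
Hypothesis n23 : n \in [:: 2; 3]%N.
Implicit Types (k : nat) (c : K) (x : symAlg (dsum V n.+1)).

(** With h the [homotopy], T the operator [to_end] and E the Euler operator of the k active slots, h
    d + d h = E - T. On a cocycle with E = c this gives x = (d h x + T x) / c, and T x is treated in
    turn, with one active slot and one degree less. *)
Fixpoint contract k c x : symAlg (dsum V n) :=
  if k is k'.+1 then
    c^-1 *: (tder_op n (homotopy k' n) x
             + contract k' (c - 1) (tder_op n.+1 (to_end k n.+1) x))
  else 0.

Fixpoint all_to_end k x : symAlg (dsum V n.+1) :=
  if k is k'.+1 then all_to_end k' (tder_op n.+1 (to_end k n.+1) x) else x.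

(** The slots beyond k, which act as coefficients, are occupied by exactly one linear factor
    each. *)
Definition linear_from m k (y : symAlg (dsum V m)) : Prop :=
  forall p, (k < p <= m)%N -> tder1 m (lin_slot m p) y = y.

Lemma tder1E m1 m2 ab (y : symAlg (dsum V m1)) :
  tder1 m2 ab y = tder_op m2 [:: (1, ab)] y.
Proof. by rewrite /tder_op big_seq1 scale1r. Qed.

Lemma tder_op_cons m1 m2 p f (y : symAlg (dsum V m1)) :
  tder_op m2 (p :: f) y = p.1%:~R *: tder1 m2 p.2 y + tder_op m2 f y.
Proof. by rewrite /tder_op big_cons. Qed.

Lemma euler0 m (y : symAlg (dsum V m)) : tder1 m (euler 0 m) y = 0.
Proof.
apply: tder0r => v; apply: blk_zero; apply/allP => _ /mapP[j + ->].
by rewrite mem_iota; case: j.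
Qed.

(** Induction on the number k of active slots along the recursion of [contract]. The term T x has to
    satisfy all the hypotheses again for k - 1 and c - 1; when no active slot is left, the remainder
    has lost k degrees, one for each slot. *)
Lemma cobound_contract k c x : (k <= n.+1)%N ->
  linear_from k x -> smap_op n.+2 (cobound k n.+1) x = 0 ->
  tder1 n.+1 (euler k n.+1) x = c *: x -> (forall j, (j < k)%N -> c - j%:R != 0) ->
  [/\ x = smap_op n.+1 (cobound k.-1 n) (contract k c x)
          + (\prod_(j < k) (c - j%:R))^-1 *: all_to_end k x,
      linear_from k.-1 (contract k c x)
    & tder1 n.+1 (euler 0 n.+1) (all_to_end k x) = (c - k%:R) *: all_to_end k x].
Proof.
elim: k c x => [|k IH] c x kn xlin dx Ex c0.
  rewrite big_ord0 invr1 scale1r !linear0 add0r subr0; split => // p _.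
  by rewrite linear0.
have /and5P[/and4P[w1 w2 w3 t1] /andP[w4 t2] /andP[w5 t3] /andP[w6 t4]] :=
  @contraction_checks k n kn n23.
case/and5P => /allP t5 /allP t6 /andP[w7 t7] t8 _.
have c0' : c != 0 by have := c0 0%N isT; rewrite subr0.
set y := tder_op n.+1 (to_end k.+1 n.+1) x.
set z := tder_op n (homotopy k n) x.
(* The homotopy formula h d + d h = E - T, applied to a cocycle. *)
have xE : c *: x = smap_op n.+1 (cobound k n) z + y.
  have := tder_op_eq x t1; rewrite tder_op_cat -(tder_smapE _ _ _ w1) -(smap_tderE _ _ _ w2).
  rewrite dx linear0 add0r -/z => ->.
  by rewrite tder_op_cons tder_op_neg scale1r Ex subrK.
have dy : smap_op n.+2 (cobound k.+1 n.+1) y = 0.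
  have -> : y = c *: x - smap_op n.+1 (cobound k n) z by rewrite xE addrC addKr.
  by rewrite linearB linearZ /= dx scaler0 (smap_smapE _ _ _ w4) (smap_nullP _ t2) subrr.
have ylin0 : tder1 n.+1 (lin_slot n.+1 k.+1) y = y.
  by rewrite tder_op_linear //; apply: tder_op_eq.
have ylin : linear_from k y.
  move=> p /andP[kp pn]; have [->//|pk] := eqVneq p k.+1.
  have /andP[w t] : tder_comm_wf n.+1 n.+1 (lin_slot n.+1 p) (lin_slot n.+1 p)
      (to_end k.+1 n.+1) && tder_null n.+1 n.+1
        (tder_bracket (lin_slot n.+1 p) (lin_slot n.+1 p) (to_end k.+1 n.+1)).
    apply: t5; rewrite mem_iota; apply/andP; split; last by rewrite addSn subnKC.
    by rewrite ltn_neqAle eq_sym pk.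
  by rewrite (tder_op_comm _ _ w) (tder_nullP t) addr0 xlin // pn andbT
    ltn_neqAle eq_sym pk.
(* On a linear slot the coproduct is the sum of the two insertions of an empty slot. One of them
   cancels the last face, so the coboundaries with k + 1 and with k active slots agree on y. *)
have dky : smap_op n.+2 (cobound k n.+1) y = 0.
  rewrite -dy -ylin0 tder1E !smap_tderE //; symmetry; exact: tder_op_eq.
(* One linear factor has left the active slots, so the Euler eigenvalue drops by one. *)
have Ey : tder1 n.+1 (euler k n.+1) y = (c - 1) *: y.
  rewrite (tder_op_comm _ _ w5) Ex linearZ /= scalerBl scale1r; congr (_ + _).
  by apply/eqP; rewrite -addr_eq0 -tder_op_cat; apply/eqP/tder_nullP.
have c0y j : (j < k)%N -> c - 1 - j%:R != 0.
  by move=> jk; rewrite -addrA -opprD -[1 + _]/(1%:R + _) -natrD c0.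
have [yE hlin resE] := IH (c - 1) y (ltnW kn) ylin dky Ey c0y.
(* The recursive correction is linear in slot k, where the coboundaries with k - 1 and k active
   slots agree by the same cancellation; for k = 0 it is zero. *)
have dh : smap_op n.+1 (cobound k.-1 n) (contract k (c - 1) y) =
          smap_op n.+1 (cobound k n) (contract k (c - 1) y).
  case: (k) t8 hlin kn => [|k'] /=; first by rewrite !linear0.
  case/andP => w8 t8 hlin kn; rewrite -(hlin k'.+1); last by rewrite ltnSn -ltnS.
  by rewrite tder1E !smap_tderE //; symmetry; exact: tder_op_eq.
split=> /=.
- rewrite -/y -/z linearZ linearD /= -dh.
  rewrite -[LHS](scalerK c0') xE {1}yE addrA scalerDr; congr (_ + _).
  rewrite scalerA big_ord_recl /= subr0 invfM; congr (_ * _^-1 *: _).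
  by apply: eq_bigr => i _; rewrite /bump /= natrD opprD addrA.
- move=> p /andP[kp pn]; rewrite linearZ linearD /= -/y -/z hlin; last first.
    by rewrite pn andbT (leq_ltn_trans (leq_pred _) kp).
  congr (_ *: (_ + _)).
  have /andP[w t] : tder_comm_wf n.+1 n (lin_slot n p) (lin_slot n.+1 p.+1)
      (homotopy k n) && tder_null n.+1 n
        (tder_bracket (lin_slot n p) (lin_slot n.+1 p.+1) (homotopy k n)).
    by apply: t6; rewrite mem_iota kp addSn subnKC //.
  by rewrite (tder_op_comm _ _ w) (tder_nullP t) addr0 xlin // ltnS kp.
- by rewrite -/y resE -addrA -opprD -[1 + _]/(1%:R + _) -natrD add1n.
Qed.

Lemma tder_avoid m1 m2 q ab (y : symAlg (dsum V m1)) : (0 < q)%N ->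
  avoids_label q ab -> sym_map (blk m1 (erase m1 q)) y = 0 -> tder1 m2 ab y = 0.
Proof.
move=> q0 /andP[qa qb] y0.
have q_avoid s (v : dsum V m1) : q \notin s ->
    blk m2 s v = (blk m2 s \o blk m1 (erase m1 q)) v :> dsum V m2.
  move=> qs; rewrite /= blk_comp ?size_map ?size_iota //; apply/ffunP => j.
  rewrite !ffunE /label_comp; have [js|sj] := ltnP j (size s); last first.
    by rewrite !(@nth_default _ _ _ j) ?size_map.
  rewrite (nth_map 0%N) //.
  have : nth 0%N s j != q by apply: contraNneq qs => <-; exact: mem_nth.
  case: (nth 0%N s j) => [|l] //= lq; have [lm|ml] := ltnP l m1; last first.
    by rewrite slot_ge // nth_default ?slot0 // size_map size_iota.
  by rewrite (nth_map 0%N) ?size_iota // nth_iota // add1n (negPf lq).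
rewrite /tder1 (eq_tder (fun v => q_avoid _ v qa) (fun v => q_avoid _ v qb)).
by rewrite -tder_sym_map y0 linear0.
Qed.

Definition slots_erased m (y : symAlg (dsum V m)) : Prop :=
  forall p, (0 < p <= m)%N -> sym_map (blk m (erase m p)) y = 0.

(** Term by term, by the dichotomy that [erase_stable] records. *)
Lemma erased_tder_op m1 m2 f (y : symAlg (dsum V m1)) : tder_wf m2 f ->
  erase_stable m1 m2 f -> slots_erased y -> slots_erased (tder_op m2 f y).
Proof.
move=> /allP fw /allP fs y0 p /andP[p0 pm].
have /fs/allP fp : p \in iota 1 m2 by rewrite mem_iota p0.
rewrite /tder_op linear_sum big_seq big1 // => c cf; rewrite linearZ /=.
have /andP[/eqP s1 /eqP s2] := fw _ cf.
rewrite sym_map_tder; set e := erase m2 p.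
rewrite (@eq_tder _ _ _ _ _ (blk m2 (label_comp e c.2.1))
  (blk m2 (label_comp e c.2.2))); try by move=> v /=; rewrite blk_comp.
have /orP[z|/hasP[q]] := fp _ cf.
  by rewrite tder0r ?scaler0 // => v; exact: blk_zero.
rewrite mem_iota add1n ltnS => /andP[q0 qm] qav.
have := tder_avoid m2 q0 qav (y0 q _).
by rewrite /tder1 => -> //; rewrite ?scaler0 ?q0.
Qed.

Lemma erased_contract k c x :
  (k <= n.+1)%N -> slots_erased x -> slots_erased (contract k c x).
Proof.
elim: k c x => [|k IH] c x kn x0 p pn; first by rewrite linear0.
have /and5P[/and4P[w1 w2 w3 t1] _ _ _] := @contraction_checks k n kn n23.
case/and5P => _ _ _ _ /andP[e1 e2] /=.
have y0 := erased_tder_op w3 e1 x0; have z0 := erased_tder_op w2 e2 x0.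
by rewrite linearZ linearD /= (z0 _ pn) (IH _ _ (ltnW kn) y0 _ pn) addr0 scaler0.
Qed.

Lemma contract_ind (Q : forall m, symAlg (dsum V m) -> Prop) k c x :
  (forall m, Q m 0) ->
  (forall m c y z, Q m y -> Q m z -> Q m (c *: (y + z))) ->
  (forall m1 m2 f y, Q m1 y -> tder_wf m2 f -> Q m2 (tder_op m2 f y)) ->
  (k <= n.+1)%N -> Q n.+1 x -> Q n (contract k c x).
Proof.
move=> Q0 QD QT; elim: k c x => [|k IH] c x kn Qx //=.
have /and5P[/and4P[w1 w2 w3 t1] _ _ _] := @contraction_checks k n kn n23.
by case/and5P => _ _ _ _ _; apply: QD; [apply: QT|apply: IH (ltnW kn) _; apply: QT].
Qed.

End Contraction.

(** * Degrees, exactness and invariance in the complex *)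

Section Homogeneous.
Variables (K : fieldType) (V : lmodType K).

Lemma homog_ind (n : nat) (Q : symAlg V -> Prop) :
  Q 0 -> (forall x y, Q x -> Q y -> Q (x + y)) -> (forall c x, Q x -> Q (c *: x)) ->
  (forall s : seq V, size s = n -> Q (\prod_(v <- s) sym_var v)) ->
  forall x, homog n x -> Q x.
Proof.
move=> Q0 QD QZ Qs x; elim=> // [y z _ Qy _ Qz|c _ [t ->]]; first exact: QD.
by apply: QZ; apply: Qs; rewrite size_tuple.
Qed.

Lemma homog_prod (s : seq V) : homog (size s) (\prod_(v <- s) sym_var v).
Proof. by rewrite -[\prod_(_ <- _) _]scale1r; apply: spanZ; exists (in_tuple s). Qed.

Lemma homogD n (x y : symAlg V) : homog n x -> homog n y -> homog n (x + y).
Proof. exact: spanD. Qed.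

Lemma homog0 n : homog n (0 : symAlg V). Proof. exact: span0. Qed.

End Homogeneous.

Section HomogeneousMaps.
Variables (K : fieldType) (V W : lmodType K).

Lemma homog_sym_map n (A : {linear V -> W}) x : homog n x -> homog n (sym_map A x).
Proof.
elim/homog_ind => [|y z hy hz|c y hy|s <-].
- by rewrite linear0; exact: homog0.
- by rewrite linearD; exact: homogD.
- by rewrite linearZ; exact: homogZ.
- rewrite rmorph_prod -(size_map A) (eq_bigr (fun v => sym_var (A v))); last first.
    by move=> v _; exact: sym_map_var.
  by rewrite -(big_map A xpredT sym_var); exact: homog_prod.
Qed.

Lemma homog_tder n (A B : {linear V -> W}) x : homog n x -> homog n (tder A B x).
Proof.
elim/homog_ind => [|y z hy hz|c y hy|s <-].
- by rewrite linear0; exact: homog0.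
- by rewrite linearD; exact: homogD.
- by rewrite linearZ; exact: homogZ.
elim: s => [|v s IH]; first by rewrite big_nil -[1]scale1r tder_cst; exact: homog0.
rewrite big_cons tderM tder_var sym_map_var /= -add1n; apply: homogD.
  by apply: homogM; [exact: homog_var|apply: homog_sym_map; exact: homog_prod].
by apply: homogM => //; exact: homog_var.
Qed.

Lemma tder_id_homog n (x : symAlg V) : homog n x -> tder idfun idfun x = n%:R *: x.
Proof.
have idE (y : symAlg V) : sym_map idfun y = y.
  by symmetry; apply: (@eq_sym_ext _ _ _ _ idfun) => v.
elim/homog_ind => [|y z hy hz|c y hy|s <-].
- by rewrite linear0 scaler0.
- by rewrite linearD /= hy hz scalerDr.
- by rewrite linearZ /= hy !scalerA mulrC.
elim: s => [|v s IH]; first by rewrite big_nil -[1]scale1r tder_cst scale0r.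
rewrite big_cons tderM tder_var IH !idE /= -scalerAr -{1}[_ * _]scale1r.
by rewrite -scalerDl -natr1 addrC.
Qed.

End HomogeneousMaps.

Section Exactness.
Variables (K : fieldType) (V : lmodType K).
Hypothesis K0 : [pchar K] =i pred0.

Lemma euler_homog m c (y : symAlg (dsum V m)) : homog c y ->
  tder1 m (euler m m) y = c%:R *: y.
Proof.
move=> hy; rewrite -tder_id_homog // /tder1 /euler /=.
have -> : [seq (if (j <= m)%N then j else 0%N) | j <- iota 1 m] = iota 1 m.
  rewrite -[RHS]map_id; apply/eq_in_map => j.
  by rewrite mem_iota add1n ltnS => /andP[_ ->].
by apply: eq_tder => v /=; rewrite blk_iota.
Qed.

(** On an element of degree c, all slots being active, the Euler eigenvalue is c. The Euler operator
    of no slot is zero, yet acts on the residue by c - (n + 1), so a residue can only survive in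
    degree n + 1. *)
Lemma cochain_residue n c (y : symAlg (dsum V n.+1)) : n \in [:: 2; 3]%N ->
  homog c y -> (n < c)%N -> smap_op n.+2 (cobound n.+1 n.+1) y = 0 ->
  y = smap_op n.+1 (cobound n n) (contract n.+1 c%:R y)
      + (\prod_(j < n.+1) (c%:R - j%:R))^-1 *: all_to_end n.+1 y /\
  ((n.+1 < c)%N -> all_to_end n.+1 y = 0).
Proof.
move=> n23 hy nc dy.
have natB a b : (b <= a)%N -> a%:R - b%:R = (a - b)%:R :> K.
  by move=> ba; rewrite natrB.
have nat0 a : (0 < a)%N -> a%:R != 0 :> K by move/pcharf0P: K0 => ->; rewrite lt0n.
have [|j jn|yE _ resE] := cobound_contract n23 (leqnn _) _ dy (euler_homog hy).
- by move=> p /andP[/ltn_geF ->].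
- have jc : (j < c)%N by apply: leq_trans jn nc.
  by rewrite (natB _ _ (ltnW jc)) nat0 // subn_gt0.
split=> // nc'; move/esym/eqP: resE.
rewrite euler0 scaler_eq0 (natB _ _ (ltnW nc')) (negPf (nat0 _ _)) ?subn_gt0 //.
by move/eqP.
Qed.

Lemma contract_homog n k c e (y : symAlg (dsum V n.+1)) : n \in [:: 2; 3]%N ->
  (k <= n.+1)%N -> homog e y -> homog e (contract k c y).
Proof.
move=> n23 kn; apply: (@contract_ind _ _ _ n23 (fun m y => homog e y)) => //.
- by move=> m; exact: homog0.
- by move=> m a u v hu hv; apply/homogZ/homogD.
- move=> m1 m2 f u hu _; apply: homog_sum => p _; apply: homogZ.
  exact: homog_tder.
Qed.

End Exactness.

Section Slotwise.
Variables (K : fieldType) (V : lmodType K).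

Definition slotwise k (u : {linear V -> V}) (v : dsum V k) : dsum V k :=
  [ffun i => u (v i)].

Fact slotwise_is_linear k u : linear (@slotwise k u).
Proof. by move=> c v w; apply/ffunP => i; rewrite !ffunE linearP. Qed.
HB.instance Definition _ k u :=
  GRing.isLinear.Build _ _ _ _ (@slotwise k u) (@slotwise_is_linear k u).

Lemma slotwise_blk m n s u (v : dsum V m) :
  slotwise u (blk n s v) = blk n s (slotwise u v).
Proof.
apply/ffunP => j; rewrite !ffunE /slot linear_sum; apply: eq_bigr => i _.
by rewrite linearZ ffunE.
Qed.

(** All the operators involved come from substitutions of slots, which commute with any endomorphism
    applied in every slot at once; the commutator with the action of [u] is then a derivation that
    is zero on generators. *)
Lemma contract_invariant n k c u (y : symAlg (dsum V n.+1)) : n \in [:: 2; 3]%N ->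
  (k <= n.+1)%N -> tder idfun (slotwise u) y = 0 ->
  tder idfun (slotwise u) (contract k c y) = 0.
Proof.
move=> n23 kn.
apply: (@contract_ind _ _ _ n23 (fun m y => tder idfun (@slotwise m u) y = 0)) => //.
- by move=> m; rewrite linear0.
- by move=> m a y1 y2 h1 h2; rewrite linearZ linearD /= h1 h2 addr0 scaler0.
move=> m1 m2 f y1 h1 _; rewrite /tder_op linear_sum big1 // => p _.
rewrite linearZ /=; pose Z : {linear dsum V m1 -> dsum V m2} := \0.
have := @tder_comm K _ _ _ _ idfun (slotwise u) (blk m2 p.2.1) (blk m2 p.2.2)
  (blk m2 p.2.1) (blk m2 p.2.2) idfun (slotwise u) Z y1.
rewrite h1 linear0 subr0 => -> //; first by rewrite tder0r ?scaler0.
- by move=> v /=; rewrite slotwise_blk.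
- by move=> v /=; rewrite slotwise_blk subrr.
Qed.

Lemma blk_eraseE m p (v : dsum V m) (j : 'I_m) :
  blk m (erase m p) v j = if j.+1 == p then 0 else v j.
Proof.
rewrite ffunE (nth_map 0%N) ?size_iota // nth_iota // add1n.
by case: ifP; rewrite ?slot0 ?slot_ord.
Qed.

Lemma tensor_lin_slot k p (x : symAlg (dsum V k)) : (0 < p <= k)%N -> tensor x ->
  tder1 k (lin_slot k p) x = x.
Proof.
case: p => // p /andP[_ pk]; elim=> [|y z _ hy _ hz|c _ [t ->]].
- by rewrite linear0.
- by rewrite linearD /= hy hz.
rewrite linearZ /=; congr (_ *: _); pose q := Ordinal pk.
rewrite (bigD1 q) //= /tder1 tderM tder_var sym_map_var /=.
have -> : blk k (erase k p.+1) (inj q (t q)) = 0.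
  apply/ffunP => j; rewrite blk_eraseE !ffunE eqSS -[p]/(val q) (inj_eq val_inj).
  by case: (j == q).
have -> : blk k [seq (if j == p.+1 then j else 0%N) | j <- iota 1 k] (inj q (t q))
    = inj q (t q).
  apply/ffunP => j; rewrite !ffunE (nth_map 0%N) ?size_iota // nth_iota // add1n.
  rewrite eqSS -[p]/(val q) (inj_eq val_inj).
  by case: ifP => [/eqP ->|_]; rewrite ?slot0 // slot_ord ffunE eqxx.
rewrite linear0 mul0r addr0 rmorph_prod; congr (_ * _); apply: eq_bigr => i iq.
rewrite /= sym_map_var; congr sym_var; apply/ffunP => j.
rewrite blk_eraseE !ffunE eqSS -[p]/(val q) (inj_eq val_inj).
by case: (j =P q) => // ->; rewrite eq_sym (negPf iq).
Qed.

Definition skip_slot q : seq nat :=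
  [seq (if (j < q)%N then j else if j == q then 0%N else j.-1) | j <- iota 1 4].

Lemma smap_op_cons m n p f (x : symAlg (dsum V m)) :
  smap_op n (p :: f) x = p.1%:~R *: sym_map (blk n p.2) x + smap_op n f x.
Proof. by rewrite /smap_op big_cons. Qed.

Lemma smap_op_cat m n f g (x : symAlg (dsum V m)) :
  smap_op n (f ++ g) x = smap_op n f x + smap_op n g x.
Proof. by rewrite /smap_op big_cat. Qed.

Lemma sym_map_smap m n s (x : symAlg (dsum V m)) :
  sym_map (blk n s) x = smap_op n [:: (1, s)] x.
Proof. by rewrite smap_op_cons /smap_op big_nil scale1r addr0. Qed.

Lemma smap_op_lin_slot m n p f g (x : symAlg (dsum V m)) :
  tder1 m (lin_slot m p) x = x -> tder_wf m [:: (1, lin_slot m p)] ->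
  tder_null m n (smap_tder f [:: (1, lin_slot m p)] ++
    tder_neg (smap_tder g [:: (1, lin_slot m p)])) ->
  smap_op n f x = smap_op n g x.
Proof. by move=> <- w t; rewrite tder1E !smap_tderE //; exact: tder_op_eq. Qed.

(** On an element linear in slot m, doubling that slot is the sum of the insertions of an empty slot
    just before and just after it. The alternating sum of the faces then telescopes. *)
Lemma tensor_cocycle (x : symAlg (dsum V 3)) : tensor x ->
  smap_op 4 (cobound 3 3) x = 0.
Proof.
move=> tx; have lx p : (0 < p <= 3)%N -> tder1 3 (lin_slot 3 p) x = x.
  by move=> p3; exact: tensor_lin_slot.
have face_skip m : (0 < m <= 3)%N -> sym_map (blk 4 (face 3 3 m)) x =
    smap_op 4 [:: (1, skip_slot m); (1, skip_slot m.+1)] x.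
  move=> m3; rewrite sym_map_smap; apply: (smap_op_lin_slot (lx m m3));
    by case: m m3 => [|[|[|[|m]]]] // _; vm_compute.
have : face 3 3 0 = skip_slot 1 by [].
have : face 3 3 4 = skip_slot 4 by [].
rewrite -[cobound 3 3]/[seq (alt_sign m, face 3 3 m) | m <- iota 0 5].
move: (face 3 3) (skip_slot) face_skip => F G FG F4 F0.
rewrite /= !smap_op_cons /= F0 F4 !FG // !smap_op_cons /smap_op !big_nil /=.
by rewrite !scale1r !addr0 !scaleN1r; ring.
Qed.

Definition alt_labels : seq (int * seq nat) :=
  [:: (1, [:: 1; 2; 3]%N); (-1, [:: 2; 1; 3]%N); (-1, [:: 1; 3; 2]%N);
      (1, [:: 3; 1; 2]%N); (1, [:: 2; 3; 1]%N); (-1, [:: 3; 2; 1]%N)].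

(** The cycle that takes slot i out and puts it back in position k. These cycles, for i up to k,
    represent the cosets of the permutations of the first k - 1 slots in those of the first k. *)
Definition cycle_labels k i : seq nat :=
  [seq (if (j < i)%N then j else if (j < k)%N then j.+1
        else if j == k then i else j) | j <- iota 1 3].

Definition cycles k : seq (int * seq nat) :=
  [seq (alt_sign (k - i), cycle_labels k i) | i <- iota 1 k].

(** On multilinear elements, moving a linear factor from slot i to slot k is the cycle permuting the
    slots. Multiplying the signed sums of cycles for k = 1, 2, 3 reaches every permutation once,
    with its sign: the residue is the unnormalized antisymmetrization. *)
Lemma all_to_end_tensor (x : symAlg (dsum V 3)) : tensor x ->
  all_to_end 3 x = smap_op 3 alt_labels x.
Proof.
move=> tx; pose fixed (y : symAlg (dsum V 3)) :=
  forall p, (0 < p <= 3)%N -> tder1 3 (lin_slot 3 p) y = y.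
have fx : fixed x by move=> p p3; exact: tensor_lin_slot.
have to_end_cycle k y : (0 < k <= 3)%N -> fixed y ->
    tder_op 3 (to_end k 3) y = smap_op 3 (cycles k) y.
  move=> k3 fy; rewrite /tder_op /smap_op !big_map !big_seq; apply: eq_bigr => i.
  rewrite mem_iota add1n ltnS => /andP[i0 ik] /=; congr (_ *: _).
  have i3 : (0 < i <= 3)%N.
    by rewrite i0 (leq_trans ik) //; case/andP: k3.
  (* Inserting the projection onto the part linear in slot i turns the permutation into the
     derivation of [to_end]. *)
  rewrite -[RHS](congr1 _ (fy i i3)) sym_map_smap tder1E smap_tderE; last first.
    by case: i i3 {i0 ik} => [|[|[|[|i]]]].
  rewrite -[LHS]/(tder1 3 (_, _) y) tder1E; apply: tder_op_eq.
  case: k k3 ik => [|[|[|[|k]]]] // _; case: i i0 i3 => [|[|[|[|i]]]] // _ _ _;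
    by vm_compute.
have fixed_cycle k y : (0 < k <= 3)%N -> fixed y -> fixed (smap_op 3 (cycles k) y).
  move=> k3 fy p p3; rewrite /smap_op linear_sum !big_map !big_seq.
  apply: eq_bigr => i; rewrite mem_iota add1n ltnS => /andP[i0 ik] /=.
  rewrite linearZ /=; congr (_ *: _).
  have i3 : (0 < i <= 3)%N by rewrite i0 (leq_trans ik) //; case/andP: k3.
  have [q /andP[q3 q_null]] : exists q, (0 < q <= 3)%N && tder_null 3 3
      (tder_smap [:: (1, lin_slot 3 p)] [:: (1, cycle_labels k i)] ++
       tder_neg (smap_tder [:: (1, cycle_labels k i)] [:: (1, lin_slot 3 q)])).
    (* The slot whose content the cycle brings to slot p; labels count from 1 and list positions
       from 0. *)
    exists (nth 0%N (cycle_labels k i) p.-1).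
    case: k k3 ik => [|[|[|[|k]]]] // _; case: i i0 i3 => [|[|[|[|i]]]] // _ _ _;
    by case: p p3 => [|[|[|[|p]]]] // _; vm_compute.
  rewrite -[in RHS](fy q q3) !sym_map_smap !tder1E smap_tderE ?tder_smapE //.
  + exact: tder_op_eq.
have f3 := fixed_cycle 3 x isT fx; have f2 := fixed_cycle 2 _ isT f3.
rewrite -[all_to_end 3 x]/(tder_op 3 (to_end 1 3)
  (tder_op 3 (to_end 2 3) (tder_op 3 (to_end 3 3) x))).
rewrite (to_end_cycle 3 _ isT fx) (to_end_cycle 2 _ isT f3) (to_end_cycle 1 _ isT f2).
rewrite !smap_smapE //.
apply/eqP; rewrite -subr_eq0; apply/eqP.
transitivity (smap_op 3 (smap_smap (smap_smap (cycles 1) (cycles 2)) (cycles 3) ++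
   [seq (- p.1, p.2) | p <- alt_labels]) x); last exact: smap_nullP.
rewrite [RHS]smap_op_cat; congr (_ + _); rewrite /smap_op big_map -sumrN.
by apply: eq_bigr => p _; rewrite rmorphN scaleNr.
Qed.

End Slotwise.

Section Push.
Variables (K : fieldType) (V : lmodType K).

Fact push_is_linear m n (s : 'I_m -> 'I_n) : linear (@push K V m n s).
Proof.
move=> c v w; apply/ffunP => j; rewrite !ffunE scaler_sumr -big_split /=.
by apply: eq_bigr => i _; rewrite !ffunE.
Qed.
HB.instance Definition _ m n s :=
  GRing.isLinear.Build _ _ _ _ (@push K V m n s) (@push_is_linear m n s).

Lemma push_blk m n (s : 'I_m -> 'I_n) l (v : dsum V m) : injective s ->
  (forall i, nth 0%N l (s i) = i.+1) ->
  (forall j : 'I_n, (forall i, s i != j) -> nth 0%N l j = 0%N) ->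
  push s v = blk n l v.
Proof.
move=> si ls l0; apply/ffunP => j; rewrite !ffunE.
have [/existsP[i /eqP ij]|] := boolP [exists i, s i == j].
  rewrite (big_pred1 i) => [|k]; first by rewrite -ij ls slot_ord.
  by rewrite -ij (inj_eq si).
rewrite negb_exists => /forallP sj; rewrite big1 => [|i /eqP e].
  by rewrite l0 ?slot0.
by have := sj i; rewrite e eqxx.
Qed.

Let i0 : 'I_3 := ord0.
Let i1 : 'I_3 := Ordinal (isT : (1 < 3)%N).
Let i2 : 'I_3 := ord_max.

(** Pushing along s reads the labels of the inverse of s; as s and its inverse have the same sign,
    the alternating sum is not affected. *)
Lemma sum_S3 (x : symAlg (dsum V 3)) :
  \sum_(s : 'S_3) (-1) ^+ s *: sym_map (push s) x = smap_op 3 alt_labels x.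
Proof.
pose perms : seq 'S_3 := [:: 1%g; tperm i0 i1; tperm i1 i2;
  (tperm i0 i1 * tperm i1 i2)%g; (tperm i1 i2 * tperm i0 i1)%g; tperm i0 i2].
pose vals (s : 'S_3) := (s i0 : nat, s i1 : nat).
have vE : map vals perms =
    [:: (0, 1); (1, 0); (0, 2); (2, 0); (1, 2); (2, 1)]%N.
  by rewrite /vals /= !permE /= !permE /=.
(* Six permutations told apart by their values exhaust S_3. *)
have u : uniq perms by apply: (@map_uniq _ _ vals); rewrite vE.
have all_perms : perms =i index_enum 'S_3.
  have sub : {subset perms <= enum 'S_3} by move=> s _; rewrite mem_enum.
  have sz : (size (enum 'S_3) <= size perms)%N.
    by rewrite -cardE card_Sn.
  have [_ e] := uniq_min_size u sub sz.
  by move=> s; rewrite e mem_enum mem_index_enum.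
rewrite -(perm_big _ (uniq_perm u (index_enum_uniq _) all_perms)) /=.
rewrite /smap_op !big_cons !big_nil /=.
have pb (s : 'S_3) l : nth 0%N l (s i0) = 1%N ->
    nth 0%N l (s i1) = 2%N -> nth 0%N l (s i2) = 3%N ->
    sym_map (push s) x = sym_map (blk 3 l) x.
  move=> e0 e1 e2; apply: eq_sym_map => v; apply: push_blk; first exact: perm_inj.
    move=> i; have [->//|->//|->//] : [\/ i = i0, i = i1 | i = i2].
    case: i => [[|[|[|]]]] // Hi; [constructor 1|constructor 2|constructor 3];
    exact: val_inj.
  by move=> j /(_ (s^-1 j)%g); rewrite permKV eqxx.
rewrite (pb 1%g [:: 1; 2; 3]%N) ?(pb (tperm i0 i1) [:: 2; 1; 3]%N)
 ?(pb (tperm i1 i2) [:: 1; 3; 2]%N) ?(pb (tperm i0 i1 * tperm i1 i2)%g [:: 2; 3; 1]%N)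
 ?(pb (tperm i1 i2 * tperm i0 i1)%g [:: 3; 1; 2]%N) ?(pb (tperm i0 i2) [:: 3; 2; 1]%N);
 try by rewrite !permE /= ?permE.
rewrite !odd_permM !odd_tperm odd_perm1 /=.
by rewrite expr0 expr1 rmorphN rmorph1 !scale1r !scaleN1r; ring.
Qed.

End Push.

(** * Dynkin's formula *)

Section ExpLogPoly.
Variable K : fieldType.
Hypothesis K0 : [pchar K] =i pred0.

Lemma natS_neq0 n : (n.+1)%:R != 0 :> K.
Proof. by move/pcharf0P: K0 => ->. Qed.

Lemma fact_neq0 n : n`!%:R != 0 :> K.
Proof. by move/pcharf0P: K0 => ->; rewrite -lt0n fact_gt0. Qed.

(** This polynomial and the next three are the truncations of exp X, log (1 + X), (exp X - 1) / X
    and log (1 + X) / X. *)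
Definition exp_poly n : {poly K} := \poly_(i < n.+1) i`!%:R^-1.
Definition log_poly n : {poly K} := 'X * \poly_(i < n) ((-1) ^+ i / i.+1%:R).
Definition exp1_poly n : {poly K} := \poly_(i < n) (i.+1)`!%:R^-1.
Definition log1_poly n : {poly K} := \poly_(i < n) ((-1) ^+ i / i.+1%:R).

Definition eqX n (p q : {poly K}) := exists r, p = q + r * 'X^n.

Lemma eqX_coef n (p q : {poly K}) : (forall i, (i < n)%N -> p`_i = q`_i) -> eqX n p q.
Proof.
move=> pq; exists (drop_poly n (p - q)).
rewrite -[LHS](subrK q) addrC; congr (_ + _).
rewrite -{1}(poly_take_drop n (p - q)) -[RHS]add0r; congr (_ + _).
apply/polyP => i; rewrite coef_take_poly coef0; case: ifP => // i_n.
by rewrite coefB pq // subrr.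
Qed.

Lemma exp_polyE n : exp_poly n = 1 + 'X * exp1_poly n.
Proof.
apply/polyP => -[|i]; rewrite coefD coefXM coef_poly coef1 /= ?addr0 ?add0r ?invr1 //.
by rewrite coef_poly ltnS.
Qed.

Lemma deriv_exp_poly n : (exp_poly n)^`() = exp_poly n - n`!%:R^-1 *: 'X^n.
Proof.
apply/polyP => i; rewrite coef_deriv coefB coefZ coefXn !coef_poly !ltnS.
case: (ltngtP i n) => [i_n|n_i|->].
- rewrite mulr0 subr0 factS natrM invfM -[LHS]mulr_natl mulrA divff ?mul1r //.
  exact: natS_neq0.
- by rewrite mul0rn mulr0 subr0.
- by rewrite mulr1 subrr mul0rn.
Qed.

Lemma deriv_log_poly n : (1 + 'X) * (log_poly n)^`() = 1 - (- 'X) ^+ n.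
Proof.
have -> : (log_poly n)^`() = \sum_(i < n) (- 'X) ^+ i.
  apply/polyP => i; rewrite coef_deriv coefXM /= coef_poly coef_sum.
  under eq_bigr => j _ do rewrite -scaleN1r exprZn coefZ coefXn.
  case: ltnP => i_n.
    rewrite (bigD1 (Ordinal i_n)) //= eqxx mulr1 big1 ?addr0; last first.
      by move=> j /negPf; rewrite -val_eqE /= eq_sym => ->; rewrite mulr0.
    by rewrite -[LHS]mulr_natr -mulrA mulVf ?mulr1 ?natS_neq0.
  rewrite mul0rn big1 // => j _; rewrite gtn_eqF ?mulr0 //.
  exact: leq_trans (ltn_ord j) i_n.
by rewrite -[RHS]opprB subrX1 -mulNr opprB opprK.
Qed.

Lemma log_polyXn n : exists r, log_poly n ^+ n = r * 'X^n.
Proof. by rewrite /log_poly exprMn mulrC; eexists. Qed.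

(** The composite v satisfies (1 + X) v' = v modulo X ^ n and v(0) = 1. The resulting recursion on
    coefficients forces 1, 1, 0, 0, and so on; dividing by i + 1 needs characteristic 0. *)
Lemma exp_log n : eqX n.+1 (exp_poly n \Po log_poly n) (1 + 'X).
Proof.
set v := _ \Po _.
have [r hr] : exists r, (1 + 'X) * v^`() = v + r * 'X^n.
  rewrite /v deriv_comp mulrCA deriv_log_poly deriv_exp_poly.
  rewrite comp_polyB comp_polyZ -/v.
  have -> : 'X^n \Po log_poly n = log_poly n ^+ n by rewrite rmorphXn /= comp_polyX.
  have [s ->] := log_polyXn n; rewrite scalerAl; set t := _ *: s.
  have -> : (- 'X) ^+ n = (-1) ^+ n * 'X^n :> {poly K} by rewrite -exprMn mulN1r.
  exists (- v * (-1) ^+ n - t + t * (-1) ^+ n * 'X^n); ring.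
have v0 : v`_0 = 1.
  rewrite -horner_coef0 /v horner_comp /log_poly hornerM hornerX mul0r.
  by rewrite horner_coef0 coef_poly /= invr1.
have vS i : (i < n)%N -> v`_i.+1 *+ i.+1 + v`_i *+ i = v`_i.
  move=> i_n; move/(congr1 (fun p : {poly K} => p`_i)): hr.
  rewrite coefD coefMXn i_n addr0 mulrDl mul1r coefD coefXM !coef_deriv => e; rewrite -[RHS]e.
  by case: (i) => [|j] /=; rewrite ?mulr0n.
apply: eqX_coef => -[|[|i]] i_n; rewrite coefD coefX coef1 ?v0 ?addr0 ?add0r //=.
  by have := vS 0%N i_n; rewrite mulr1n mulr0n addr0 v0.
have v2 j : (j.+2 < n.+1)%N -> v`_j.+2 = 0.
  elim: j => [|j IH] jn.
    have := vS 1%N jn; rewrite mulr1n -[RHS]add0r => /addIr/eqP.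
    by rewrite -mulr_natl mulf_eq0 (negPf (natS_neq0 _)) => /eqP.
  have := vS j.+2 jn; rewrite IH ?(ltnW jn) // mul0rn addr0 => /eqP.
  by rewrite -mulr_natl mulf_eq0 (negPf (natS_neq0 _)) => /eqP.
by rewrite v2.
Qed.

(** X times the left side is log (exp X), whose derivative is 1 modulo X ^ n. One factor X is
    divided out because the statement will be evaluated at a nilpotent operator, which cannot be
    cancelled. *)
Lemma log_exp n : eqX n (exp1_poly n * (log1_poly n \Po (exp_poly n - 1))) 1.
Proof.
set e := exp_poly n - 1; set u := log_poly n \Po e.
have eE : e = 'X * exp1_poly n by rewrite /e exp_polyE addrC addKr.
have uE : u = 'X * (exp1_poly n * (log1_poly n \Po e)).
  by rewrite /u /log_poly rmorphM /= comp_polyX {1}eE mulrA.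
have [r hr] : exists r, u^`() = 1 + r * 'X^n.
  have h1 : exp_poly n * ((log_poly n)^`() \Po e) = 1 - (- e) ^+ n.
    have := congr1 (comp_poly e) (deriv_log_poly n).
    rewrite rmorphM rmorphB rmorphXn rmorphN rmorphD /= rmorph1 comp_polyX => <-.
    by rewrite /e addrCA subrr addr0.
  rewrite /u deriv_comp derivB deriv_exp_poly derivC subr0 mulrBr mulrC h1.
  have -> : (- e) ^+ n = (- exp1_poly n) ^+ n * 'X^n.
    by rewrite -exprMn mulNr mulrC -eE.
  exists (- (- exp1_poly n) ^+ n - n`!%:R^-1 *: ((log_poly n)^`() \Po e)).
  by rewrite mulrBl mulNr -addrA -scalerAr -scalerAl.
apply: eqX_coef => i i_n; move/(congr1 (fun p : {poly K} => p`_i)): hr.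
rewrite coefD coefMXn i_n addr0 uE coef_deriv coefXM /= coef1 => h.
apply: (mulIf (natS_neq0 i)); rewrite mulr_natr h.
by case: (i =P 0%N) => [->|]; rewrite ?mulr1 // mul0r.
Qed.

End ExpLogPoly.

Section Pev.
Variables (K : fieldType) (A : algType K).
Implicit Types (p q : {poly K}) (a : A).

Lemma horner_algE p a n : (size p <= n)%N ->
  horner_alg a p = \sum_(i < n) p`_i *: a ^+ i.
Proof.
move=> pn; have {1}-> : p = \sum_(i < n) p`_i *: 'X^i.
  rewrite -poly_def; apply/polyP => i; rewrite coef_poly; case: ltnP => // ni.
  by rewrite nth_default // (leq_trans pn).
rewrite linear_sum; apply: eq_bigr => i _.
by rewrite linearZ rmorphXn /= horner_algX mulr_algl.
Qed.

Lemma horner_alg_comp p q a : horner_alg a (p \Po q) = horner_alg (horner_alg a q) p.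
Proof.
elim/poly_ind: p => [|p c IH]; first by rewrite comp_poly0 !linear0.
rewrite comp_poly_MXaddC !rmorphD !rmorphM /= IH horner_algX.
by rewrite !horner_algC.
Qed.

Lemma horner_alg_eqX n p q a : eqX n p q -> a ^+ n = 0 ->
  horner_alg a p = horner_alg a q.
Proof.
case=> r -> an; rewrite rmorphD rmorphM rmorphXn /= horner_algX an.
by rewrite mulr0 addr0.
Qed.

End Pev.

Section LinEnd.
Variables (K : fieldType) (B : lmodType K) (nz : exists b : B, b != 0).

(* The argument nz makes linEnd_of nz a nonzero ring. *)
Record linEnd : Type := LinEnd {
  lin_fun :> B -> B;
  lin_funP : linear lin_fun
}.
Definition linEnd_of of (exists b : B, b != 0) := linEnd.
Local Notation E := (linEnd_of nz).

HB.instance Definition _ (f : linEnd) :=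
  GRing.isLinear.Build K B B _ (lin_fun f) (lin_funP f).

HB.instance Definition _ := gen_eqMixin linEnd.
HB.instance Definition _ := gen_choiceMixin linEnd.
HB.instance Definition _ := Choice.on E.

Lemma linEndP (f g : linEnd) : (forall b, f b = g b) -> f = g.
Proof.
case: f g => [f hf] [g hg] /= /funext fg.
by move: hf hg; rewrite fg => hf hg; congr LinEnd; exact: Prop_irrelevance.
Qed.

Fact le_zero_subproof : linear (fun _ : B => 0 : B).
Proof. by move=> c u v; rewrite scaler0 addr0. Qed.
Fact le_opp_subproof (f : linEnd) : linear (fun b => - f b).
Proof. by move=> c u v; rewrite linearP opprD scalerN. Qed.
Fact le_add_subproof (f g : linEnd) : linear (fun b => f b + g b).
Proof. by move=> c u v; rewrite !linearP scalerDr addrACA. Qed.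
Fact le_one_subproof : linear (fun b : B => b). Proof. by []. Qed.
Fact le_mul_subproof (f g : linEnd) : linear (fun b => f (g b)).
Proof. by move=> c u v; rewrite !linearP. Qed.
Fact le_scale_subproof (a : K) (f : linEnd) : linear (fun b => a *: f b).
Proof. by move=> c u v; rewrite linearP scalerDr !scalerA mulrC. Qed.

Definition le_zero : E := LinEnd le_zero_subproof.
Definition le_one : E := LinEnd le_one_subproof.
Definition le_opp (f : E) : E := LinEnd (le_opp_subproof f).
Definition le_add (f g : E) : E := LinEnd (le_add_subproof f g).
Definition le_mul (f g : E) : E := LinEnd (le_mul_subproof f g).
Definition le_scale (a : K) (f : E) : E := LinEnd (le_scale_subproof a f).

Fact le_addA : associative le_add.
Proof. by move=> f g h; apply: linEndP => b /=; rewrite addrA. Qed.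
Fact le_addC : commutative le_add.
Proof. by move=> f g; apply: linEndP => b /=; rewrite addrC. Qed.
Fact le_add0 : left_id le_zero le_add.
Proof. by move=> f; apply: linEndP => b /=; rewrite add0r. Qed.
Fact le_addN : left_inverse le_zero le_opp le_add.
Proof. by move=> f; apply: linEndP => b /=; rewrite addNr. Qed.
HB.instance Definition _ := GRing.isZmodule.Build E le_addA le_addC le_add0 le_addN.

Fact le_mulA : associative le_mul.
Proof. by move=> f g h; apply: linEndP. Qed.
Fact le_mul1 : left_id le_one le_mul.
Proof. by move=> f; apply: linEndP. Qed.
Fact le_mulr1 : right_id le_one le_mul.
Proof. by move=> f; apply: linEndP. Qed.
Fact le_mulDl : left_distributive le_mul +%R.
Proof. by move=> f g h; apply: linEndP. Qed.
Fact le_mulDr : right_distributive le_mul +%R.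
Proof. by move=> f g h; apply: linEndP => b /=; rewrite linearD. Qed.
Fact le_1_neq0 : le_one != 0.
Proof.
case: nz => b b0; apply: contraNneq b0 => /(congr1 (fun f : linEnd => f b)) /= ->.
exact: eqxx.
Qed.
HB.instance Definition _ := GRing.Zmodule_isNzRing.Build E
  le_mulA le_mul1 le_mulr1 le_mulDl le_mulDr le_1_neq0.

Fact le_scaleA c d f : le_scale c (le_scale d f) = le_scale (c * d) f.
Proof. by apply: linEndP => b /=; rewrite scalerA. Qed.
Fact le_scale1 : left_id 1 le_scale.
Proof. by move=> f; apply: linEndP => b /=; rewrite scale1r. Qed.
Fact le_scaleDr : right_distributive le_scale +%R.
Proof. by move=> c f g; apply: linEndP => b /=; rewrite scalerDr. Qed.
Fact le_scaleDl f : {morph le_scale^~ f : c d / c + d}.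
Proof. by move=> c d; apply: linEndP => b /=; rewrite scalerDl. Qed.
HB.instance Definition _ := GRing.Zmodule_isLmodule.Build K E
  le_scaleA le_scale1 le_scaleDr le_scaleDl.

Fact le_scaleAl c (f g : E) : c *: (f * g) = c *: f * g.
Proof. exact: linEndP. Qed.
HB.instance Definition _ := GRing.Lmodule_isLalgebra.Build K E le_scaleAl.
Fact le_scaleAr c (f g : E) : c *: (f * g) = f * (c *: g).
Proof. by apply: linEndP => b /=; rewrite linearZ. Qed.
HB.instance Definition _ := GRing.Lalgebra_isAlgebra.Build K E le_scaleAr.

Lemma le0E b : (0 : E) b = 0. Proof. by []. Qed.
Lemma le1E b : (1 : E) b = b. Proof. by []. Qed.
Lemma leDE (f g : E) b : (f + g) b = f b + g b. Proof. by []. Qed.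
Lemma leBE (f g : E) b : (f - g) b = f b - g b. Proof. by []. Qed.
Lemma leME (f g : E) b : (f * g) b = f (g b). Proof. by []. Qed.
Lemma leZE c (f : E) b : (c *: f) b = c *: f b. Proof. by []. Qed.
Lemma le_sumE I (r : seq I) (P : pred I) (F : I -> E) b :
  (\sum_(i <- r | P i) F i) b = \sum_(i <- r | P i) F i b.
Proof. by elim/big_rec2: _ => [|i x y _ <-]. Qed.
Lemma leXE (f : E) n b : (f ^+ n) b = iter n f b.
Proof. by elim: n => [|n IH]; rewrite ?expr0 // exprS leME IH. Qed.

End LinEnd.

Section NilpotentExp.
Variables (K : fieldType) (A : algType K).
Hypothesis K0 : [pchar K] =i pred0.
Implicit Types x y : A.

Definition nexp n x : A := horner_alg x (exp_poly K n).

Lemma nexpE n x : nexp n x = \sum_(i < n.+1) i`!%:R^-1 *: x ^+ i.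
Proof.
rewrite /nexp (@horner_algE _ _ _ _ n.+1) ?size_poly //.
by apply: eq_bigr => i _; rewrite coef_poly ltn_ord.
Qed.

Lemma nexp0 n : nexp n 0 = 1.
Proof.
rewrite nexpE big_ord_recl expr0 /= invr1 scale1r big1 ?addr0 // => i _.
by rewrite expr0n /= scaler0.
Qed.

(** The product of truncated exponentials also contains terms with i + j > n, absent from the
    exponential of the sum; the second hypothesis is there to remove them. *)
Lemma nexpD n x y : x * y = y * x ->
  (forall i j, (n < i + j)%N -> x ^+ i * y ^+ j = 0) ->
  nexp n (x + y) = nexp n x * nexp n y.
Proof.
move=> xy xy0; rewrite !nexpE mulr_suml.
pose F i j := (i`!%:R^-1 * j`!%:R^-1) *: (x ^+ i * y ^+ j).
transitivity (\sum_(k < n.+1) \sum_(i < n.+1 | (i <= k)%N) F i (k - i)%N).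
  apply: eq_bigr => k _; rewrite addrC exprDn_comm; last exact: esym.
  rewrite scaler_sumr (big_ord_widen n.+1
    (fun i => k`!%:R^-1 *: (y ^+ (k - i) * x ^+ i *+ 'C(k, i)))) //.
  apply: eq_big => [i|i]; rewrite ltnS // => ik.
  have c : x ^+ i * y ^+ (k - i) = y ^+ (k - i) * x ^+ i.
    by apply: commrX; apply: commr_sym; apply: commrX; exact: esym.
  rewrite /F c -scaler_nat scalerA; congr (_ *: _).
  have := bin_fact ik; move/(congr1 (fun j => j%:R : K)); rewrite !natrM => <-.
  have bn0 : 'C(k, i)%:R != 0 :> K.
    by move/pcharf0P: K0 => ->; rewrite -lt0n bin_gt0.
  by have := fact_neq0 K0 i; have := fact_neq0 K0 (k - i); move=> a b; field;
    rewrite ?a ?b ?bn0.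
rewrite (exchange_big_dep xpredT) //=; apply: eq_bigr => i _; rewrite mulr_sumr.
transitivity (\sum_(0 <= j < n.+1 - i) F i j).
  have := @big_geq_mkord A 0 +%R i n.+1 xpredT (fun k => F i (k - i)%N).
  rewrite /= => <-; rewrite -{1}[nat_of_ord i]add0n big_addn.
  by apply: eq_bigr => j _; rewrite addnK.
transitivity (\sum_(0 <= j < n.+1) F i j).
  rewrite [RHS](@big_cat_nat _ _ _ (n.+1 - i)) ?leq_subr //=.
  rewrite [X in _ + X]big_nat_cond [X in _ + X]big1 ?addr0 // => j /andP[/andP[ij _] _].
  by rewrite /F xy0 ?scaler0 // -leq_subLR.
rewrite big_mkord; apply: eq_bigr => j _.
by rewrite /F -scalerAr -scalerAl scalerA mulrC.
Qed.

Lemma nexp_opp n x : x ^+ n.+1 = 0 -> nexp n (- x) * nexp n x = 1.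
Proof.
move=> xn; rewrite -nexpD ?addNr ?nexp0 // ?mulrN ?mulNr // => i j ij.
by rewrite exprNn -mulrA -exprD -(subnK ij) exprD xn !mulr0.
Qed.

End NilpotentExp.

Section Adjoint.
Variables (K : fieldType) (A : algType K).
Hypothesis K0 : [pchar K] =i pred0.
Implicit Types a b c : A.

Lemma alg_nontrivial : exists a : A, a != 0.
Proof. by exists 1; exact: oner_neq0. Qed.

Local Notation End := (linEnd_of alg_nontrivial).

Fact mulL_is_linear a : linear (fun c => a * c).
Proof. by move=> k u v; rewrite mulrDr scalerAr. Qed.
Fact mulR_is_linear a : linear (fun c => c * a).
Proof. by move=> k u v; rewrite mulrDl scalerAl. Qed.

Definition mulL a : End := LinEnd (mulL_is_linear a).
Definition mulR a : End := LinEnd (mulR_is_linear a).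
(** Presented as a sum of commuting operators, left and right multiplications, so that [nexpD]
    splits its exponential. *)
Definition ad a : End := mulL a + mulR (- a).

Lemma adE a c : ad a c = a * c - c * a.
Proof. by rewrite /ad leDE /= mulrN. Qed.

Lemma mulLX a i c : (mulL a ^+ i) c = a ^+ i * c.
Proof.
elim: i => [|i IH]; first by rewrite !expr0 mul1r.
by rewrite exprS leME IH exprS -mulrA.
Qed.

Lemma mulRX a i c : (mulR a ^+ i) c = c * a ^+ i.
Proof.
elim: i => [|i IH]; first by rewrite !expr0 mulr1.
by rewrite exprS leME IH /= exprSr mulrA.
Qed.

Lemma mulL_mulR a b : mulL a * mulR b = mulR b * mulL a.
Proof. by apply: linEndP => c /=; rewrite mulrA. Qed.

Lemma mulLR_nil m a b i j : a ^+ m.+1 = 0 -> b ^+ m.+1 = 0 -> (m.*2 < i + j)%N ->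
  mulL a ^+ i * mulR b ^+ j = 0.
Proof.
move=> am bm ij; apply: linEndP => c; rewrite leME mulLX mulRX.
have [mi|im] := ltnP m i; first by rewrite -(subnK mi) exprD am mulr0 mul0r.
have mj : (m < j)%N.
  by rewrite -(ltn_add2l m) (leq_trans _ (leq_add im (leqnn j))) // addnn.
by rewrite -(subnK mj) exprD bm !mulr0.
Qed.

Lemma oppX_nil m a : a ^+ m.+1 = 0 -> (- a) ^+ m.+1 = 0.
Proof. by move=> am; rewrite exprNn am mulr0. Qed.

(** In a binomial term of exponent above 2m, the left or the right power exceeds m. This bound is
    the origin of the truncation [m.*2.+1] of all the exponentials below. *)
Lemma ad_nil m a : a ^+ m.+1 = 0 -> ad a ^+ m.*2.+1 = 0.
Proof.
move=> am; rewrite /ad exprDn_comm; last exact: mulL_mulR.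
rewrite big1 // => i _; rewrite (mulLR_nil am (oppX_nil am)) ?mul0rn //.
by rewrite subnK // -ltnS.
Qed.

Lemma nexp_mulL n a c : nexp n (mulL a) c = nexp n a * c.
Proof.
rewrite !nexpE le_sumE mulr_suml; apply: eq_bigr => i _.
by rewrite leZE mulLX -scalerAl.
Qed.

Lemma nexp_mulR n a c : nexp n (mulR a) c = c * nexp n a.
Proof.
rewrite !nexpE le_sumE mulr_sumr; apply: eq_bigr => i _.
by rewrite leZE mulRX -scalerAr.
Qed.

(** The exponential of ad a is conjugation by the exponential of a, written without inverse. *)
Lemma nexp_ad m n a c : a ^+ m.+1 = 0 -> (m.*2 <= n)%N ->
  nexp n (ad a) c * nexp n a = nexp n a * c.
Proof.
move=> am mn; rewrite /ad (nexpD K0) ?leME ?nexp_mulL ?nexp_mulR; last first.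
- by move=> i j ij; apply: mulLR_nil am (oppX_nil am) (leq_ltn_trans mn ij).
- exact: mulL_mulR.
rewrite -!mulrA nexp_opp ?mulr1 //.
have mn' : (m <= n)%N by apply: leq_trans mn; rewrite -addnn leq_addr.
by rewrite -(subnK mn') -addnS exprD am mulr0.
Qed.

Lemma nexp_killed (B : lmodType K) (nz : exists b : B, b != 0) n (T : linEnd_of nz) v :
  (0 < n)%N -> T (T v) = 0 -> nexp n T v = v + T v.
Proof.
case: n => // n _ Tv; rewrite nexpE le_sumE !big_ord_recl big1 ?addr0.
  by rewrite !leZE expr0 expr1 !invr1 !scale1r.
move=> i _; have -> : val (lift ord0 (lift ord0 i)) = (i + 2)%N by rewrite addn2.
rewrite leZE exprD leME expr2 leME Tv.
by rewrite linear0 scaler0.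
Qed.

End Adjoint.

Section DynkinTerm.
Variables (K : fieldType) (L : lmodType K) (br : L -> L -> L).

Fixpoint nested (w : seq L) : L :=
  match w with
  | [::] => 0
  | [:: f] => f
  | f :: w' => br f (nested w')
  end.

Definition dynkin_word (f g : L) (t : seq (nat * nat)) : seq L :=
  flatten [seq nseq rs.1 f ++ nseq rs.2 g | rs <- t].

Definition pos_pairs (t : seq (nat * nat)) := all (fun rs => 0 < rs.1 + rs.2)%N t.
Definition pairs_degree (t : seq (nat * nat)) := (\sum_(rs <- t) (rs.1 + rs.2))%N.
Definition pairs_fact (t : seq (nat * nat)) := (\prod_(rs <- t) (rs.1`! * rs.2`!))%N.

Definition nat_pairs b (t : seq ('I_b * 'I_b)) : seq (nat * nat) :=
  [seq (val rs.1, val rs.2) | rs <- t].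

Definition dynkin_part b n d f g : L :=
  \sum_(t : n.+1.-tuple ('I_b * 'I_b) |
     pos_pairs (nat_pairs t) && (pairs_degree (nat_pairs t) == d))
   (pairs_fact (nat_pairs t))%:R^-1 *: nested (dynkin_word f g (nat_pairs t)).

Definition dynkin_term d f g : L :=
  d%:R^-1 *: \sum_(n < d) ((-1) ^+ n / n.+1%:R) *: dynkin_part d.+1 n d f g.

Lemma nested_cons f w : w <> [::] -> nested (f :: w) = br f (nested w).
Proof. by case: w. Qed.

Lemma pairs_degree_ge t : pos_pairs t -> (size t <= pairs_degree t)%N.
Proof.
rewrite /pairs_degree; elim: t => [|p t IH] /=; first by rewrite big_nil.
by case/andP => p0 /IH; rewrite big_cons -add1n; exact: leq_add.
Qed.

Lemma size_dynkin_word f g t : size (dynkin_word f g t) = pairs_degree t.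
Proof.
rewrite /pairs_degree; elim: t => [|p t IH] /=; first by rewrite big_nil.
by rewrite /dynkin_word /= !size_cat !size_nseq big_cons -IH.
Qed.

(** In total degree d no exponent exceeds d, so the bound on the indices is immaterial. The
    expansion of the logarithmic derivative uses one bound for all degrees, Dynkin's term a bound
    depending on d. *)
Lemma dynkin_part_widen b n d f g : (d < b)%N ->
  dynkin_part b n d f g = dynkin_part d.+1 n d f g.
Proof.
move=> db; rewrite /dynkin_part.
pose wid (p : 'I_d.+1 * 'I_d.+1) := (widen_ord db p.1, widen_ord db p.2).
pose nar (p : 'I_b * 'I_b) := (inord p.1 : 'I_d.+1, inord p.2 : 'I_d.+1).
pose h (t : n.+1.-tuple ('I_d.+1 * 'I_d.+1)) := map_tuple wid t.
pose h' (t : n.+1.-tuple ('I_b * 'I_b)) := map_tuple nar t.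
have hE t : nat_pairs (h t) = nat_pairs t by rewrite /nat_pairs /= -map_comp.
rewrite (reindex_onto h h'); last first.
  move=> t /andP[_ /eqP td]; apply: val_inj => /=; rewrite -map_comp.
  rewrite -[RHS]map_id; apply/eq_in_map => -[r s] rst /=.
  have : (r + s <= d)%N.
    rewrite -td /pairs_degree big_map (big_rem (r, s)) //=; exact: leq_addr.
  move=> rsd; congr (_, _); apply: val_inj => /=; rewrite inordK // ltnS.
    exact: leq_trans (leq_addr _ _) rsd.
  exact: leq_trans (leq_addl _ _) rsd.
apply: eq_big => [t|t _]; rewrite hE //.
have -> : h' (h t) = t.
  apply: val_inj => /=; rewrite -map_comp -[RHS]map_id; apply: eq_map => -[r s] /=.
  by rewrite /nar /= !inord_val.
by rewrite eqxx andbT.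
Qed.

Lemma dynkin_part_big b n d f g : (d <= n)%N -> dynkin_part b n d f g = 0.
Proof.
move=> dn; apply: big_pred0 => t; apply/negP => /andP[/pairs_degree_ge + /eqP td].
by rewrite td size_map size_tuple leqNgt ltnS dn.
Qed.

End DynkinTerm.

Lemma big_tuple_cons (R : Type) (idx : R) (op : Monoid.com_law idx) (T : finType) n
    (P : pred (n.+1.-tuple T)) (F : n.+1.-tuple T -> R) :
  \big[op/idx]_(t : n.+1.-tuple T | P t) F t =
  \big[op/idx]_(p : T) \big[op/idx]_(t : n.-tuple T | P (cons_tuple p t))
     F (cons_tuple p t).
Proof.
rewrite pair_big_dep /= (reindex (fun q : T * n.-tuple T => cons_tuple q.1 q.2)) //.
exists (fun t => (thead t, behead_tuple t)) => [[p t] _|t _] /=.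
  by congr (_, _); apply: val_inj.
by apply: val_inj; rewrite /= [t in RHS]tuple_eta.
Qed.

Section DynkinFormula.
Variables (K : fieldType) (A : algType K).
Hypothesis K0 : [pchar K] =i pred0.
Variables (m : nat) (J : nat -> A -> Prop) (D X Y : A).
Hypothesis J0 : forall i, J i 0.
Hypothesis J1 : J 0 1.
Hypothesis JD : forall i a b, J i a -> J i b -> J i (a + b).
Hypothesis JZ : forall i c a, J i a -> J i (c *: a).
Hypothesis JM : forall i j a b, J i a -> J j b -> J (i + j) (a * b).
Hypothesis JS : forall i a, J i.+1 a -> J i a.
Hypothesis Jnil : forall a, J m.+1 a -> a = 0.
Hypothesis JX : J 1 X.
Hypothesis JY : J 1 Y.

(* D plays the role of t d/dt, with X and Y of degree one in t.               *)
Hypothesis DX : D * X - X * D = X.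
Hypothesis DY : D * Y - Y * D = Y.
Hypothesis Dinj : forall a, J 1 a -> D * a = a * D -> a = 0.

Local Notation N := m.*2.+1.
Local Notation br := (fun a b : A => a * b - b * a).

Let Jle i j a : (i <= j)%N -> J j a -> J i a.
Proof. by move/subnK <-; elim: (j - i)%N => // k IH /JS/IH. Qed.

Let Jsum i I (r : seq I) (P : pred I) (F : I -> A) :
  (forall k, P k -> J i (F k)) -> J i (\sum_(k <- r | P k) F k).
Proof. by move=> h; elim/big_ind: _ => // a b; exact: JD. Qed.

Let JB i a b : J i a -> J i b -> J i (a - b).
Proof. by move=> ha hb; rewrite -scaleN1r; apply: JD => //; exact: JZ. Qed.

Let JXn a i : J 1 a -> J i (a ^+ i).
Proof.
by move=> a1; elim: i => [|i IH]; rewrite ?expr0 // exprS -add1n; exact: JM.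
Qed.

Let nil1 a : J 1 a -> a ^+ m.+1 = 0.
Proof. by move=> a1; apply/Jnil/JXn. Qed.

Let nilS a n : (m < n)%N -> J 1 a -> a ^+ n = 0.
Proof. by move=> mn /nil1 am; rewrite -(subnK mn) exprD am mulr0. Qed.

Let mN : (m < N)%N.
Proof. by rewrite ltnS -addnn leq_addr. Qed.

Let Jhorner (p : {poly K}) a : J 1 a -> p`_0 = 0 -> J 1 (horner_alg a p).
Proof.
move=> a1 p0; rewrite (@horner_algE _ _ p _ (size p)) //.
apply: Jsum => -[[|i] ip] _ /=; first by rewrite p0 scale0r.
by apply: JZ; apply: (@Jle _ i.+1) => //; exact: JXn.
Qed.

Let G := nexp N X * nexp N Y.

Let expE (a : A) : nexp N a = 1 + horner_alg a ('X * exp1_poly K N).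
Proof. by rewrite /nexp exp_polyE rmorphD /= rmorph1. Qed.

Let Jexp (a : A) : J 1 a -> J 1 (horner_alg a ('X * exp1_poly K N)).
Proof. by move=> a1; apply: Jhorner; rewrite // coefXM. Qed.

Let JG : J 1 (G - 1).
Proof.
have sub1 (a b : A) : (1 + a) * (1 + b) - 1 = a + b + a * b.
  apply: (addIr 1); rewrite subrK mulrDl mul1r mulrDr mulr1 [RHS]addrC !addrA.
  by congr (_ + _); exact: addrAC.
rewrite /G !expE sub1; move: (Jexp JX) (Jexp JY) => eX eY.
by apply: JD; [exact: JD|apply/JS/(JM eX)].
Qed.

Let Z := horner_alg (G - 1) (log_poly K N).

Let JlogZ : J 1 Z.
Proof. by apply: Jhorner; rewrite // coefXM. Qed.

Let expZ : nexp N Z = G.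
Proof.
rewrite /nexp /Z -horner_alg_comp (horner_alg_eqX (exp_log K0 N)); last first.
  by apply: nilS => //; exact: ltnW.
by rewrite rmorphD rmorph1 /= horner_algX addrC subrK.
Qed.

Local Notation Op := (nexp N (ad X) * nexp N (ad Y)).

(** Both sides conjugate by G, and right multiplication by G can be cancelled since exp (- Z) is a
    right inverse of G. *)
Let adZ_Op : nexp N (ad Z) = Op.
Proof.
have mN2 : (m.*2 <= N)%N by [].
have eq (c : A) : nexp N (ad Z) c * G = Op c * G.
  rewrite -{1}expZ (nexp_ad K0 _ (nil1 JlogZ) mN2) expZ leME /G mulrA.
  rewrite (nexp_ad K0 _ (nil1 JX) mN2) -!mulrA.
  by rewrite (nexp_ad K0 _ (nil1 JY) mN2).
have inv : G * nexp N (- Z) = 1.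
  rewrite -expZ -{1}[Z]opprK nexp_opp //; apply: oppX_nil; apply: nilS => //.
  exact: ltnW.
apply: linEndP => c; have := congr1 (fun a => a * nexp N (- Z)) (eq c).
by rewrite -[LHS]mulrA -[RHS]mulrA inv !mulr1.
Qed.

(** The logarithmic derivative (D G - G D) G ^ -1 of G = e^X e^Y for the derivation [D, -]. *)
Let Theta := X + nexp N (ad X) Y.

Let Op_D : Op D = D - Theta.
Proof.
have adD a : D * a - a * D = a -> ad a D = - a.
  by rewrite adE => e; rewrite -opprB e.
have adN a : D * a - a * D = a -> ad a (ad a D) = 0.
  by move=> e; rewrite (adD a e) adE mulrN mulNr subrr.
rewrite leME !(nexp_killed _ (adN _ DY)) // adD // linearB.
rewrite /= (nexp_killed _ (adN _ DX)) // (adD _ DX) /Theta opprD addrA; reflexivity.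
Qed.

(** Applying exp (ad Z) to D gives Theta = ((exp (ad Z) - 1) / ad Z) [D, Z]. The power series is
    inverted by [log_exp], and exp (ad Z) - 1 is known as Op - 1 without reference to Z. *)
Let log_derivative :
  D * Z - Z * D = horner_alg (Op - 1) (log1_poly K N) Theta.
Proof.
set e := horner_alg (ad Z) (exp1_poly K N).
have expE' : nexp N (ad Z) = 1 + e * ad Z.
  rewrite /nexp exp_polyE rmorphD rmorph1 mulrC rmorphM /=.
  by rewrite horner_algX.
have ThetaE : Theta = e (D * Z - Z * D).
  have := Op_D; rewrite -adZ_Op expE' leDE le1E leME adE => /addrI/(congr1 -%R).
  by rewrite opprK -linearN opprB.
rewrite ThetaE -adZ_Op.
have -> : nexp N (ad Z) - 1 = horner_alg (ad Z) (exp_poly K N - 1).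
  by rewrite rmorphB rmorph1.
rewrite -horner_alg_comp -leME -rmorphM /= mulrC.
rewrite (horner_alg_eqX (log_exp K0 N)) ?rmorph1 //.
exact: ad_nil (nil1 JlogZ).
Qed.

Let B := N.+1.
Local Notation pairs := ('I_B * 'I_B)%type.
Let nz (p : pairs) := (0 < p.1 + p.2)%N.
Let cf (p : pairs) : K := (p.1`! * p.2`!)%N%:R^-1.

Let OpB1 u : (Op - 1) u =
  \sum_(p : pairs | nz p) cf p *: iter p.1 (ad X) (iter p.2 (ad Y) u).
Proof.
transitivity (\sum_(p : pairs) cf p *: iter p.1 (ad X) (iter p.2 (ad Y) u) - u).
  rewrite leBE le1E leME !nexpE !le_sumE; congr (_ - _).
  rewrite (eq_bigr (fun r : 'I_B => \sum_(s < B) cf (r, s) *: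
    iter r (ad X) (iter s (ad Y) u))); first by rewrite pair_bigA.
  move=> r _; rewrite leZE linear_sum scaler_sumr; apply: eq_bigr => s _.
  by rewrite leZE linearZ /cf natrM invfM -scalerA -!leXE.
rewrite (bigD1 (ord0, ord0)) //= /cf /= mul1n invr1 scale1r addrAC subrr add0r.
apply: eq_bigl => -[[r Hr] [s Hs]]; rewrite /nz /=.
by case: r Hr s Hs => [|r] Hr [|s] Hs.
Qed.

(** A word X^r Y^s with s > 1, or with s = 0 and r > 1, has two equal letters in its innermost
    bracket. What remains is X and (ad X)^r Y / r!, so that Theta takes the same shape as a block of
    Dynkin's sum. *)
Let Theta_sum : Theta = \sum_(p : pairs | nz p) cf p *: nested br (nseq p.1 X ++ nseq p.2 Y).
Proof.
have nested_ad a w : w <> [::] -> nested br (a :: w) = ad a (nested br w).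
  by move=> w0; rewrite nested_cons // adE.
have nested_rep r w : w <> [::] -> nested br (nseq r X ++ w) = iter r (ad X) (nested br w).
  move=> w0; elim: r => [//|r IH].
  rewrite -[nseq r.+1 X ++ w]/(X :: (nseq r X ++ w)) nested_ad ?IH //.
  by case: (r) => [|k] //; case: (w) w0.
have rep2 a r : nested br (nseq r.+2 a) = 0.
  elim: r => [|r IH]; first by rewrite /= subrr.
  by rewrite -[nseq _ _]/(a :: nseq r.+2 a) nested_ad // IH linear0.
transitivity (\sum_(r < B) \sum_(s < B | nz (r, s))
    cf (r, s) *: nested br (nseq r X ++ nseq s Y)); last first.
  by rewrite pair_big_dep /=; apply: eq_big => [[r s]|[r s]].
have inner (r : 'I_B) : \sum_(s < B | nz (r, s)) cf (r, s) *: nested br (nseq r X ++ nseq s Y)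
    = (if r == 1%N :> nat then X else 0) + r`!%:R^-1 *: iter r (ad X) Y.
  rewrite big_mkcond big_ord_recl big_ord_recl big1 ?addr0; last first.
    move=> s _; case: ifP => // _; rewrite nested_rep //.
    have -> : nested br (nseq (lift ord0 (lift ord0 s)) Y) = 0 by exact: rep2.
    by rewrite -leXE linear0 scaler0.
  rewrite /nz /= addn0 addn1 /= cats0; congr (_ + _).
    case: r => -[|[|r]] Hr; first by [].
      by rewrite /= /cf /= invr1 scale1r.
    by have /= -> := rep2 X r; rewrite /= scaler0.
  by rewrite addr0 nested_rep // /cf /= muln1.
rewrite (eq_bigr _ (fun r _ => inner r)) big_split /= /Theta; congr (_ + _).
  by rewrite big_ord_recl big_ord_recl /= big1 ?addr0 ?add0r.
by rewrite nexpE le_sumE; apply: eq_bigr => r _; rewrite leZE leXE.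
Qed.

Let F (t : seq (nat * nat)) : A :=
  (pairs_fact t)%:R^-1 *: nested br (dynkin_word X Y t).

(** Each application of Op - 1 puts one more pair of exponents in front of the words; Theta supplies
    the last pair. *)
Let iter_Op n : iter n (Op - 1) Theta =
  \sum_(t : n.+1.-tuple pairs | pos_pairs (nat_pairs t)) F (nat_pairs t).
Proof.
elim: n => [|n IH].
  rewrite big_tuple_cons Theta_sum big_mkcond; apply: eq_bigr => p _.
  rewrite [RHS]big_mkcond (big_pred1 [tuple]) => [|t]; last by apply/esym/eqP; exact: tuple0.
  by rewrite /pos_pairs /= andbT /F /dynkin_word /pairs_fact /= big_seq1 cats0.
rewrite iterS IH OpB1 [RHS]big_tuple_cons big_mkcond; apply: eq_bigr => p _.
have posE (t : n.+1.-tuple pairs) : pos_pairs (nat_pairs (cons_tuple p t)) =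
    nz p && pos_pairs (nat_pairs t) by [].
case: ifP => np; last by rewrite big_pred0 // => t; rewrite posE np.
rewrite -!leXE -leME linear_sum scaler_sumr; apply: eq_big => [t|t tp].
  by rewrite posE np.
rewrite /F linearZ scalerA /pairs_fact big_cons natrM invfM.
congr (_ *: _).
transitivity (iter p.1 (ad X) (iter p.2 (ad Y)
  (nested br (dynkin_word X Y (nat_pairs t))))); first by rewrite -!leXE.
have nested_ad a w : w <> [::] -> nested br (a :: w) = ad a (nested br w).
  by move=> w0; rewrite nested_cons // adE.
have nested_rep a r w : w <> [::] ->
    nested br (nseq r a ++ w) = iter r (ad a) (nested br w).
  move=> w0; elim: r => [//|r IHr].
  rewrite -[nseq r.+1 a ++ w]/(a :: (nseq r a ++ w)) nested_ad ?IHr //.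
  by case: (r) => [|k] //; case: (w) w0.
rewrite /dynkin_word /= -catA; set w := flatten _.
have w0 : w <> [::].
  move/(congr1 size)/eqP; rewrite -[w]/(dynkin_word X Y (nat_pairs t)).
  rewrite size_dynkin_word => /= /eqP e; have := pairs_degree_ge tp.
  by rewrite e size_map size_tuple.
rewrite nested_rep ?nested_rep //.
by case: (val p.2) => [|k] //; case: (w) w0.
Qed.

Let words w : all (fun a => (a == X) || (a == Y)) w ->
  J (size w) (nested br w) /\
  D * nested br w - nested br w * D = nested br w *+ size w.
Proof.
elim: w => [|a w IH] /=; first by rewrite mulr0 mul0r subrr.
case/andP => /orP aXY /IH {IH} [Jw Dw].
have [Ja Da] : J 1 a /\ D * a - a * D = a by case: aXY => /eqP ->.
case: w Jw Dw => [//|b w]; set u := nested br _ => Ju Du.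
have der (x y : A) : D * (x * y) - x * y * D =
    (D * x - x * D) * y + x * (D * y - y * D).
  by rewrite mulrBl mulrBr !mulrA addrA subrK.
split; first by apply: JB; [exact: (JM Ja Ju)|rewrite -addn1; exact: (JM Ju Ja)].
have -> : D * (a * u - u * a) - (a * u - u * a) * D =
    (D * (a * u) - a * u * D) - (D * (u * a) - u * a * D).
  have sw (w1 x y z : A) : w1 - x - (y - z) = w1 - y - (x - z).
    by rewrite !opprB [z - y]addrC addrACA [- x + z]addrC.
  by rewrite mulrBr mulrBl sw.
rewrite !der Da Du mulrnAr mulrnAl.
transitivity (a * u *+ (size w).+2 - u * a *+ (size w).+2); last by rewrite -mulrnBl.
by rewrite [a * u *+ (size w).+2]mulrS [u * a *+ (size w).+2]mulrSr.
Qed.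

Let words_dynkin t :
  J (pairs_degree t) (nested br (dynkin_word X Y t)) /\
  D * nested br (dynkin_word X Y t) - nested br (dynkin_word X Y t) * D =
  nested br (dynkin_word X Y t) *+ pairs_degree t.
Proof.
rewrite -(size_dynkin_word X Y); apply: words; apply/allP => a.
case/flattenP => w /mapP[p _ ->]; rewrite mem_cat => /orP[] /nseqP[-> _];
  by rewrite eqxx ?orbT.
Qed.

(** Words are sorted by their length d: it is at least n + 1 > 0, and for d > m the word vanishes by
    nilpotency. *)
Let iter_Op_parts n :
  iter n (Op - 1) Theta = \sum_(1 <= d < m.+1) dynkin_part br B n d X Y.
Proof.
rewrite iter_Op /dynkin_part.
rewrite (exchange_big_dep (fun t : n.+1.-tuple pairs => pos_pairs (nat_pairs t))) /=;
  last by move=> d t _ /andP[].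
apply: eq_bigr => t tp.
have dt := pairs_degree_ge tp; rewrite size_map size_tuple in dt.
rewrite (eq_bigl (fun d => d == pairs_degree (nat_pairs t))); last first.
  by move=> d; rewrite tp eq_sym.
rewrite big_nat1_eq (leq_trans _ dt) //= ltnS; case: leqP => // md.
rewrite /F (Jnil (Jle md (words_dynkin _).1)) scaler0 //.
Qed.

Let dyn_degree d : (0 < d <= m)%N ->
  \sum_(n < N) ((-1) ^+ n / n.+1%:R) *: dynkin_part br B n d X Y =
  d%:R *: dynkin_term br d X Y.
Proof.
case/andP => d0 dm; rewrite /dynkin_term scalerA divff ?scale1r; last first.
  by move/pcharf0P: K0 => ->; rewrite -lt0n.
have dN : (d <= N)%N by apply: leq_trans dm (ltnW mN).
rewrite (big_ord_widen N
  (fun n => ((-1) ^+ n / n.+1%:R) *: dynkin_part br d.+1 n d X Y)) //.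
rewrite [RHS]big_mkcond; apply: eq_bigr => n _; case: ltnP => nd.
  by rewrite (@dynkin_part_widen _ _ _ B).
by rewrite dynkin_part_big // scaler0.
Qed.

Let dyn_eigen d : J d (dynkin_term br d X Y) /\
  D * dynkin_term br d X Y - dynkin_term br d X Y * D = d%:R *: dynkin_term br d X Y.
Proof.
pose good a := J d a /\ D * a - a * D = d%:R *: a.
have good0 : good 0 by split; rewrite // mulr0 mul0r subrr scaler0.
have goodD a b : good a -> good b -> good (a + b).
  move=> [Ja Da] [Jb Db]; split; first exact: JD.
  by rewrite mulrDr mulrDl opprD addrACA Da Db scalerDr.
have goodZ c a : good a -> good (c *: a).
  move=> [Ja Da]; split; first exact: JZ.
  by rewrite -scalerAr -scalerAl -scalerBr Da !scalerA mulrC.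
apply: (goodZ); apply: (big_ind good) => // n _; apply: (goodZ).
apply: (big_ind good) => // t /andP[_ /eqP td]; apply: (goodZ).
by have [Jt Dt] := words_dynkin (nat_pairs t); rewrite td in Jt Dt; split;
  rewrite // Dt scaler_nat.
Qed.

(** Dynkin's series and Z = log (e^X e^Y) have the same commutator with D: on the series D
    multiplies degree d by d, which undoes the factor 1 / d, and on Z it is given by
    [log_derivative]. By [Dinj] they coincide. *)
Lemma dynkin_formula :
  nexp N (\sum_(1 <= d < m.+1) dynkin_term br d X Y) = nexp N X * nexp N Y.
Proof.
set S := \sum_(1 <= d < m.+1) _.
have JS1 : J 1 S.
  rewrite /S big_nat; apply: Jsum => d /andP[d0 _].
  exact: Jle d0 (dyn_eigen d).1.
suff -> : S = Z by exact: expZ.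
apply/eqP; rewrite -subr_eq0; apply/eqP; apply: Dinj; first exact: JB.
have DS : D * S - S * D = \sum_(1 <= d < m.+1) d%:R *: dynkin_term br d X Y.
  rewrite /S mulr_sumr mulr_suml -sumrB; apply: eq_bigr => d _.
  exact: (dyn_eigen d).2.
have DZ : D * Z - Z * D = \sum_(1 <= d < m.+1) d%:R *: dynkin_term br d X Y.
  rewrite log_derivative (@horner_algE _ _ _ _ N) ?size_poly // le_sumE.
  under eq_bigr => n _ do
    rewrite leZE leXE iter_Op_parts coef_poly ltn_ord scaler_sumr.
  rewrite exchange_big /= !big_nat; apply: eq_bigr => d; rewrite ltnS.
  exact: dyn_degree.
have sw (w x y z : A) : w - x - (y - z) = w - y - (x - z).
  by rewrite !opprB [z - y]addrC addrACA [- x + z]addrC.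
by apply/eqP; rewrite -subr_eq0 mulrBr mulrBl sw DS DZ subrr.
Qed.

End DynkinFormula.

Section FilteredDynkin.
Variables (K : fieldType) (B : lmodType K) (nzB : exists b : B, b != 0).
Hypothesis K0 : [pchar K] =i pred0.
Variables (m : nat) (F : nat -> B -> Prop) (x y : linEnd_of nzB).
Hypothesis F0 : forall i, F i 0.
Hypothesis FD : forall i a b, F i a -> F i b -> F i (a + b).
Hypothesis FZ : forall i c a, F i a -> F i (c *: a).
Hypothesis Ftop : forall b, F 0 b.
Hypothesis Fbot : forall b, F m.+1 b -> b = 0.
Hypothesis xF : forall i b, F i b -> F i.+1 (x b).
Hypothesis yF : forall i b, F i b -> F i.+1 (y b).

Local Notation M := {ffun 'I_m.+1 -> B}.

Fact ffun_nontrivial : exists v : M, v != 0.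
Proof.
case: nzB => b b0; exists [ffun=> b]; apply: contraNneq b0 => /ffunP/(_ ord0).
by rewrite !ffunE => ->.
Qed.
Local Notation End := (linEnd_of ffun_nontrivial).

(* v_0 + v_1 t + .. |-> t (z v_0 + z v_1 t + ..), truncated after t ^ m       *)
Definition shift_fun (z : linEnd_of nzB) (v : M) : M :=
  [ffun i => (if val i is j.+1 then z (v (inord j)) else 0) : B].

Fact shift_is_linear z : linear (shift_fun z).
Proof.
move=> c u v; apply/ffunP => i; rewrite !ffunE.
by case: (val i) => [|j]; rewrite ?scaler0 ?addr0 // !ffunE linearP.
Qed.
Definition shift z : End := LinEnd (shift_is_linear z).

Definition grade_fun (v : M) : M := [ffun i => (v i *+ i) : B].

Fact grade_is_linear : linear grade_fun.
Proof.
move=> c u v; apply/ffunP => i; rewrite !ffunE mulrnDl; congr (_ + _).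
by rewrite scalerMnr.
Qed.
Definition grade : End := LinEnd grade_is_linear.

Definition raises j (T : End) : Prop := forall (v : M) i0,
  (forall i : 'I_m.+1, (i < i0)%N -> v i = 0) ->
  forall i : 'I_m.+1, (i < i0 + j)%N -> T v i = 0.

Lemma raises_shift z : raises 1 (shift z).
Proof.
move=> v i0 v0 [[|i] im] /=; rewrite addn1 ltnS ffunE //= => ii.
by rewrite v0 ?linear0 // inordK //; exact: ltnW.
Qed.

Lemma grade_shift z : grade * shift z - shift z * grade = shift z.
Proof.
apply: linEndP => v; rewrite leBE !leME; apply/ffunP => -[[|i] im]; rewrite !ffunE /=.
  by rewrite mulr0n subr0.
rewrite ffunE inordK; last exact: ltnW.
by rewrite linearMn -mulrnBr // subSnn.
Qed.

(** Commuting with [grade], whose eigenvalues are distinct in characteristic 0, forces T to preserve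
    the degree in t, while T also raises it. *)
Lemma grade_inj (T : End) : raises 1 T -> grade * T = T * grade -> T = 0.
Proof.
move=> T1 Tg; have single k b : T [ffun i : 'I_m.+1 => if i == k then b else 0] = 0.
  set v := [ffun i => _]; apply/ffunP => i; rewrite ffunE.
  have gv : grade v = v *+ k.
    apply/ffunP => j; rewrite /= !ffunE ffunMnE !ffunE.
    by case: eqP => [->|_]; rewrite ?mul0rn.
  have [ik|ki] := leqP i k.
    apply: (T1 v k); last by rewrite addn1 ltnS.
    by move=> j jk; rewrite ffunE; case: eqP => // e; rewrite e ltnn in jk.
  have /ffunP/(_ i) : grade (T v) = T v *+ k.
    by rewrite -linearMn -gv -[RHS]leME -Tg.
  rewrite ffunE ffunMnE => /eqP; rewrite -subr_eq0 -mulrnBr ?(ltnW ki) //.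
  rewrite -scaler_nat scaler_eq0; case/orP => [|/eqP //].
  by move/pcharf0P: K0 => ->; rewrite subn_eq0 leqNgt ki.
apply: linEndP => v; rewrite le0E.
have -> : v = \sum_k [ffun i : 'I_m.+1 => if i == k then v k else 0].
  apply/ffunP => j; rewrite sum_ffunE (bigD1 j) //= ffunE eqxx big1 ?addr0 //.
  by move=> k /negPf; rewrite ffunE eq_sym => ->.
by rewrite linear_sum big1 // => k _; exact: single.
Qed.

Definition graded (v : M) := forall i : 'I_m.+1, F i (v i).

(* T corresponds to z under the evaluation t = 1.                             *)
Definition evaluates_to (T : End) (z : linEnd_of nzB) : Prop := forall v : M,
  graded v -> graded (T v) /\ \sum_i T v i = z (\sum_i v i).

Lemma evaluates_shift (z : linEnd_of nzB) : (forall i b, F i b -> F i.+1 (z b)) ->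
  evaluates_to (shift z) z.
Proof.
move=> zF v gv; split=> [[[|i] im]|]; rewrite ?ffunE //=.
  have := gv (inord i : 'I_m.+1); rewrite inordK; last exact: ltnW.
  exact: zF.
rewrite big_ord_recl ffunE /= add0r [in RHS]big_ord_recr linearD /=.
(* The component lost by truncating t would land in index m + 1 of the filtration, where everything
   vanishes. *)
rewrite (Fbot (zF _ _ (gv ord_max))) addr0 linear_sum; apply: eq_bigr => i _.
rewrite ffunE /=; congr (z (v _)); apply: val_inj => /=.
by rewrite inordK // ltnW // ltnS ltn_ord.
Qed.

Lemma evaluates0 : evaluates_to 0 0.
Proof.
by move=> v gv; split=> [i|]; rewrite ?ffunE // big1 // => i _; rewrite ffunE.
Qed.

Lemma evaluatesD T U z w : evaluates_to T z -> evaluates_to U w ->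
  evaluates_to (T + U) (z + w).
Proof.
move=> hT hU v gv; have [gT eT] := hT v gv; have [gU eU] := hU v gv.
split=> [i|]; first by rewrite leDE ffunE; apply: FD.
by rewrite !leDE -eT -eU -big_split; apply: eq_bigr => i _; rewrite ffunE.
Qed.

Lemma evaluatesZ c T z : evaluates_to T z -> evaluates_to (c *: T) (c *: z).
Proof.
move=> hT v gv; have [gT eT] := hT v gv; split=> [i|].
  by rewrite leZE ffunE; apply: FZ.
by rewrite !leZE -eT scaler_sumr; apply: eq_bigr => i _; rewrite ffunE.
Qed.

Lemma evaluatesM T U z w : evaluates_to T z -> evaluates_to U w ->
  evaluates_to (T * U) (z * w).
Proof.
move=> hT hU v gv; have [gU eU] := hU v gv; have [gT eT] := hT _ gU.
by split; rewrite ?leME // -eU -eT.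
Qed.

Lemma evaluates1 : evaluates_to 1 1. Proof. by []. Qed.

Lemma evaluates_sum I (r : seq I) (P : pred I) G H :
  (forall i, P i -> evaluates_to (G i) (H i)) ->
  evaluates_to (\sum_(i <- r | P i) G i) (\sum_(i <- r | P i) H i).
Proof.
move=> h; apply: (big_rec2 evaluates_to); first exact: evaluates0.
by move=> i z T Pi hT; apply: evaluatesD => //; exact: h.
Qed.

Lemma evaluatesX T z i : evaluates_to T z -> evaluates_to (T ^+ i) (z ^+ i).
Proof.
move=> hT; elim: i => [|i IH]; first exact: evaluates1.
by rewrite !exprS; exact: evaluatesM.
Qed.

Lemma evaluates_nexp n T z : evaluates_to T z -> evaluates_to (nexp n T) (nexp n z).
Proof.
move=> hT; rewrite !nexpE; apply: evaluates_sum => i _; apply: evaluatesZ.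
exact: evaluatesX.
Qed.

Lemma evaluates_nested (w : seq (End * linEnd_of nzB)) :
  (forall p, p \in w -> evaluates_to p.1 p.2) ->
  evaluates_to (nested (fun a b => a * b - b * a) [seq p.1 | p <- w])
               (nested (fun a b => a * b - b * a) [seq p.2 | p <- w]).
Proof.
elim: w => [|p w IH] hw; first exact: evaluates0.
have hp : evaluates_to p.1 p.2 by apply: hw; rewrite mem_head.
have {}IH : evaluates_to (nested (fun a b => a * b - b * a) [seq p.1 | p <- w])
               (nested (fun a b => a * b - b * a) [seq p.2 | p <- w]).
  by apply: IH => q qw; apply: hw; rewrite inE qw orbT.
case: w IH {hw} => [|q w] IH //.
rewrite -[map fst _]/(p.1 :: map fst (q :: w)) -[map snd _]/(p.2 :: map snd (q :: w)).
rewrite (@nested_cons _ _ _ p.1) // (@nested_cons _ _ _ p.2) //.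
apply: evaluatesD; first exact: evaluatesM.
by rewrite -!scaleN1r; apply/evaluatesZ/evaluatesM.
Qed.

Lemma evaluates_dynkin d T U z w : evaluates_to T z -> evaluates_to U w ->
  evaluates_to (dynkin_term (fun a b => a * b - b * a) d T U)
               (dynkin_term (fun a b => a * b - b * a) d z w).
Proof.
move=> hT hU; apply: evaluatesZ; apply: evaluates_sum => n _; apply: evaluatesZ.
apply: evaluates_sum => t _; apply: evaluatesZ; set s := nat_pairs t.
pose W := flatten [seq nseq rs.1 (T, z) ++ nseq rs.2 (U, w) | rs <- s].
have e1 : dynkin_word T U s = [seq p.1 | p <- W].
  rewrite /dynkin_word /W map_flatten -map_comp; congr flatten; apply: eq_map => p /=.
  by rewrite map_cat !map_nseq.
have e2 : dynkin_word z w s = [seq p.2 | p <- W].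
  rewrite /dynkin_word /W map_flatten -map_comp; congr flatten; apply: eq_map => p /=.
  by rewrite map_cat !map_nseq.
rewrite e1 e2; apply: evaluates_nested => p /flattenP[u /mapP[rs _ ->]].
by rewrite mem_cat => /orP[] /nseqP[-> _].
Qed.

(** No derivation giving x and y degree one is available on B itself. The formula is therefore
    proved for t x and t y, with t d/dt as derivation, and evaluated at t = 1 on graded vectors, for
    which the truncation in t loses nothing. *)
Lemma dynkin_formula_filtered :
  nexp m.*2.+1 (\sum_(1 <= d < m.+1) dynkin_term (fun a b => a * b - b * a) d x y) =
  nexp m.*2.+1 x * nexp m.*2.+1 y.
Proof.
have eq : nexp m.*2.+1 (\sum_(1 <= d < m.+1)
      dynkin_term (fun a b => a * b - b * a) d (shift x) (shift y)) =
    nexp m.*2.+1 (shift x) * nexp m.*2.+1 (shift y).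
  apply: (@dynkin_formula _ _ K0 m raises grade).
  - by move=> i v i0 _ j _; rewrite ffunE.
  - by move=> v i0 v0 i; rewrite addn0; exact: v0.
  - move=> i T U hT hU v i0 v0 j ji.
    by rewrite leDE ffunE (hT _ _ v0 _ ji) (hU _ _ v0 _ ji) addr0.
  - by move=> i c T hT v i0 v0 j ji; rewrite leZE ffunE (hT _ _ v0 _ ji) scaler0.
  - move=> i j T U hT hU v i0 v0 k ki; rewrite leME.
    apply: (hT (U v) (i0 + j)%N (hU _ _ v0)).
    by rewrite -addnA [(j + i)%N]addnC.
  - by move=> i T hT v i0 v0 j ji; apply: (hT _ _ v0); rewrite addnS ltnW.
  - move=> T hT; apply: linEndP => v; apply/ffunP => i; rewrite le0E ffunE.
    by apply: (hT v 0%N).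
  - exact: raises_shift.
  - exact: raises_shift.
  - exact: grade_shift.
  - exact: grade_shift.
  - exact: grade_inj.
apply: linEndP => b.
pose v : M := [ffun i => if i == ord0 then b else 0].
have gv : graded v.
  by move=> i; rewrite ffunE; case: eqP => [->|_].
have vb : \sum_i v i = b.
  rewrite (bigD1 ord0) //= ffunE eqxx big1 ?addr0 // => i /negPf.
  by rewrite ffunE => ->.
have ex := evaluates_shift xF; have ey := evaluates_shift yF.
have [_ e1] := evaluatesM (evaluates_nexp m.*2.+1 ex) (evaluates_nexp m.*2.+1 ey) gv.
have eS : evaluates_to
    (\sum_(1 <= d < m.+1) dynkin_term (fun a b => a * b - b * a) d (shift x) (shift y))
    (\sum_(1 <= d < m.+1) dynkin_term (fun a b => a * b - b * a) d x y).
  by apply: evaluates_sum => d _; exact: evaluates_dynkin.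
have [_ e2] := evaluates_nexp m.*2.+1 eS gv.
by rewrite -vb -e1 -e2 eq.
Qed.

End FilteredDynkin.

(** * The Kostant-Kirillov bracket on formal series *)

Section FormalSeries.
Variables (K : fieldType) (V : lmodType K).

Fact shat_var_is_linear : linear (@shat_var K V).
Proof.
by move=> c u v; apply: shatP => n /=; case: eqP => _; rewrite ?linearP ?scaler0 ?addr0.
Qed.
HB.instance Definition _ :=
  GRing.isLinear.Build _ _ _ _ (@shat_var K V) shat_var_is_linear.

Definition shat_of : symAlg V -> Shat V := sym_ext (@shat_var K V).
HB.instance Definition _ := GRing.LRMorphism.on shat_of.

Lemma shat_addE (f g : Shat V) n : (f + g) n = f n + g n. Proof. by []. Qed.
Lemma shat_oppE (f : Shat V) n : (- f) n = - f n. Proof. by []. Qed.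
Lemma shat_subE (f g : Shat V) n : (f - g) n = f n - g n. Proof. by []. Qed.
Lemma shat_scaleE c (f : Shat V) n : (c *: f) n = c *: f n. Proof. by []. Qed.
Lemma shat_mul_comp (f g : Shat V) n : (f * g) n = \sum_(i < n.+1) f i * g (n - i)%N.
Proof. by []. Qed.
Lemma shat_sumE I (r : seq I) (P : pred I) (F : I -> Shat V) n :
  (\sum_(i <- r | P i) F i) n = \sum_(i <- r | P i) F i n.
Proof. by elim/big_rec2: _ => [|i x y _ <-]. Qed.

Lemma shat_varM v (f : Shat V) n :
  (shat_var v * f) n = if n is n'.+1 then sym_var v * f n' else 0.
Proof.
rewrite shat_mul_comp; case: n => [|n]; first by rewrite big_ord1 /= mul0r.
rewrite big_ord_recl mul0r add0r big_ord_recl /= subSS subn0 big1 ?addr0 // => i _.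
by rewrite mul0r.
Qed.

Lemma shat_of_homog d (z : symAlg V) n : homog d z ->
  shat_of z n = if n == d then z else 0.
Proof.
move=> hz; elim/homog_ind: hz n => [|x y hx hy|c x hx|s <-] n.
- by rewrite linear0; case: eqP.
- by rewrite linearD shat_addE hx hy; case: eqP; rewrite ?addr0.
- by rewrite linearZ shat_scaleE hx; case: eqP; rewrite ?scaler0.
elim: s n => [|v s IH] n; first by rewrite big_nil rmorph1 /=; case: n.
have sM a b : shat_of (a * b) = shat_of a * shat_of b by exact: rmorphM.
have sv : shat_of (sym_var v) = shat_var v by exact: sym_ext_var.
rewrite big_cons sM sv shat_varM.
by case: n => [|n] //; rewrite IH eqSS; case: eqP; rewrite ?mulr0.
Qed.

Definition agree n (f g : Shat V) : Prop := forall k, (k < n)%N -> f k = g k.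

Definition truncate n (f : Shat V) : symAlg V := \sum_(k < n) f k.

Lemma agree_truncate n f : agree n f (shat_of (truncate n f)).
Proof.
move=> k kn; rewrite /truncate linear_sum shat_sumE (bigD1 (Ordinal kn)) //=.
rewrite (shat_of_homog _ (scomp_homog _ _)) eqxx big1 ?addr0 // => i /negPf ik.
by rewrite (shat_of_homog _ (scomp_homog _ _)) eq_sym -[k]/(val (Ordinal kn))
  (inj_eq val_inj) ik.
Qed.

Lemma agreeD n f f' g g' : agree n f f' -> agree n g g' -> agree n (f + g) (f' + g').
Proof. by move=> h1 h2 k kn; rewrite !shat_addE h1 ?h2. Qed.

Lemma agreeM n f f' g g' : agree n f f' -> agree n g g' -> agree n (f * g) (f' * g').
Proof.
move=> h1 h2 k kn; rewrite !shat_mul_comp; apply: eq_bigr => i _.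
by rewrite h1 ?h2 // ?(leq_ltn_trans (leq_subr _ _)) // (leq_ltn_trans (leq_ord i)).
Qed.

Lemma agree_le m n f g : (m <= n)%N -> agree n f g -> agree m f g.
Proof. by move=> mn h k km; rewrite h // (leq_trans km). Qed.

Lemma agree_eq f g : (forall n, agree n f g) -> f = g.
Proof. by move=> h; apply: shatP => n; apply: (h n.+1). Qed.

Lemma agree_refl n f : agree n f f. Proof. by []. Qed.

Lemma agree_sym n f g : agree n f g -> agree n g f.
Proof. by move=> h k kn; rewrite h. Qed.

Lemma agree_trans n f g h : agree n f g -> agree n g h -> agree n f h.
Proof. by move=> h1 h2 k kn; rewrite h1 ?h2. Qed.

Lemma order_ge_sub n f g : order_ge n (f - g) <-> agree n f g.
Proof.
split=> h k kn; first by apply/eqP; rewrite -subr_eq0; apply/eqP/h.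
by rewrite shat_subE h ?subrr.
Qed.

Lemma order_ge0 n : order_ge n (0 : Shat V). Proof. by []. Qed.
Lemma order_geD n (f g : Shat V) : order_ge n f -> order_ge n g -> order_ge n (f + g).
Proof. by move=> h1 h2 k kn; rewrite shat_addE h1 ?h2 ?addr0. Qed.
Lemma order_geZ n c (f : Shat V) : order_ge n f -> order_ge n (c *: f).
Proof. by move=> h k kn; rewrite shat_scaleE h ?scaler0. Qed.
Lemma order_geN n (f : Shat V) : order_ge n f -> order_ge n (- f).
Proof. by move=> h k kn; rewrite shat_oppE h ?oppr0. Qed.
Lemma order_ge_sum n I (r : seq I) (P : pred I) (F : I -> Shat V) :
  (forall i, P i -> order_ge n (F i)) -> order_ge n (\sum_(i <- r | P i) F i).
Proof. by move=> h; apply: (big_ind (order_ge n)) => //; exact: order_geD. Qed.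
Lemma order_ge_le m n (f : Shat V) : (m <= n)%N -> order_ge n f -> order_ge m f.
Proof. by move=> mn h k km; rewrite h // (leq_trans km). Qed.

End FormalSeries.

Section KostantKirillov.
Variables (K : fieldType) (V : lmodType K) (mu : V -> V -> V).
Hypothesis mu_lie : lie_bracket mu.
Local Notation S := (symAlg V).

Fact mul_linear v : linear (mu^~ v). Proof. exact: lie_linearl. Qed.
Fact mur_linear u : linear (mu u). Proof. exact: lie_linearr. Qed.
Let ad_r (v : V) : V -> V := mu^~ v.
Let ad_l (u : V) : V -> V := mu u.
HB.instance Definition _ v := GRing.isLinear.Build _ _ _ _ (ad_r v) (mul_linear v).
HB.instance Definition _ u := GRing.isLinear.Build _ _ _ _ (ad_l u) (mur_linear u).

Definition sym_poisson (x y : S) : S :=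
  sym_der idfun (fun v => sym_der idfun (fun u => sym_var (mu u v)) x) y.

Lemma sym_map_idfun : sym_map idfun = idfun :> (S -> S).
Proof.
apply/funext => x; symmetry; exact: (@eq_sym_ext _ _ _ _ idfun).
Qed.

Let der_r v : sym_der idfun (fun u => sym_var (mu u v)) =
   tder idfun (ad_r v) :> (S -> S).
Proof. by rewrite /tder sym_map_idfun. Qed.

Let der_r_linear x : linear (fun v => sym_der idfun (fun u => sym_var (mu u v)) x : S).
Proof.
move=> c u v; rewrite !der_r.
elim/sym_ind: x => [w|d|x y hx hy|x y hx hy].
- by rewrite !tder_var /= /ad_r (lie_linearr mu_lie) linearP.
- by rewrite !tder_cst scaler0 addr0.
- by rewrite !linearD /= hx hy addrACA.
- by rewrite !tderM hx hy mulrDl mulrDr -scalerAl -scalerAr scalerDr addrACA.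
Qed.

Lemma sym_poisson_varr x v : sym_poisson x (sym_var v) = tder idfun (ad_r v) x.
Proof. by rewrite /sym_poisson sym_der_var // der_r. Qed.

Lemma sym_poisson_var u v : sym_poisson (sym_var u) (sym_var v) = sym_var (mu u v).
Proof. by rewrite sym_poisson_varr tder_var. Qed.

Lemma sym_poissonMr x y z :
  sym_poisson x (y * z) = sym_poisson x y * z + y * sym_poisson x z.
Proof. exact: (sym_derM idfun (der_r_linear x)). Qed.

Lemma sym_poissonDr x y z : sym_poisson x (y + z) = sym_poisson x y + sym_poisson x z.
Proof. exact: (sym_derD idfun (der_r_linear x)). Qed.

Lemma sym_poisson_cstr x c : sym_poisson x c%:A = 0.
Proof. exact: (sym_der_cst idfun (der_r_linear x)). Qed.

Lemma sym_poissonZr x c y : sym_poisson x (c *: y) = c *: sym_poisson x y.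
Proof. by rewrite -mulr_algl sym_poissonMr sym_poisson_cstr mul0r add0r mulr_algl. Qed.

Lemma sym_poissonDl x y z : sym_poisson (x + y) z = sym_poisson x z + sym_poisson y z.
Proof.
elim/sym_ind: z => [v|c|a b ha hb|a b ha hb].
- by rewrite !sym_poisson_varr linearD.
- by rewrite !sym_poisson_cstr addr0.
- by rewrite !sym_poissonDr ha hb addrACA.
- by rewrite !sym_poissonMr ha hb; ring.
Qed.

Lemma sym_poissonMl x y z :
  sym_poisson (x * y) z = sym_poisson x z * y + x * sym_poisson y z.
Proof.
elim/sym_ind: z => [v|c|a b ha hb|a b ha hb].
- by rewrite !sym_poisson_varr tderM !sym_map_idfun.
- by rewrite !sym_poisson_cstr mul0r mulr0 addr0.
- by rewrite !sym_poissonDr ha hb; ring.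
- by rewrite !sym_poissonMr ha hb; ring.
Qed.

Lemma sym_poisson_cstl x c : sym_poisson c%:A x = 0.
Proof.
elim/sym_ind: x => [v|d|a b ha hb|a b ha hb].
- by rewrite !sym_poisson_varr tder_cst.
- by rewrite !sym_poisson_cstr.
- by rewrite sym_poissonDr ha hb addr0.
- by rewrite sym_poissonMr ha hb mul0r mulr0 addr0.
Qed.

Lemma sym_poissonZl x c y : sym_poisson (c *: x) y = c *: sym_poisson x y.
Proof. by rewrite -mulr_algl sym_poissonMl sym_poisson_cstl mul0r add0r mulr_algl. Qed.

Lemma lie_anti u v : mu u v = - mu v u.
Proof.
have := lie_alt mu_lie (u + v).
have muDr a b c : mu a (b + c) = mu a b + mu a c.
  by have := lie_linearr mu_lie a 1 b c; rewrite !scale1r.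
have muDl a b c : mu (a + b) c = mu a c + mu b c.
  by have := lie_linearl mu_lie c 1 a b; rewrite !scale1r.
by rewrite muDr !muDl !lie_alt // add0r addr0 addrC => /eqP; rewrite addr_eq0 => /eqP.
Qed.

Lemma sym_poisson_anti x y : sym_poisson x y = - sym_poisson y x.
Proof.
elim/sym_ind: y x => [v|c|a b ha hb|a b ha hb] x.
- elim/sym_ind: x => [u|c|a b ha hb|a b ha hb].
  + by rewrite !sym_poisson_var lie_anti linearN.
  + by rewrite sym_poisson_cstl sym_poisson_cstr oppr0.
  + by rewrite sym_poissonDl sym_poissonDr ha hb opprD.
  + by rewrite sym_poissonMl sym_poissonMr ha hb; ring.
- by rewrite sym_poisson_cstl sym_poisson_cstr oppr0.
- by rewrite sym_poissonDl sym_poissonDr ha hb opprD.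
- by rewrite sym_poissonMl sym_poissonMr ha hb; ring.
Qed.

Lemma sym_poisson0r x : sym_poisson x 0 = 0.
Proof. by have := sym_poissonZr x 0 0; rewrite !scale0r. Qed.
Lemma sym_poisson0l x : sym_poisson 0 x = 0.
Proof. by have := sym_poissonZl 0 0 x; rewrite !scale0r. Qed.

Let jac x y z := sym_poisson x (sym_poisson y z) + sym_poisson y (sym_poisson z x)
  + sym_poisson z (sym_poisson x y).

Let jac_rot x y z : jac x y z = jac y z x.
Proof. by rewrite /jac [RHS]addrC addrA. Qed.

Let jacD x y z t : jac x y (z + t) = jac x y z + jac x y t.
Proof.
rewrite /jac !(sym_poissonDr, sym_poissonDl); ring.
Qed.

Let jacM x y z t : jac x y (z * t) = jac x y z * t + z * jac x y t.
Proof.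
rewrite /jac !(sym_poissonMr, sym_poissonMl, sym_poissonDr, sym_poissonDl).
rewrite [sym_poisson x t]sym_poisson_anti [sym_poisson x z]sym_poisson_anti; ring.
Qed.

Let jac_cst x y c : jac x y c%:A = 0.
Proof.
by rewrite /jac !(sym_poisson_cstr, sym_poisson_cstl, sym_poisson0r) !addr0.
Qed.

(** The Jacobiator is invariant under rotation and a derivation in its last argument, so the
    arguments can be replaced by generators one after the other. *)
Lemma sym_poisson_jacobi x y z : sym_poisson x (sym_poisson y z)
  + sym_poisson y (sym_poisson z x) + sym_poisson z (sym_poisson x y) = 0.
Proof.
rewrite -/(jac x y z).
have gen a b : (forall w, jac a b (sym_var w) = 0) -> forall c, jac a b c = 0.
  move=> h; elim/sym_ind => [w|c|c d hc hd|c d hc hd]; first exact: h.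
  - exact: jac_cst.
  - by rewrite jacD hc hd addr0.
  - by rewrite jacM hc hd mul0r mulr0 addr0.
apply: (gen) => w; rewrite -jac_rot; apply: (gen) => v; rewrite -jac_rot.
apply: (gen) => u; rewrite /jac !sym_poisson_var -!linearD.
by rewrite lie_jacobi ?linear0.
Qed.

End KostantKirillov.

Lemma sym_homog_ind (K : fieldType) (V : lmodType K) (Q : symAlg V -> Prop) :
  (forall d x, homog d x -> Q x) -> (forall x y, Q x -> Q y -> Q (x + y)) ->
  forall x, Q x.
Proof.
move=> Qh QD x; pose mono (y : symAlg V) := exists s : seq V, y = \prod_(v <- s) sym_var v.
suff: Defs.span mono x.
  elim=> [|y z _ Qy _ Qz|c _ [s ->]]; first exact/(Qh 0%N)/homog0.
    exact: QD.
  by apply: (Qh (size s)); apply: homogZ; exact: homog_prod.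
have spanZ' c y : Defs.span mono y -> Defs.span mono (c *: y).
  elim=> [|y1 y2 _ h1 _ h2|d z Sz]; first by rewrite scaler0; exact: span0.
    by rewrite scalerDr; exact: spanD.
  by rewrite scalerA; exact: spanZ.
elim/sym_ind: x => [v|c|y z hy hz|y z hy hz].
- by rewrite -[sym_var v]scale1r; apply: spanZ; exists [:: v]; rewrite big_seq1.
- by apply: spanZ; exists [::]; rewrite big_nil.
- exact: spanD.
elim: hy => [|y1 y2 _ h1 _ h2|c _ [s ->]].
- by rewrite mul0r; exact: span0.
- by rewrite mulrDl; exact: spanD.
rewrite -scalerAl; apply: spanZ'; elim: hz => [|z1 z2 _ h1 _ h2|d _ [t ->]].
- by rewrite mulr0; exact: span0.
- by rewrite mulrDr; exact: spanD.
by rewrite -scalerAr; apply: spanZ; exists (s ++ t); rewrite big_cat.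
Qed.

Section PoissonStructure.
Variables (K : fieldType) (V : lmodType K) (mu : V -> V -> V).
Hypothesis mu_lie : lie_bracket mu.
Local Notation br := (sym_poisson mu).
Local Notation kk := (kostant_kirillov mu).

Lemma homog_sym_poisson k l x y : homog k x -> homog l y -> homog (k + l).-1 (br x y).
Proof.
move=> hx; have hv v : homog k (br x (sym_var v)).
  by rewrite (sym_poisson_varr mu_lie); exact: homog_tder.
elim/homog_ind => [|a b ha hb|c a ha|s <-].
- by rewrite (sym_poisson0r mu_lie); exact: homog0.
- by rewrite (sym_poissonDr mu_lie); exact: homogD.
- by rewrite (sym_poissonZr mu_lie); exact: homogZ.
elim: s => [|v s IH].
  by rewrite big_nil -[1]scale1r (sym_poisson_cstr mu_lie); exact: homog0.
rewrite big_cons (sym_poissonMr mu_lie) /= addnS /=; apply: homogD.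
  by apply: homogM (hv v) _; exact: homog_prod.
case: s IH => [|w s] IH.
  by rewrite big_nil -[1]scale1r (sym_poisson_cstr mu_lie) mulr0; exact: homog0.
move: IH; rewrite /= !addnS /= => IH; rewrite -add1n.
by apply: homogM IH; exact: homog_var.
Qed.

Lemma sym_poisson_homog0l x y : homog 0 x -> br x y = 0.
Proof.
elim/homog_ind => [|a b ha hb|c a ha|s /size0nil ->].
- exact: (sym_poisson0l mu_lie).
- by rewrite (sym_poissonDl mu_lie) ha hb addr0.
- by rewrite (sym_poissonZl mu_lie) ha scaler0.
- by rewrite big_nil -[1]scale1r (sym_poisson_cstl mu_lie).
Qed.

Lemma sym_poisson_homog0r x y : homog 0 y -> br x y = 0.
Proof. by move=> hy; rewrite (sym_poisson_anti mu_lie) sym_poisson_homog0l ?oppr0. Qed.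

Lemma sym_bider_poisson x y :
  sym_bider (fun u v => shat_var (mu u v)) x y = shat_of (br x y).
Proof.
rewrite /sym_bider -[sym_lift (@shat_var K V)]/(@shat_of K V).
set d := fun v => _.
have inner z v : sym_der (@shat_of K V) (fun u => shat_var (mu u v)) z =
    shat_of (br z (sym_var v)).
  have lin : linear (fun u => shat_var (mu u v)).
    by move=> c a b; rewrite (lie_linearl mu_lie) linearP.
  elim/sym_ind: z => [w|c|a b ha hb|a b ha hb].
  - by rewrite sym_der_var // (sym_poisson_var mu_lie) [RHS]sym_ext_var.
  - by rewrite (sym_der_cst _ lin) (sym_poisson_cstl mu_lie) linear0.
  - by rewrite (sym_derD _ lin) ha hb (sym_poissonDl mu_lie) linearD.
  - by rewrite (sym_derM _ lin) ha hb (sym_poissonMl mu_lie) linearD !rmorphM.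
have dE v : d v = shat_of (br x (sym_var v)) by exact: inner.
have lin : linear d.
  by move=> c a b; rewrite !dE linearP (sym_poissonDr mu_lie) (sym_poissonZr mu_lie) linearP.
elim/sym_ind: y => [w|c|a b ha hb|a b ha hb].
- by rewrite sym_der_var // dE.
- by rewrite (sym_der_cst _ lin) (sym_poisson_cstr mu_lie) linear0.
- by rewrite (sym_derD _ lin) ha hb (sym_poissonDr mu_lie) linearD.
- by rewrite (sym_derM _ lin) ha hb (sym_poissonMr mu_lie) linearD !rmorphM.
Qed.

Lemma kkE f g n : kk f g n =
  \sum_(k < n.+2) \sum_(l < n.+2) if (k + l == n.+1)%N then br (f k) (g l) else 0.
Proof.
rewrite /kostant_kirillov /shat_bider /= shat_sumE; apply: eq_bigr => k _.
rewrite shat_sumE; apply: eq_bigr => l _; rewrite sym_bider_poisson.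
have [k0|k0] := posnP k.
  by rewrite sym_poisson_homog0l ?linear0 ?if_same // k0; exact: scomp_homog.
have [l0|l0] := posnP l.
  by rewrite sym_poisson_homog0r ?linear0 ?if_same // l0; exact: scomp_homog.
rewrite (shat_of_homog _ (homog_sym_poisson (scomp_homog _ _) (scomp_homog _ _))).
by rewrite -(prednK k0) addSn /= eqSS eq_sym.
Qed.

Lemma agree_kk n f f' g g' : agree n.+1 f f' -> agree n.+1 g g' ->
  agree n (kk f g) (kk f' g').
Proof.
move=> hf hg k kn; rewrite !kkE; apply: eq_bigr => i _; apply: eq_bigr => j _.
by rewrite hf ?hg // (leq_trans (ltn_ord _)) // ltnS.
Qed.

(** The constant term of [g] is left free since the bracket kills it. With b = 1 nothing at all is
    asked of [g]: bracketing with [f] of order a always gives order at least a. *)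
Lemma order_ge_kk a b f (g : Shat V) : order_ge a f -> (forall l, (0 < l < b)%N -> g l = 0) ->
  order_ge (a + b).-1 (kk f g).
Proof.
move=> hf hg n nab; rewrite kkE big1 // => k _; rewrite big1 // => l _.
case: eqP => // kl; have [ka|ak] := ltnP k a.
  by rewrite hf // (sym_poisson0l mu_lie).
have [l0|l0] := posnP l; first by rewrite sym_poisson_homog0r // l0; exact: scomp_homog.
rewrite hg ?(sym_poisson0r mu_lie) // l0 -(ltn_add2l a).
apply: leq_ltn_trans (leq_add ak (leqnn l)) _; rewrite kl.
by case: (a + b)%N nab.
Qed.

Lemma kk_linearl g : linear (kk^~ g).
Proof.
move=> c f f'; apply: shatP => n; rewrite shat_addE shat_scaleE !kkE scaler_sumr.
rewrite -big_split; apply: eq_bigr => k _; rewrite scaler_sumr -big_split.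
apply: eq_bigr => l _ /=; case: ifP => _; last by rewrite scaler0 addr0.
by rewrite (sym_poissonDl mu_lie) (sym_poissonZl mu_lie).
Qed.

Lemma kk_anti f g : kk f g = - kk g f.
Proof.
apply: shatP => n; rewrite shat_oppE !kkE exchange_big -sumrN; apply: eq_bigr => k _.
rewrite -sumrN; apply: eq_bigr => l _; rewrite addnC; case: ifP => _.
  by rewrite (sym_poisson_anti mu_lie).
by rewrite oppr0.
Qed.

Lemma kk_linearr f : linear (kk f).
Proof.
by move=> c g h; rewrite kk_anti kk_linearl opprD -scalerN -!kk_anti.
Qed.

Lemma kk_shat_of_homog a b x y : homog a x -> homog b y ->
  kk (shat_of x) (shat_of y) = shat_of (br x y).
Proof.
move=> hx hy; apply: shatP => n.
rewrite kkE (shat_of_homog _ (homog_sym_poisson hx hy)).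
under eq_bigr => k _ do under eq_bigr => l _ do
  rewrite (shat_of_homog _ hx) (shat_of_homog _ hy).
have [e|ne] := eqVneq (a + b)%N n.+1.
  have la : (a < n.+2)%N by rewrite ltnS -e leq_addr.
  have lb : (b < n.+2)%N by rewrite ltnS -e leq_addl.
  rewrite (bigD1 (Ordinal la)) //= (bigD1 (Ordinal lb)) //= !eqxx e eqxx /= eqxx.
  rewrite !big1 ?addr0 // => [k /negPf ka|l /negPf lb'].
    rewrite big1 // => l _; rewrite -val_eqE /= in ka.
    by rewrite ka (sym_poisson0l mu_lie) if_same.
  by rewrite -val_eqE /= in lb'; rewrite lb' (sym_poisson0r mu_lie) if_same.
have [a0|a0] := posnP a.
  rewrite a0 in hx; rewrite sym_poisson_homog0l // if_same big1 // => k _.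
  rewrite big1 // => l _; case: ifP => // _; case: (nat_of_ord k == a).
    exact: sym_poisson_homog0l.
  exact: (sym_poisson0l mu_lie).
rewrite (_ : n == (a + b).-1 = false); last first.
  by apply/negP => /eqP e; case/negP: ne; rewrite e prednK // addn_gt0 a0.
rewrite big1 // => k _; rewrite big1 // => l _; case: eqP => // e.
case: eqP => [ka|_]; last exact: (sym_poisson0l mu_lie).
case: eqP => [lb|_]; last exact: (sym_poisson0r mu_lie).
by case/negP: ne; rewrite -ka -lb e.
Qed.

Lemma kkDl f g h : kk (f + g) h = kk f h + kk g h.
Proof. by have := kk_linearl h 1 f g; rewrite !scale1r. Qed.
Lemma kkDr f g h : kk f (g + h) = kk f g + kk f h.
Proof. by have := kk_linearr f 1 g h; rewrite !scale1r. Qed.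
Lemma kk0l f : kk 0 f = 0.
Proof. by apply: (addIr (kk 0 f)); rewrite -kkDl !add0r. Qed.
Lemma kk0r f : kk f 0 = 0.
Proof. by rewrite kk_anti kk0l oppr0. Qed.
Lemma kkZl c f g : kk (c *: f) g = c *: kk f g.
Proof. by have := kk_linearl g c f 0; rewrite !addr0 kk0l addr0. Qed.
Lemma kkZr c f g : kk f (c *: g) = c *: kk f g.
Proof. by rewrite kk_anti kkZl -scalerN -kk_anti. Qed.
Lemma kkNr f g : kk f (- g) = - kk f g.
Proof. by rewrite -scaleN1r kkZr scaleN1r. Qed.

Lemma kk_shat_of x y : kk (shat_of x) (shat_of y) = shat_of (br x y).
Proof.
elim/sym_homog_ind: x => [a x hx|x1 x2 h1 h2]; last first.
  by rewrite linearD kkDl h1 h2 (sym_poissonDl mu_lie) linearD.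
elim/sym_homog_ind: y => [b y hy|y1 y2 h1 h2]; last first.
  by rewrite linearD kkDr h1 h2 (sym_poissonDr mu_lie) linearD.
exact: kk_shat_of_homog hx hy.
Qed.

Lemma kk_jacobi f g h : kk f (kk g h) + kk g (kk h f) + kk h (kk f g) = 0.
Proof.
(* Each bracket costs one degree, so two brackets need the arguments up to degree n + 1. *)
apply: agree_eq => n; pose tr (x : Shat V) := shat_of (truncate n.+2 x).
have T x : agree n.+2 x (tr x) by exact: agree_truncate.
apply: (@agree_trans _ _ _ _ (kk (tr f) (kk (tr g) (tr h)) + kk (tr g) (kk (tr h) (tr f))
  + kk (tr h) (kk (tr f) (tr g)))).
  have k2 x y z : agree n (kk x (kk y z)) (kk (tr x) (kk (tr y) (tr z))).
    by apply: agree_kk; [apply: agree_le (T x)|apply: agree_kk].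
  by apply: agreeD => //; exact: agreeD.
by rewrite !kk_shat_of -!linearD (sym_poisson_jacobi mu_lie) linear0.
Qed.

Lemma kk_leibniz f g h : kk f (g * h) = kk f g * h + g * kk f h.
Proof.
apply: agree_eq => n; pose tr (x : Shat V) := shat_of (truncate n.+1 x).
have T x : agree n.+1 x (tr x) by exact: agree_truncate.
apply: (@agree_trans _ _ _ _ (kk (tr f) (tr g * tr h))).
  by apply: agree_kk => //; exact: agreeM.
apply: (@agree_trans _ _ _ _ (kk (tr f) (tr g) * tr h + tr g * kk (tr f) (tr h))).
  by rewrite -rmorphM !kk_shat_of (sym_poissonMr mu_lie) linearD !rmorphM.
apply: agree_sym; apply: agreeD; apply: agreeM; do ?exact: agree_kk;
  exact: agree_le (leqnSn _) (T _).
Qed.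

Lemma kk_poisson_structure : poisson_structure kk.
Proof.
split.
- exact: kk_linearl.
- exact: kk_linearr.
- move=> f; apply: agree_eq => n; pose tr := shat_of (truncate n.+1 f).
  apply: (@agree_trans _ _ _ _ (kk tr tr)).
    by apply: agree_kk; exact: agree_truncate.
  rewrite kk_shat_of; set x := truncate _ _.
  suff -> : br x x = 0 by rewrite linear0.
  elim/sym_ind: {f tr}x => [v|c|a b ha hb|a b ha hb].
  + by rewrite (sym_poisson_var mu_lie) lie_alt // linear0.
  + exact: (sym_poisson_cstr mu_lie).
  + rewrite (sym_poissonDl mu_lie) !(sym_poissonDr mu_lie) ha hb.
    by rewrite [br b a](sym_poisson_anti mu_lie) add0r addr0 subrr.
  + rewrite (sym_poissonMl mu_lie) !(sym_poissonMr mu_lie) ha hb.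
    by rewrite [br b a](sym_poisson_anti mu_lie); ring.
- exact: kk_jacobi.
- exact: kk_leibniz.
- move=> n; exists n.+1 => f g hf k kn.
  have := @order_ge_kk n.+1 1 f g hf; rewrite addn1 /=; apply=> //.
    by move=> l /andP[l0]; rewrite ltnS leqNgt l0.
  exact: ltnW.
Qed.

Lemma kk_max_ideal f g : max_ideal (kk f g).
Proof.
rewrite /max_ideal kkE big1 // => k _; rewrite big1 // => l _; case: eqP => // kl.
have [k0|k0] := posnP k; first by rewrite sym_poisson_homog0l // k0; exact: scomp_homog.
have [l0|l0] := posnP l; first by rewrite sym_poisson_homog0r // l0; exact: scomp_homog.
by have := leq_add k0 l0; rewrite kl.
Qed.

End PoissonStructure.

(** * The group law *)

Section StarGroup.
Variables (K : fieldType) (V : lmodType K) (mu : V -> V -> V).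
Hypothesis K0 : [pchar K] =i pred0.
Hypothesis mu_lie : lie_bracket mu.
Local Notation kk := (kostant_kirillov mu).
Local Notation S := (Shat V).

Fact cutoff_homog N (f : S) n : homog n (if (n <= N)%N then f n else 0).
Proof. by case: ifP => _; [exact: scomp_homog|exact: homog0]. Qed.
Definition cutoff N (f : S) : S := MkShat (cutoff_homog N f).

Fact degree1_homog (f : S) n : homog n ((n%:R - 1) *: f n).
Proof. by apply: homogZ; exact: scomp_homog. Qed.
Definition degree1 (f : S) : S := MkShat (degree1_homog f).

Lemma cutoffE N f n : cutoff N f n = if (n <= N)%N then f n else 0.
Proof. by []. Qed.
Lemma degree1E f n : degree1 f n = (n%:R - 1) *: f n. Proof. by []. Qed.

Lemma degree1_linear : linear degree1.
Proof. by move=> c f g; apply: shatP => n /=; rewrite scalerDr !scalerA mulrC. Qed.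
HB.instance Definition _ := GRing.isLinear.Build _ _ _ _ degree1 degree1_linear.

Lemma cutoff_linear N : linear (cutoff N).
Proof.
by move=> c f g; apply: shatP => n /=; case: ifP => _; rewrite // scaler0 addr0.
Qed.
HB.instance Definition _ N := GRing.isLinear.Build _ _ _ _ (cutoff N) (cutoff_linear N).

Definition rep (f m : S) : S := kk f m + degree1 f * m.

Fact rep_linear f : linear (rep f).
Proof.
move=> c m p; rewrite /rep (kk_linearr mu_lie) mulrDr scalerDr -scalerAr.
by rewrite addrACA.
Qed.

Fact rho_linear N f : linear (fun m => cutoff N (rep f m)).
Proof. by move=> c m p; rewrite rep_linear linearP. Qed.

Lemma shat_nontrivial : exists f : S, f != 0. Proof. by exists 1; exact: oner_neq0. Qed.
Local Notation End := (linEnd_of shat_nontrivial).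

(* The bracket with f, corrected by deg - 1 so as to be faithful: f is read   *)
(* off from its value at 1.  The extra term makes it a representation because *)
(* the bracket lowers the degree by one.                                      *)
Definition rho N f : End := LinEnd (rho_linear N f).

Lemma rhoE N f m : rho N f m = cutoff N (rep f m). Proof. by []. Qed.

Lemma rho_is_linear N : linear (rho N).
Proof.
move=> c f g; apply: linEndP => m; rewrite leDE leZE !rhoE -linearZ -linearD.
congr (cutoff N _); rewrite /rep (kk_linearl mu_lie) linearP mulrDl scalerDr.
by rewrite -scalerAl addrACA.
Qed.
HB.instance Definition _ N := GRing.isLinear.Build _ _ _ _ (rho N) (rho_is_linear N).

Lemma order_geM a b (f g : S) : order_ge a f -> order_ge b g -> order_ge (a + b) (f * g).
Proof.
move=> hf hg n nab; rewrite shat_mul_comp big1 // => i _.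
have [ia|ai] := ltnP i a; first by rewrite hf ?mul0r.
rewrite hg ?mulr0 // -(ltn_add2l a) (leq_ltn_trans _ nab) //.
by rewrite -leq_subRL ?leq_sub2l // (leq_trans ai) // -ltnS.
Qed.

Lemma order_ge_degree1 a (f : S) : order_ge a f -> order_ge a (degree1 f).
Proof. by move=> hf n na; rewrite degree1E hf // scaler0. Qed.

Lemma order_ge_rep a b f m : order_ge a f -> order_ge b m ->
  order_ge (a + b).-1 (rep f m).
Proof.
move=> hf hm; apply: order_geD.
  by apply: (order_ge_kk mu_lie hf) => l /andP[_]; exact: hm.
by apply: order_ge_le (leq_pred _) _; apply: order_geM => //; exact: order_ge_degree1.
Qed.

Lemma order_ge_rep1 a f m : order_ge a f -> order_ge a (rep f m).
Proof.
move=> hf; apply: order_geD; last first.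
  by rewrite -[a]addn0; apply: order_geM => //; exact: order_ge_degree1.
have := @order_ge_kk _ _ _ mu_lie a 1 f m hf; rewrite addn1 /=; apply.
by move=> [|l].
Qed.

Lemma order_ge_cutoff N a (f : S) : order_ge a f -> order_ge a (cutoff N f).
Proof. by move=> hf n na; rewrite cutoffE hf // if_same. Qed.

Lemma cutoff0 N (f : S) : order_ge N.+1 f -> cutoff N f = 0.
Proof.
by move=> hf; apply: shatP => n; rewrite cutoffE; case: ifP => // nN; rewrite hf.
Qed.

Lemma rho0 N f : order_ge N.+1 f -> rho N f = 0.
Proof. by move=> hf; apply: linEndP => m; rewrite rhoE cutoff0 //; exact: order_ge_rep1. Qed.

Lemma rho_agree N f g : agree N.+1 f g -> rho N f = rho N g.
Proof.
move/order_ge_sub => h; apply/eqP; rewrite -subr_eq0 -linearB; apply/eqP.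
exact: rho0.
Qed.

(** The bracket sends degrees k and l to n = k + l - 1, and n - 1 = (k - 1) + (l - 1): the shift by
    one makes deg - 1 a derivation of the bracket, as a representation requires. *)
Lemma degree1_kk f g : degree1 (kk f g) = kk f (degree1 g) + kk (degree1 f) g.
Proof.
apply: shatP => n; rewrite shat_addE degree1E !(kkE mu_lie) scaler_sumr -big_split.
apply: eq_bigr => k _; rewrite scaler_sumr -big_split; apply: eq_bigr => l _ /=.
case: eqP => kl; last by rewrite scaler0 addr0.
rewrite (sym_poissonZl mu_lie) (sym_poissonZr mu_lie) -scalerDl; congr (_ *: _).
have -> : n%:R = k%:R + l%:R - 1 :> K by rewrite -natrD kl -natr1 addrK.
by ring.
Qed.

Lemma rep_kk f g m : rep (kk f g) m = rep f (rep g m) - rep g (rep f m).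
Proof.
rewrite /rep degree1_kk !(kkDr mu_lie) !(kk_leibniz mu_lie).
have := kk_jacobi mu_lie f g m.
rewrite [kk m f](kk_anti mu_lie) (kkNr mu_lie) [kk m (kk f g)](kk_anti mu_lie).
rewrite [kk (degree1 f) g](kk_anti mu_lie) => j.
have -> : kk (kk f g) m = kk f (kk g m) - kk g (kk f m).
  by apply/eqP; rewrite eq_sym -subr_eq0 j.
by ring.
Qed.

Lemma rho_kk N f g : order_ge 2 f -> order_ge 2 g ->
  rho N (kk f g) = rho N f * rho N g - rho N g * rho N f.
Proof.
(* As [rep a] does not lower orders, a cutoff before it has no effect in degrees up to N. *)
have cut a b m : order_ge 2 a -> rho N a (rho N b m) = cutoff N (rep a (rep b m)).
  move=> ha; rewrite !rhoE; apply/eqP; rewrite -subr_eq0 -linearB; apply/eqP.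
  have repB x y z : rep x (y - z) = rep x y - rep x z.
    by rewrite -scaleN1r addrC rep_linear scaleN1r addrC.
  rewrite -repB; apply: cutoff0.
  apply: order_ge_le (leqnSn _) (order_ge_rep (b := N.+1) ha _) => n nN; rewrite shat_subE cutoffE.
  by rewrite -ltnS nN subrr.
move=> hf hg; apply: linEndP => m; rewrite leBE !leME !cut // rhoE rep_kk.
by rewrite linearB.
Qed.

Definition grp N f : End := nexp N.*2.+1 (rho N f).

(** The innermost letter has order 2 and each further bracket raises the order by one. *)
Lemma order_ge_nested d w : (forall f, f \in w -> order_ge 2 f) -> (d <= size w)%N ->
  order_ge d.+1 (nested kk w).
Proof.
elim: w d => [|f w IH] d hw dw; first by [].
case: w IH hw dw => [|g w] IH hw dw.
  apply: order_ge_le (hw f _); last by rewrite mem_head.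
  by case: d dw => [|[|d]].
rewrite nested_cons //; case: d dw => [|d] dw.
  by apply: order_ge_le (order_ge_kk mu_lie (a := 2) (b := 1) _ _) => //;
    [apply: hw; rewrite mem_head|case].
have := @order_ge_kk _ _ _ mu_lie 2 d.+1 f (nested kk (g :: w)); rewrite addSn add1n; apply.
  by apply: hw; rewrite mem_head.
by move=> l /andP[_ ld]; apply: (IH d) => // h hh; apply: hw; rewrite inE hh orbT.
Qed.

Lemma rho_nested N w : (forall f, f \in w -> order_ge 2 f) ->
  rho N (nested kk w) = nested (fun a b => a * b - b * a) [seq rho N f | f <- w].
Proof.
elim: w => [|f w IH] hw; first by rewrite linear0.
have hw' h : h \in w -> order_ge 2 h by move=> hh; apply: hw; rewrite inE hh orbT.
case: w IH hw hw' => [//|g w] IH hw hw'.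
rewrite nested_cons // rho_kk ?IH //; first by apply: hw; rewrite mem_head.
exact: (@order_ge_nested 1).
Qed.

Lemma cbh_term_dynkin (P : S -> S -> S) d f g : cbh_term P d f g = dynkin_term P d f g.
Proof.
have nestedE w : nested_bracket P w = nested P w by elim: w => //= h [|h' w] // ->.
rewrite /cbh_term /dynkin_term scaler_sumr; apply: eq_bigr => n _.
rewrite [RHS]scalerA [X in _ = X *: _]mulrC -[RHS]scalerA; congr (_ *: _).
rewrite /dynkin_part scaler_sumr.
apply: eq_big => [t|t _].
  by rewrite /pos_pairs /nat_pairs all_map /pairs_degree big_map.
rewrite scalerA natrM invfM /pairs_fact big_map nestedE; congr (_ *: nested P _).
by rewrite /dynkin_word /nat_pairs -map_comp.
Qed.

Lemma mem_dynkin_word (f g h : S) t : order_ge 2 f -> order_ge 2 g ->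
  h \in dynkin_word f g t -> order_ge 2 h.
Proof.
move=> hf hg /flattenP[u /mapP[rs _ ->]].
by rewrite mem_cat => /orP[] /nseqP[-> _].
Qed.

Lemma order_ge_dynkin d f g : order_ge 2 f -> order_ge 2 g ->
  order_ge d.+1 (dynkin_term kk d f g).
Proof.
move=> hf hg; apply: order_geZ; apply: order_ge_sum => n _; apply: order_geZ.
apply: order_ge_sum => t /andP[_ /eqP td]; apply: order_geZ.
apply: order_ge_nested => [h|]; first exact: mem_dynkin_word.
by rewrite size_dynkin_word td.
Qed.

Lemma rho_dynkin N d f g : order_ge 2 f -> order_ge 2 g ->
  rho N (dynkin_term kk d f g) =
  dynkin_term (fun a b => a * b - b * a) d (rho N f) (rho N g).
Proof.
move=> hf hg; rewrite /dynkin_term linearZ linear_sum; congr (_ *: _).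
apply: eq_bigr => n _; rewrite linearZ linear_sum; congr (_ *: _).
apply: eq_bigr => t _; rewrite linearZ /= rho_nested; last first.
  by move=> h; exact: mem_dynkin_word.
congr (_ *: nested _ _); rewrite /dynkin_word map_flatten -map_comp.
by congr flatten; apply: eq_map => rs /=; rewrite map_cat !map_nseq.
Qed.

Lemma agree_cbh N f g : order_ge 2 f -> order_ge 2 g ->
  agree N.+1 (cbh kk f g) (\sum_(1 <= d < N.+1) dynkin_term kk d f g).
Proof.
move=> hf hg k kN; rewrite [in RHS](big_cat_nat (n := k.+1)) // shat_addE.
rewrite [X in _ = _ + X](_ : _ = 0) ?addr0; last first.
  rewrite shat_sumE big_nat big1 // => d /andP[kd _].
  by rewrite (order_ge_dynkin hf hg) // ltnS ltnW.
rewrite -[LHS]/((\sum_(1 <= d < k.+1) cbh_term kk d f g) k).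
by congr (scomp _ k); apply: eq_bigr => d _; rewrite cbh_term_dynkin.
Qed.

Lemma order_ge_cbh f g : order_ge 2 f -> order_ge 2 g -> order_ge 2 (cbh kk f g).
Proof.
move=> hf hg k k2; rewrite (@agree_cbh 1 f g hf hg k k2) big_nat1.
by rewrite (order_ge_dynkin hf hg).
Qed.

(** The filtration by order, closed off at 0 beyond N to match the cutoff; it is the one to which
    the filtered Dynkin formula is applied, with m = N. *)
Definition rep_filtration N i (m : S) : Prop :=
  if (i <= N)%N then order_ge i m else m = 0.

Lemma rho_filtration N f i m : order_ge 2 f ->
  rep_filtration N i m -> rep_filtration N i.+1 (rho N f m).
Proof.
rewrite /rep_filtration => hf; have [iN hm|Ni ->] := leqP i N; last first.
  by rewrite linear0 ltnNge ltnW.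
have hi : order_ge i.+1 (rep f m) by exact: (order_ge_rep hf hm).
case: ifP => Ni; first exact: order_ge_cutoff.
by rewrite rhoE cutoff0 //; apply: order_ge_le hi; rewrite ltnS leqNgt Ni.
Qed.

Lemma grp_star N f g : order_ge 2 f -> order_ge 2 g ->
  grp N (cbh kk f g) = grp N f * grp N g.
Proof.
move=> hf hg; rewrite /grp (rho_agree (agree_cbh hf hg)) linear_sum.
under eq_bigr => d _ do rewrite /= rho_dynkin //.
apply: (dynkin_formula_filtered K0 (F := rep_filtration N)).
- by move=> i; rewrite /rep_filtration; case: ifP.
- move=> i a b; rewrite /rep_filtration; case: ifP => _; first exact: order_geD.
  by move=> -> ->; rewrite addr0.
- move=> i c a; rewrite /rep_filtration; case: ifP => _; first exact: order_geZ.
  by move=> ->; rewrite scaler0.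
- by move=> b; rewrite /rep_filtration.
- by move=> b; rewrite /rep_filtration ltnn.
- by move=> i b; exact: rho_filtration.
- by move=> i b; exact: rho_filtration.
Qed.

Lemma rhoM_top N u g : order_ge N u -> order_ge 2 g ->
  rho N u * rho N g = 0 /\ rho N g * rho N u = 0.
Proof.
move=> hu hg; split; apply: linEndP => m; rewrite leME !rhoE le0E; apply: cutoff0.
  apply: order_ge_le (order_ge_rep (b := 2) hu _); first by rewrite addn2.
  by apply: order_ge_cutoff; exact: order_ge_rep1.
by apply: (order_ge_rep (b := N) hg); apply: order_ge_cutoff; exact: order_ge_rep1.
Qed.

Lemma rho_grp N u g : order_ge N u -> order_ge 2 g ->
  rho N u * grp N g = rho N u /\ grp N g * rho N u = rho N u.
Proof.
move=> hu hg; have [e1 e2] := rhoM_top hu hg.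
rewrite /grp nexpE big_ord_recl expr0 invr1 scale1r.
split; rewrite ?mulrDr ?mulrDl ?mulr1 ?mul1r.
  rewrite mulr_sumr big1 ?addr0 // => i _; rewrite lift0 -scalerAr exprS mulrA e1 mul0r.
  by rewrite scaler0.
rewrite mulr_suml big1 ?addr0 // => i _; rewrite lift0 -scalerAl exprSr -mulrA e2 mulr0.
by rewrite scaler0.
Qed.

(** In the cut-off representation all products of [rho N u] with [rho N g] or with itself vanish, so
    only the linear term of the exponential sees u. *)
Lemma grp_add N u g : (1 < N)%N -> order_ge N u -> order_ge 2 g ->
  grp N (g + u) = grp N g + rho N u.
Proof.
move=> N1 hu hg; have [e1 e2] := rhoM_top hu hg.
have [e3 _] := rhoM_top hu (order_ge_le N1 hu).
have powE i : (rho N (g + u)) ^+ i = rho N g ^+ i + (i == 1%N)%:R *: rho N u.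
  rewrite linearD; elim: i => [|[|i] IH]; first by rewrite !expr0 scale0r addr0.
    by rewrite !expr1 scale1r.
  have gu : rho N g ^+ i.+1 * rho N u = 0 by rewrite exprSr -mulrA e2 mulr0.
  rewrite exprSr IH mulrDl !mulrDr gu -!scalerAl e1 e3 !scaler0 !addr0 -exprSr.
  by rewrite scale0r addr0.
rewrite /grp !nexpE; under eq_bigr => i _ do rewrite powE scalerDr.
rewrite big_split /=; congr (_ + _).
have h : (1 < N.*2.+2)%N by [].
rewrite (bigD1 (Ordinal h)) //= invr1 !scale1r big1 ?addr0 // => i /negPf i1.
by rewrite -val_eqE /= in i1; rewrite i1 scale0r scaler0.
Qed.

(** At 1 the bracket vanishes and the extra term leaves (N - 1) u_N; hence the exclusion of N = 1
    and the use of characteristic 0. *)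
Lemma rho_inj N u : (1 < N)%N -> order_ge N u -> rho N u = 0 -> u N = 0.
Proof.
move=> N1 hu r0; have : rho N u 1 N = 0 by rewrite r0.
rewrite rhoE cutoffE leqnn /rep (_ : kk u 1 = 0); last first.
  have := kk_leibniz mu_lie u 1 1; rewrite !mulr1 mul1r => /esym/eqP.
  by rewrite -subr_eq0 addrK => /eqP.
rewrite add0r mulr1 degree1E => /eqP; rewrite scaler_eq0.
rewrite -(subnK N1) -[2%N]/(1 + 1)%N addnA natrD addrK addn1.
by rewrite (negPf (natS_neq0 K0 _)) => /eqP.
Qed.

(** By induction f and g agree below degree N. Their difference then enters additively at cutoff N,
    and [rho_inj] reads off its component of degree N. *)
Lemma grp_agree N f g : order_ge 2 f -> order_ge 2 g ->
  (forall M, (M <= N)%N -> grp M f = grp M g) -> agree N.+1 f g.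
Proof.
move=> hf hg; elim: N => [|N IH] h; first by move=> k k1; rewrite hf ?hg // (leq_trans k1).
have a1 : agree N.+1 f g by apply: IH => M MN; apply: h; exact: leqW.
case: N IH h a1 => [|N] IH h a1; first by move=> k k1; rewrite hf ?hg.
move=> k; rewrite ltnS leq_eqVlt => /orP[/eqP->|]; last exact: a1.
have hu : order_ge N.+2 (f - g) by apply/order_ge_sub.
apply/eqP; rewrite -subr_eq0 -shat_subE; apply/eqP; apply: rho_inj => //.
have := @grp_add N.+2 _ _ isT hu hg; rewrite addrC subrK h // => /eqP.
by rewrite addrC -subr_eq subrr eq_sym => /eqP.
Qed.

Lemma grp_inj f g : order_ge 2 f -> order_ge 2 g ->
  (forall N, grp N f = grp N g) -> f = g.
Proof. by move=> hf hg h; apply: agree_eq => n; apply: agree_le (leqnSn n) _; exact: grp_agree. Qed.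

Lemma grp0 N : grp N 0 = 1. Proof. by rewrite /grp linear0 nexp0. Qed.

Lemma grpN N f : order_ge 2 f -> grp N (- f) * grp N f = 1.
Proof.
move=> hf; rewrite /grp linearN; apply: (nexp_opp K0); apply: linEndP => m.
have fil i : rep_filtration N i ((rho N f ^+ i) m).
  elim: i => [|i IH]; first by rewrite expr0 /rep_filtration.
  by rewrite exprS leME; exact: rho_filtration.
have := fil N.*2.+2; rewrite /rep_filtration leqNgt ltnS -addnn.
by rewrite (leq_trans (leq_addr N N)) //; exact: leqnSn.
Qed.

Lemma grp_commute N f g : order_ge 2 f -> order_ge 2 g -> kk f g = 0 ->
  grp N f * grp N g = grp N g * grp N f.
Proof.
move=> hf hg fg0; have := rho_kk N hf hg; rewrite fg0 linear0 => /esym/eqP.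
rewrite subr_eq0 => /eqP c; rewrite /grp !nexpE.
have cX i j : rho N f ^+ i * rho N g ^+ j = rho N g ^+ j * rho N f ^+ i.
  by apply: commrX; apply: commr_sym; apply: commrX; exact: esym.
rewrite mulr_suml mulr_sumr; apply: eq_bigr => i _; rewrite mulr_suml mulr_sumr.
by apply: eq_bigr => j _; rewrite -!scalerAl -!scalerAr cX !scalerA mulrC.
Qed.

End StarGroup.

(** * Functoriality of the bracket and of the group law, direct sums and invariants *)

Section ShatMap.
Variables (K : fieldType) (V W : lmodType K) (A : {linear V -> W}).

Definition shat_map (f : Shat V) : Shat W :=
  MkShat (fun n => homog_sym_map A (scomp_homog f n)).

Lemma shat_mapE f n : shat_map f n = sym_map A (f n). Proof. by []. Qed.

Fact shat_map_is_linear : linear shat_map.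
Proof. by move=> c f g; apply: shatP => n; rewrite shat_mapE linearP. Qed.
HB.instance Definition _ := GRing.isLinear.Build _ _ _ _ shat_map shat_map_is_linear.

Lemma shat_map_mul f g : shat_map (f * g) = shat_map f * shat_map g.
Proof.
apply: shatP => n; rewrite shat_mapE !shat_mul_comp linear_sum.
by apply: eq_bigr => i _; rewrite rmorphM.
Qed.

Lemma shat_map1 : shat_map 1 = 1.
Proof.
apply: shatP => -[|n]; rewrite shat_mapE /=; first exact: rmorph1.
exact: linear0.
Qed.

Lemma shat_map_var v : shat_map (shat_var v) = shat_var (A v).
Proof.
apply: shatP => n; rewrite shat_mapE /=; case: eqP => _; last exact: linear0.
exact: sym_map_var.
Qed.

Lemma shat_map_agree n f g : agree n f g -> agree n (shat_map f) (shat_map g).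
Proof. by move=> h k kn; rewrite !shat_mapE h. Qed.

Lemma shat_map_order n f : order_ge n f -> order_ge n (shat_map f).
Proof. by move=> h k kn; rewrite shat_mapE h // linear0. Qed.

Lemma shat_lift_var u : (forall v, u v = shat_var (A v)) -> shat_lift u =1 shat_map.
Proof.
move=> uA f; apply: shatP => n; rewrite shat_mapE /shat_lift /= shat_sumE.
have -> : u = fun v => shat_var (A v) by apply/funext.
have lift_map x : sym_lift (fun v => shat_var (A v)) x = shat_of (sym_map A x).
  have lin : linear (fun v => shat_var (A v)) by move=> c a b; rewrite !linearP.
  elim/sym_ind: x => [v|c|x y hx hy|x y hx hy].
  - by rewrite (sym_lift_var lin) sym_map_var [RHS]sym_ext_var.
  - by rewrite (sym_lift_cst lin) !linearZ /= !rmorph1.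
  - by rewrite (sym_liftD lin) hx hy !linearD.
  - by rewrite (sym_liftM lin) hx hy !rmorphM.
rewrite (bigD1 ord_max) //= lift_map (shat_of_homog _ (homog_sym_map A (scomp_homog f n))).
rewrite eqxx big1 ?addr0 // => k /negPf kn.
rewrite lift_map (shat_of_homog _ (homog_sym_map A (scomp_homog f k))).
by rewrite eq_sym -[n]/(val (@ord_max n)) (inj_eq val_inj) kn.
Qed.

End ShatMap.

Lemma eq_shat_map (K : fieldType) (V W : lmodType K) (A B : {linear V -> W}) :
  A =1 B -> shat_map A =1 shat_map B.
Proof. by move=> AB f; apply: shatP => n; rewrite !shat_mapE (eq_sym_map AB). Qed.

Lemma shat_map_comp (K : fieldType) (U V W : lmodType K) (A : {linear V -> W})
  (B : {linear U -> V}) f : shat_map A (shat_map B f) = shat_map (A \o B) f.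
Proof. by apply: shatP => n; rewrite !shat_mapE sym_map_comp. Qed.

Section Naturality.
Variables (K : fieldType) (V W : lmodType K) (mu : V -> V -> V) (nu : W -> W -> W).
Hypothesis mu_lie : lie_bracket mu.
Hypothesis nu_lie : lie_bracket nu.
Variable A : {linear V -> W}.
Hypothesis A_lie : forall v w, A (mu v w) = nu (A v) (A w).

Lemma sym_map_poisson x y :
  sym_map A (sym_poisson mu x y) = sym_poisson nu (sym_map A x) (sym_map A y).
Proof.
elim/sym_ind: y => [w|c|a b ha hb|a b ha hb].
- elim/sym_ind: x => [v|c|a b ha hb|a b ha hb].
  + by rewrite (sym_poisson_var mu_lie) !sym_map_var (sym_poisson_var nu_lie) A_lie.
  + rewrite (sym_poisson_cstl mu_lie) !linear0 linearZ /= rmorph1.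
    by rewrite (sym_poisson_cstl nu_lie).
  + by rewrite (sym_poissonDl mu_lie) !linearD (sym_poissonDl nu_lie) /= ha hb.
  + rewrite (sym_poissonMl mu_lie) linearD !rmorphM (sym_poissonMl nu_lie) /= ha hb.
    by [].
- rewrite (sym_poisson_cstr mu_lie) !linear0 linearZ /= rmorph1.
  by rewrite (sym_poisson_cstr nu_lie).
- by rewrite (sym_poissonDr mu_lie) !linearD (sym_poissonDr nu_lie) /= ha hb.
- rewrite (sym_poissonMr mu_lie) linearD !rmorphM (sym_poissonMr nu_lie) /= ha hb.
  by [].
Qed.

Local Notation kk := (kostant_kirillov mu).
Local Notation kk' := (kostant_kirillov nu).

Lemma shat_map_kk f g : shat_map A (kk f g) = kk' (shat_map A f) (shat_map A g).
Proof.
apply: shatP => n; rewrite shat_mapE (kkE mu_lie) (kkE nu_lie) linear_sum.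
apply: eq_bigr => k _; rewrite linear_sum; apply: eq_bigr => l _.
by case: ifP => _; [exact: sym_map_poisson|exact: linear0].
Qed.

Lemma shat_map_dynkin d f g : shat_map A (dynkin_term kk d f g) =
  dynkin_term kk' d (shat_map A f) (shat_map A g).
Proof.
rewrite /dynkin_term linearZ linear_sum; congr (_ *: _).
apply: eq_bigr => n _; rewrite linearZ linear_sum; congr (_ *: _).
apply: eq_bigr => t _; rewrite linearZ /=; congr (_ *: _).
have nestedE w : shat_map A (nested kk w) = nested kk' [seq shat_map A x | x <- w].
  elim: w => [|x [|y w] IH]; [exact: linear0|by []|].
  by rewrite nested_cons // shat_map_kk IH.
rewrite nestedE /dynkin_word map_flatten -map_comp; congr (nested _ (flatten _)).
by apply: eq_map => rs /=; rewrite map_cat !map_nseq.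
Qed.

Lemma shat_map_cbh f g : shat_map A (cbh kk f g) = cbh kk' (shat_map A f) (shat_map A g).
Proof.
apply: shatP => n; rewrite shat_mapE.
have cbhE (U : lmodType K) (P : Shat U -> Shat U -> Shat U) a b :
    cbh P a b n = (\sum_(1 <= d < n.+1) dynkin_term P d a b) n.
  rewrite -[LHS]/((\sum_(1 <= d < n.+1) cbh_term P d a b) n).
  by congr (scomp _ n); apply: eq_bigr => d _; rewrite cbh_term_dynkin.
rewrite !cbhE -shat_mapE linear_sum; congr (scomp _ n).
by apply: eq_bigr => d _; rewrite /= shat_map_dynkin.
Qed.

End Naturality.

Section DirectSum.
Variables (K : fieldType) (V : lmodType K) (mu : V -> V -> V).
Hypothesis mu_lie : lie_bracket mu.

Definition lie_sum k (v w : dsum V k) : dsum V k := [ffun i => mu (v i) (w i)].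

Lemma lie_sum_lie k : lie_bracket (@lie_sum k).
Proof.
split.
- move=> v c a b; apply/ffunP => i; rewrite !ffunE; exact: (lie_linearl mu_lie).
- move=> v c a b; apply/ffunP => i; rewrite !ffunE; exact: (lie_linearr mu_lie).
- by move=> u; apply/ffunP => i; rewrite !ffunE lie_alt.
- by move=> u v w; apply/ffunP => i; rewrite !ffunE lie_jacobi.
Qed.

Definition lie_ad (_ : lie_bracket mu) (x v : V) : V := mu x v.
Fact lie_ad_is_linear h x : linear (lie_ad h x).
Proof. exact: (lie_linearr mu_lie). Qed.
HB.instance Definition _ h x :=
  GRing.isLinear.Build _ _ _ _ (lie_ad h x) (lie_ad_is_linear h x).

Lemma mu0l v : mu 0 v = 0.
Proof.
have := lie_linearl mu_lie v 1 0 0; rewrite scaler0 addr0 scale1r => /eqP.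
by rewrite -subr_eq0 opprD addrA subrr add0r oppr_eq0 => /eqP.
Qed.

Lemma lie_sum_blk m n s (v w : dsum V m) :
  blk n s (lie_sum v w) = lie_sum (blk n s v) (blk n s w).
Proof.
apply/ffunP => j; rewrite !ffunE; case: (nth _ _ _) => [|l].
  by rewrite !slot0 mu0l.
have [lm|ml] := ltnP l m; last by rewrite !slot_ge // mu0l.
by rewrite -[l]/(val (Ordinal lm)) !slot_ord ffunE.
Qed.

Definition invariant k (x : symAlg (dsum V k)) : Prop :=
  forall z, tder idfun (slotwise (lie_ad mu_lie z)) x = 0.

Definition shat_inv k (f : Shat (dsum V k)) : Prop := forall n, invariant (f n).

Lemma sym_invariantE k (x : symAlg (dsum V k)) : sym_invariant mu x <-> invariant x.
Proof.
by split=> h z; have := h z; rewrite /sym_ad /tder sym_map_idfun.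
Qed.

(** Invariance becomes commutation with the primitive elements; stability of invariants under the
    bracket is then the Jacobi identity. *)
Lemma poisson_diag k z (x : symAlg (dsum V k)) :
  sym_poisson (@lie_sum k) (sym_var [ffun=> z]) x =
  tder idfun (slotwise (lie_ad mu_lie z)) x.
Proof.
have Lk := lie_sum_lie k.
elim/sym_ind: x => [w|c|a b ha hb|a b ha hb].
- rewrite (sym_poisson_var Lk) tder_var; congr sym_var.
  by apply/ffunP => i; rewrite !ffunE.
- by rewrite (sym_poisson_cstr Lk) tder_cst.
- by rewrite (sym_poissonDr Lk) linearD ha hb.
- by rewrite (sym_poissonMr Lk) tderM ha hb sym_map_idfun.
Qed.

Lemma invariant_poisson k (x y : symAlg (dsum V k)) :
  invariant x -> invariant y -> invariant (sym_poisson (@lie_sum k) x y).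
Proof.
have Lk := lie_sum_lie k; move=> hx hy z; rewrite -poisson_diag.
have := sym_poisson_jacobi Lk (sym_var [ffun=> z]) x y.
rewrite [sym_poisson _ y (sym_var _)](sym_poisson_anti Lk) !poisson_diag hx hy.
by rewrite oppr0 !(sym_poisson0r Lk) !addr0.
Qed.

Lemma invariant_lin k c (x y : symAlg (dsum V k)) :
  invariant x -> invariant y -> invariant (c *: x + y).
Proof. by move=> hx hy z; rewrite linearP /= hx hy scaler0 addr0. Qed.

Lemma invariant0 k : invariant (0 : symAlg (dsum V k)).
Proof. by move=> z; rewrite linear0. Qed.

Lemma invariant_blk m n s (x : symAlg (dsum V m)) :
  invariant x -> invariant (sym_map (blk n s) x).
Proof.
move=> hx z; rewrite tder_sym_map.
rewrite (@eq_tder _ _ _ _ _ (blk n s \o idfun) (blk n s \o slotwise (lie_ad mu_lie z))) //.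
  by rewrite -sym_map_tder hx linear0.
by move=> v /=; rewrite slotwise_blk.
Qed.

Lemma shat_inv0 k : shat_inv (0 : Shat (dsum V k)).
Proof. by move=> n; exact: invariant0. Qed.

Lemma shat_invD k (f g : Shat (dsum V k)) : shat_inv f -> shat_inv g -> shat_inv (f + g).
Proof. by move=> hf hg n; rewrite shat_addE -[f n]scale1r; exact: invariant_lin. Qed.

Lemma shat_invZ k c (f : Shat (dsum V k)) : shat_inv f -> shat_inv (c *: f).
Proof.
move=> hf n; rewrite shat_scaleE -[_ *: _]addr0; apply: invariant_lin => //.
exact: invariant0.
Qed.

Lemma shat_invN k (f : Shat (dsum V k)) : shat_inv f -> shat_inv (- f).
Proof. by rewrite -scaleN1r; exact: shat_invZ. Qed.

Lemma shat_inv_sum k I (r : seq I) (P : pred I) (F : I -> Shat (dsum V k)) :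
  (forall i, P i -> shat_inv (F i)) -> shat_inv (\sum_(i <- r | P i) F i).
Proof.
by move=> h; apply: (big_ind (@shat_inv k)) => //; [exact: shat_inv0|exact: shat_invD].
Qed.

Lemma shat_inv_map m n s (f : Shat (dsum V m)) :
  shat_inv f -> shat_inv (shat_map (blk n s) f).
Proof. by move=> hf k; rewrite shat_mapE; exact: invariant_blk. Qed.

Local Notation kk k := (kostant_kirillov (@lie_sum k)).

Lemma shat_inv_kk k (f g : Shat (dsum V k)) :
  shat_inv f -> shat_inv g -> shat_inv (kk k f g).
Proof.
move=> hf hg n; rewrite (kkE (lie_sum_lie k)).
apply: (big_ind (@invariant k)) => [|x y hx hy|i _]; first exact: invariant0.
  by rewrite -[x]scale1r; exact: invariant_lin.
apply: (big_ind (@invariant k)) => [|x y hx hy|j _]; first exact: invariant0.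
  by rewrite -[x]scale1r; exact: invariant_lin.
by case: ifP => _; [exact: invariant_poisson|exact: invariant0].
Qed.

Lemma shat_inv_nested k (w : seq (Shat (dsum V k))) :
  (forall f, f \in w -> shat_inv f) -> shat_inv (nested (kk k) w).
Proof.
elim: w => [|f w IH] hw; first exact: shat_inv0.
have hf : shat_inv f by apply: hw; rewrite mem_head.
case: w IH hw => [//|g w] IH hw; rewrite nested_cons //; apply: shat_inv_kk => //.
by apply: IH => h hh; apply: hw; rewrite inE hh orbT.
Qed.

Lemma shat_inv_cbh k (f g : Shat (dsum V k)) :
  shat_inv f -> shat_inv g -> shat_inv (cbh (kk k) f g).
Proof.
move=> hf hg n; suff: shat_inv (\sum_(1 <= d < n.+1) cbh_term (kk k) d f g) by apply.
apply: shat_inv_sum => d _; rewrite cbh_term_dynkin.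
apply: shat_invZ; apply: shat_inv_sum => i _; apply: shat_invZ.
apply: shat_inv_sum => t _; apply: shat_invZ; apply: shat_inv_nested => h.
by case/flattenP => u /mapP[rs _ ->]; rewrite mem_cat => /orP[] /nseqP[-> _].
Qed.

(* An invariant element commutes with an element in which all the slots that  *)
(* it meets are filled by the same coproduct.                                 *)
Lemma kk_invariant m m' n s t l (f : Shat (dsum V m)) (g : Shat (dsum V m')) :
  shat_inv f -> (forall j, (j < n)%N -> nth 0%N t j = 0%N \/ nth 0%N s j = l) ->
  kk n (shat_map (blk n t) f) (shat_map (blk n s) g) = 0.
Proof.
move=> hf hst; have Ln := lie_sum_lie n.
have key x y : invariant x ->
    sym_poisson (@lie_sum n) (sym_map (@blk K V m n t) x) (sym_map (@blk K V m' n s) y) = 0.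
  move=> hx; elim/sym_ind: y => [w|c|a b ha hb|a b ha hb].
  (* In every slot met by the image of x, the image of the generator w carries the same vector
     [slot w l]. The bracket is therefore minus the diagonal action of that vector on x. *)
  - have -> : sym_poisson (@lie_sum n) (sym_map (blk n t) x) (sym_map (blk n s) (sym_var w))
        = - sym_map (blk n t) (tder idfun (slotwise (lie_ad mu_lie (slot w l))) x).
      rewrite sym_map_var; elim/sym_ind: {hx}x => [v|c|a b ha hb|a b ha hb].
      + rewrite tder_var !sym_map_var (sym_poisson_var Ln) -linearN; congr sym_var.
        apply/ffunP => j; rewrite !ffunE.
        have [->|->] := hst j (ltn_ord j); first by rewrite !slot0 mu0l oppr0.
        rewrite (lie_anti mu_lie); congr (- _).
        rewrite /slot -[mu _ _]/(lie_ad mu_lie (slot w l) _) linear_sum.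
        by apply: eq_bigr => i _; rewrite linearZ ffunE.
      + by rewrite tder_cst !linear0 linearZ /= rmorph1 (sym_poisson_cstl Ln) ?oppr0.
      + by rewrite !linearD /= (sym_poissonDl Ln) ha hb.
      + rewrite tderM linearD !rmorphM /= (sym_poissonMl Ln) ha hb sym_map_idfun.
        by rewrite mulNr mulrN opprD.
    by rewrite hx linear0 oppr0.
  - by rewrite linearZ /= rmorph1 (sym_poisson_cstr Ln).
  - by rewrite linearD (sym_poissonDr Ln) ha hb addr0.
  - by rewrite rmorphM (sym_poissonMr Ln) ha hb mul0r mulr0 addr0.
apply: shatP => k; rewrite (kkE Ln) big1 // => i _; rewrite big1 // => j _.
by rewrite !shat_mapE key ?if_same.
Qed.

End DirectSum.

(** * Pentagons and twists *)

(* The nine two-dimensional faces of the associahedron K_5: six pentagons,    *)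
(* each commuting up to r_i, and three squares; going around its boundary.    *)
Lemma pentagons_sum (R : nzRingType) (a b c d e f g h i j k l o p q : R)
    (r0 r1 r2 r3 r4 r5 : R) :
  j * k * l = d * g + r0 -> j * q * p = b * c + r1 -> g * h * i = e * c + r2 ->
  k * h * o = a * q + r3 -> d * e * f = a * b + r4 -> l * i * f = o * p + r5 ->
  f * c = c * f -> l * h = h * l -> j * a = a * j ->
  r4 * c = r4 -> d * (r2 * f) = r2 -> r0 * (h * i * f) = r0 ->
  j * k * h * r5 = r5 -> j * r3 * p = r3 -> a * r1 = r1 ->
  r0 - r1 + r2 - r3 + r4 - r5 = 0.
Proof.
move=> P0 P1 P2 P3 P4 P5 fc lh ja e4 e2 e0 e5 e3 e1.
(* Starting from the path a b c, the pentagons 4, 2, 0, 5, 3, 1 are crossed in this order, with the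
   squares used in between, until the same path is reached again; each crossing leaves its
   defect. *)
have s4 : a * b * c = d * (e * c) * f - r4.
  by rewrite -[a * b](addrK r4) -P4 mulrBl e4 -!mulrA fc.
have s2 : d * (e * c) * f = d * g * (h * i * f) - r2.
  by rewrite -[e * c](addrK r2) -P2 mulrBr mulrBl -[d * r2 * f]mulrA e2 !mulrA.
have s0 : d * g * (h * i * f) = j * k * h * (l * i * f) - r0.
  by rewrite -[d * g](addrK r0) -P0 mulrBl e0 !mulrA -[j * k * l * h]mulrA lh !mulrA.
have s5 : j * k * h * (l * i * f) = j * (k * h * o) * p + r5.
  by rewrite P5 mulrDr e5 !mulrA.
have s3 : j * (k * h * o) * p = a * (j * q * p) + r3.
  by rewrite P3 mulrDr mulrDl e3 !mulrA ja.
have s1 : a * (j * q * p) = a * b * c + r1 by rewrite P1 mulrDr e1 mulrA.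
have h0 : a * b * c = a * b * c + r1 + r3 + r5 - r0 - r2 - r4.
  by rewrite {1}s4 s2 s0 s5 s3 s1.
transitivity (a * b * c - (a * b * c + r1 + r3 + r5 - r0 - r2 - r4)).
  rewrite !opprD !opprK !addrA subrr add0r.
  by rewrite [RHS](ACl (4*1*5*2*6*3)).
by rewrite -h0 subrr.
Qed.

(** [e s] stands for the associator and [r s] for the defect of the pentagon under the substitution
    s. The six faces of the four-slot pentagon in five slots are the pentagons of the associahedron,
    and the associators on disjoint or nested blocks give its squares. *)
Lemma pentagon_labels (R : nzRingType) (e r : seq nat -> R) :
  (forall s, e (label_comp s [:: 0; 1; 2; 3]%N) * e (label_comp s [:: 1; 2; 2; 3]%N)
    * e (label_comp s [:: 1; 2; 3; 0]%N) =
    e (label_comp s [:: 1; 2; 3; 3]%N) * e (label_comp s [:: 1; 1; 2; 3]%N) + r s) ->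
  (forall s t l, (forall j, (j < 5)%N -> nth 0%N s j = 0%N \/ nth 0%N t j = l) ->
    e s * e t = e t * e s) ->
  (forall s t, r s * e t = r s) -> (forall s t, e t * r s = r s) ->
  r (face 4 4 0) - r (face 4 4 1) + r (face 4 4 2) - r (face 4 4 3)
    + r (face 4 4 4) - r (face 4 4 5) = 0.
Proof.
move=> pent comm absl absr.
apply: (@pentagons_sum _ (e [:: 1; 2; 3; 3; 3]%N) (e [:: 1; 1; 2; 3; 3]%N)
  (e [:: 1; 1; 1; 2; 3]%N) (e [:: 0; 1; 2; 3; 3]%N) (e [:: 1; 2; 2; 3; 3]%N)
  (e [:: 1; 2; 3; 0; 0]%N) (e [:: 0; 1; 1; 2; 3]%N) (e [:: 1; 2; 2; 2; 3]%N)
  (e [:: 1; 2; 2; 3; 0]%N) (e [:: 0; 0; 1; 2; 3]%N) (e [:: 0; 1; 2; 2; 3]%N)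
  (e [:: 0; 1; 2; 3; 0]%N) (e [:: 1; 2; 3; 3; 0]%N) (e [:: 1; 1; 2; 3; 0]%N)
  (e [:: 1; 1; 2; 2; 3]%N)); rewrite ?absl ?absr ?absl //.
- exact: (pent (face 4 4 0)).
- exact: (pent (face 4 4 1)).
- exact: (pent (face 4 4 2)).
- exact: (pent (face 4 4 3)).
- exact: (pent (face 4 4 4)).
- exact: (pent (face 4 4 5)).
- by apply: (comm _ _ 1%N) => -[|[|[|[|[|j]]]]] // _; [right|right|right|left|left].
- by apply: (comm _ _ 2%N) => -[|[|[|[|[|j]]]]] // _; [left|right|right|right|left].
- by apply: (comm _ _ 3%N) => -[|[|[|[|[|j]]]]] // _; [left|left|right|right|right].
- by rewrite !mulrA !absl.
- by rewrite -!mulrA !absr.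
Qed.

Section StarTheory.
Variables (K : fieldType) (V : lmodType K) (mu : V -> V -> V).
Hypothesis K0 : [pchar K] =i pred0.
Hypothesis mu_lie : lie_bracket mu.

Local Notation kk k := (kostant_kirillov (@lie_sum K V mu k)).
Local Notation star k := (cbh (kk k)).
Local Notation G k := (grp (lie_sum_lie mu_lie k)).
Local Notation rh k := (rho (lie_sum_lie mu_lie k)).
Local Notation sm n s := (shat_map (blk n s)).

Lemma sm_star m n s (f g : Shat (dsum V m)) :
  sm n s (star m f g) = star n (sm n s f) (sm n s g).
Proof.
apply: shat_map_cbh; [exact: lie_sum_lie|exact: lie_sum_lie|].
by move=> v w; exact: (lie_sum_blk mu_lie).
Qed.

Lemma sm_comp m n k s t (f : Shat (dsum V m)) : size t = n ->
  sm k s (sm n t f) = sm k (label_comp s t) f.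
Proof. by move=> tn; rewrite shat_map_comp; apply: eq_shat_map => v /=; rewrite blk_comp. Qed.

Lemma star_agree k N (f f' g g' : Shat (dsum V k)) :
  order_ge 2 f -> order_ge 2 f' -> order_ge 2 g -> order_ge 2 g' ->
  agree N f f' -> agree N g g' -> agree N (star k f g) (star k f' g').
Proof.
move=> hf hf' hg hg'; case: N => [//|N] af ag.
pose Lk := lie_sum_lie mu_lie k.
apply: (grp_agree K0 (mu_lie := Lk)); [exact: order_ge_cbh|exact: order_ge_cbh|].
move=> M MN; rewrite !(grp_star K0) // /grp.
by rewrite (rho_agree Lk (agree_le (MN : (M.+1 <= N.+1)%N) af))
  (rho_agree Lk (agree_le (MN : (M.+1 <= N.+1)%N) ag)).
Qed.

Lemma grp_order k M N (f g : Shat (dsum V k)) : (M < N)%N -> agree N f g ->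
  G k M f = G k M g.
Proof.
by move=> MN h; rewrite /grp (rho_agree (lie_sum_lie mu_lie k) (agree_le MN h)).
Qed.

Definition cob k (u : Shat (dsum V k)) : Shat (dsum V k.+1) :=
  \sum_(p <- cobound k k) p.1%:~R *: sm k.+1 p.2 u.

Lemma cobE k (u : Shat (dsum V k)) n : cob u n = smap_op k.+1 (cobound k k) (u n).
Proof. by rewrite /cob shat_sumE. Qed.

Lemma cob_order k (u : Shat (dsum V k)) n : order_ge n u -> order_ge n (cob u).
Proof.
move=> hu; apply: order_ge_sum => p _; apply: order_geZ; exact: shat_map_order.
Qed.

Lemma rho_cob k N (u : Shat (dsum V k)) : rh k.+1 N (cob u) =
  \sum_(m <- iota 0 k.+2) (alt_sign m)%:~R *: rh k.+1 N (sm k.+1 (face k k m) u).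
Proof.
rewrite /cob linear_sum /cobound big_map; apply: eq_bigr => m _.
by rewrite linearZ.
Qed.

(** A label list spells the usual superscripts: [[:: 1; 2; 3; 3]] is 1,2,34, [[:: 1; 1; 2; 3]] is
    12,3,4 and [[:: 0; 1; 2; 3]] is 2,3,4. *)
Definition pent_l (phi : Shat (dsum V 3)) : Shat (dsum V 4) :=
  star 4 (sm 4 [:: 1; 2; 3; 3]%N phi) (sm 4 [:: 1; 1; 2; 3]%N phi).
Definition pent_r (phi : Shat (dsum V 3)) : Shat (dsum V 4) :=
  star 4 (star 4 (sm 4 [:: 0; 1; 2; 3]%N phi) (sm 4 [:: 1; 2; 2; 3]%N phi))
         (sm 4 [:: 1; 2; 3; 0]%N phi).

Section Pentagon.
Variable phi : Shat (dsum V 3).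
Hypothesis phi2 : order_ge 2 phi.
Hypothesis phi_inv : shat_inv mu_lie phi.

Lemma order_ge_pent_l : order_ge 2 (pent_l phi).
Proof. by apply: (order_ge_cbh (lie_sum_lie mu_lie 4)); exact: shat_map_order. Qed.

Lemma order_ge_pent_r : order_ge 2 (pent_r phi).
Proof.
pose L4 := lie_sum_lie mu_lie 4.
by do 2?apply: (order_ge_cbh L4); exact: shat_map_order.
Qed.

Lemma shat_inv_pent_l : shat_inv mu_lie (pent_l phi).
Proof. by apply: shat_inv_cbh; exact: shat_inv_map. Qed.
Lemma shat_inv_pent_r : shat_inv mu_lie (pent_r phi).
Proof. by do 2?apply: shat_inv_cbh; exact: shat_inv_map. Qed.

(** At cutoff N the defect has top order and is absorbed by every group element, and invariance of
    [phi] provides the squares. The associahedron relation then holds in the representation, and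
    [rho_inj] brings it back to degree N. *)
Lemma pentagon_cocycle N : (1 < N)%N -> agree N (pent_l phi) (pent_r phi) ->
  smap_op 5 (cobound 4 4) ((pent_r phi - pent_l phi) N) = 0.
Proof.
move=> N1 aN; set u := pent_r phi - pent_l phi.
pose L5 := lie_sum_lie mu_lie 5.
have hu : order_ge N u by apply/order_ge_sub/agree_sym.
pose e s := G 5 N (sm 5 s phi).
pose r s := rh 5 N (sm 5 s u).
have sp s : order_ge 2 (sm 5 s phi) by exact: shat_map_order.
have su s : order_ge N (sm 5 s u) by exact: shat_map_order.
have pent s : e (label_comp s [:: 0; 1; 2; 3]%N) * e (label_comp s [:: 1; 2; 2; 3]%N)
    * e (label_comp s [:: 1; 2; 3; 0]%N) =
    e (label_comp s [:: 1; 2; 3; 3]%N) * e (label_comp s [:: 1; 1; 2; 3]%N)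
    + r s.
  have -> : e (label_comp s [:: 0; 1; 2; 3]%N) * e (label_comp s [:: 1; 2; 2; 3]%N)
      * e (label_comp s [:: 1; 2; 3; 0]%N) = G 5 N (sm 5 s (pent_r phi)).
    rewrite /pent_r !sm_star !sm_comp // !(grp_star K0) //.
    exact: (order_ge_cbh L5).
  have -> : e (label_comp s [:: 1; 2; 3; 3]%N) * e (label_comp s [:: 1; 1; 2; 3]%N)
      = G 5 N (sm 5 s (pent_l phi)).
    by rewrite /pent_l !sm_star !sm_comp // !(grp_star K0).
  (* The right side of the pentagon is the left side plus a term of order N, which enters
     additively. *)
  rewrite -(grp_add L5 N1 (su s) (shat_map_order (blk 5 s) order_ge_pent_l)).
  by rewrite -linearD addrC subrK.
have comm s t l : (forall j, (j < 5)%N -> nth 0%N s j = 0%N \/ nth 0%N t j = l) ->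
    e s * e t = e t * e s.
  move=> h; apply: grp_commute => //.
  exact: (kk_invariant (l := l) _ phi_inv h).
have absl s t : r s * e t = r s by apply: (rho_grp L5 _ _).1.
have absr s t : e t * r s = r s by apply: (rho_grp L5 _ _).2.
have h := pentagon_labels pent comm absl absr.
rewrite -cobE; apply: (rho_inj K0 (mu_lie := L5) N1); first exact: cob_order.
rewrite rho_cob -[RHS]h /r; move: (face 4 4) => F.
by rewrite !big_cons big_nil /= !scale1r !scaleN1r addr0 !addrA.
Qed.

End Pentagon.
End StarTheory.

Lemma perturbed_mul (R : nzRingType) (x y a b : R) :
  a * y = a -> x * b = b -> a * b = 0 -> (x + a) * (y + b) = x * y + (a + b).
Proof.
by move=> ay xb ab; rewrite mulrDl !mulrDr ay xb ab addr0 -addrA [b + a]addrC.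
Qed.

(* g 0 s and g 1 s stand for the image of the twist under s and its inverse,  *)
(* and g 2 s for that of the associator.                                      *)
Lemma twist_labels (R : nzRingType) (g : nat -> seq nat -> R) :
  (forall s, g 1%N s * g 0%N s = 1) ->
  (forall a b s t l, (forall j, (j < 4)%N -> nth 0%N s j = 0%N \/ nth 0%N t j = l) ->
    g a s * g b t = g b t * g a s) ->
  g 2 [:: 1; 2; 3; 3]%N * g 2 [:: 1; 1; 2; 3]%N =
    g 2 [:: 0; 1; 2; 3]%N * g 2 [:: 1; 2; 2; 3]%N * g 2 [:: 1; 2; 3; 0]%N ->
  let tw s := g 0%N (label_comp s [:: 0; 1; 2]%N) * g 0%N (label_comp s [:: 1; 2; 2]%N)
    * g 2 s * g 1%N (label_comp s [:: 1; 1; 2]%N) * g 1%N (label_comp s [:: 1; 2; 0]%N) in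
  tw [:: 1; 2; 3; 3]%N * tw [:: 1; 1; 2; 3]%N =
    tw [:: 0; 1; 2; 3]%N * tw [:: 1; 2; 2; 3]%N * tw [:: 1; 2; 3; 0]%N.
Proof.
move=> inv comm pent tw; rewrite /tw /label_comp /= {tw}.
have c12 a b t : nth 0%N t 0 = nth 0%N t 1 ->
    g a [:: 1; 2; 0; 0]%N * g b t = g b t * g a [:: 1; 2; 0; 0]%N.
  move=> t01; apply: (comm _ _ _ _ (nth 0%N t 0)).
  by case=> [|[|[|[|j]]]] // _; [right|right|left|left].
have c23 a b t : nth 0%N t 1 = nth 0%N t 2 ->
    g a [:: 0; 1; 2; 0]%N * g b t = g b t * g a [:: 0; 1; 2; 0]%N.
  move=> t12; apply: (comm _ _ _ _ (nth 0%N t 1)).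
  by case=> [|[|[|[|j]]]] // _; [left|right|right|left].
have c34 a b t : nth 0%N t 2 = nth 0%N t 3 ->
    g a [:: 0; 0; 1; 2]%N * g b t = g b t * g a [:: 0; 0; 1; 2]%N.
  move=> t23; apply: (comm _ _ _ _ (nth 0%N t 2)).
  by case=> [|[|[|[|j]]]] // _; [left|left|right|right].
have c123 a b t : nth 0%N t 0 = nth 0%N t 1 -> nth 0%N t 1 = nth 0%N t 2 ->
    g a [:: 1; 2; 3; 0]%N * g b t = g b t * g a [:: 1; 2; 3; 0]%N.
  move=> t01 t12; apply: (comm _ _ _ _ (nth 0%N t 0)).
  by case=> [|[|[|[|j]]]] // _; [right|right|right; rewrite t01|left].
have c234 a b t : nth 0%N t 1 = nth 0%N t 2 -> nth 0%N t 2 = nth 0%N t 3 ->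
    g a [:: 0; 1; 2; 3]%N * g b t = g b t * g a [:: 0; 1; 2; 3]%N.
  move=> t12 t23; apply: (comm _ _ _ _ (nth 0%N t 1)).
  by case=> [|[|[|[|j]]]] // _; [left|right|right|right; rewrite t12].
set f34 := g 0%N [:: 0; 0; 1; 2]%N; set f2_34 := g 0%N [:: 0; 1; 2; 2]%N.
set f1_234 := g 0%N [:: 1; 2; 2; 2]%N; set f12_34 := g 0%N [:: 1; 1; 2; 2]%N.
set f23_4 := g 0%N [:: 0; 1; 1; 2]%N; set f23 := g 0%N [:: 0; 1; 2; 0]%N.
set f1_23 := g 0%N [:: 1; 2; 2; 0]%N.
set i12 := g 1%N [:: 1; 2; 0; 0]%N; set i12_34 := g 1%N [:: 1; 1; 2; 2]%N.
set i123_4 := g 1%N [:: 1; 1; 1; 2]%N; set i12_3 := g 1%N [:: 1; 1; 2; 0]%N.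
set i23_4 := g 1%N [:: 0; 1; 1; 2]%N; set i23 := g 1%N [:: 0; 1; 2; 0]%N.
set i1_23 := g 1%N [:: 1; 2; 2; 0]%N.
set P1 := g 2 [:: 1; 2; 3; 3]%N; set P2 := g 2 [:: 1; 1; 2; 3]%N.
set Q1 := g 2 [:: 0; 1; 2; 3]%N; set Q2 := g 2 [:: 1; 2; 2; 3]%N.
set Q3 := g 2 [:: 1; 2; 3; 0]%N; rewrite -/P1 -/P2 -/Q1 -/Q2 -/Q3 in pent.
have cA : GRing.comm f34 (f2_34 * f1_234 * P1 * i12_34 * i12).
  by do 4?apply: commrM; rewrite /GRing.comm c34.
have cB : GRing.comm i12 (f12_34 * P2 * i123_4 * i12_3).
  by do 3?apply: commrM; rewrite /GRing.comm c12.
have cC : GRing.comm i23 (f23_4 * f1_234 * Q2 * i123_4 * i1_23).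
  by do 4?apply: commrM; rewrite /GRing.comm c23.
have inv12_34 : i12_34 * f12_34 = 1 by exact: inv.
have inv23 : i23 * f23 = 1 by exact: inv.
have inv23_4 : i23_4 * f23_4 = 1 by exact: inv.
have inv1_23 : i1_23 * f1_23 = 1 by exact: inv.
(* Both sides are brought to this form: commuting factors past invariant blocks makes all
   intermediate twists meet their inverses, leaving the untwisted pentagon in the middle. *)
transitivity (f34 * f2_34 * f1_234 * (P1 * P2) * i123_4 * i12_3 * i12).
  have -> : f34 * f12_34 * P2 * i123_4 * i12_3 = f34 * (f12_34 * P2 * i123_4 * i12_3).
    by rewrite !mulrA.
  rewrite mulrA -cA -!mulrA.
  have -> : i12 * (f12_34 * (P2 * (i123_4 * i12_3))) = f12_34 * P2 * i123_4 * i12_3 * i12.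
    by rewrite -cB !mulrA.
  by rewrite -!mulrA [i12_34 * _]mulrA inv12_34 mul1r.
have -> : f34 * f2_34 * Q1 * i23_4 * i23 * (f23_4 * f1_234 * Q2 * i123_4 * i1_23) *
    (f23 * f1_23 * Q3 * i12_3 * i12) =
  f34 * f2_34 * Q1 * i23_4 * (i23 * (f23_4 * f1_234 * Q2 * i123_4 * i1_23)) *
    (f23 * f1_23 * Q3 * i12_3 * i12) by rewrite !mulrA.
rewrite cC pent -!mulrA [i23 * _]mulrA inv23 mul1r [i1_23 * _]mulrA inv1_23 mul1r.
rewrite [i23_4 * _]mulrA inv23_4 mul1r [Q1 * (f1_234 * _)]mulrA c234 // -!mulrA.
by rewrite [i123_4 * (Q3 * _)]mulrA -c123 // -!mulrA.
Qed.

Section Perturbation.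
Variables (K : fieldType) (V : lmodType K) (mu : V -> V -> V).
Hypothesis K0 : [pchar K] =i pred0.
Hypothesis mu_lie : lie_bracket mu.

Local Notation kk k := (kostant_kirillov (@lie_sum K V mu k)).
Local Notation star k := (cbh (kk k)).
Local Notation G k := (grp (lie_sum_lie mu_lie k)).
Local Notation rh k := (rho (lie_sum_lie mu_lie k)).
Local Notation sm n s := (shat_map (blk n s)).

Lemma grp_add_le k M N (u g : Shat (dsum V k)) : (M <= N)%N -> (1 < N)%N ->
  order_ge N u -> order_ge 2 g -> G k M (g + u) = G k M g + rh k M u.
Proof.
pose Lk := lie_sum_lie mu_lie k; rewrite leq_eqVlt => /orP[/eqP ->|MN] N1 hu hg.
  exact: (grp_add Lk).
rewrite (rho0 Lk (order_ge_le MN hu)) addr0; apply: (grp_order mu_lie MN).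
by apply/order_ge_sub; rewrite addrC addKr.
Qed.

Lemma rhoM_le k M N (u g : Shat (dsum V k)) : (M <= N)%N -> order_ge N u ->
  order_ge 2 g -> rh k M u * G k M g = rh k M u /\ G k M g * rh k M u = rh k M u.
Proof. by move=> MN hu hg; apply: (rho_grp _ (order_ge_le MN hu)). Qed.

Lemma rho_rho k M N (u v : Shat (dsum V k)) : (M <= N)%N -> (1 < N)%N -> order_ge N u ->
  order_ge N v -> rh k M u * rh k M v = 0.
Proof.
move=> MN N1 hu hv; apply: (rhoM_top _ (order_ge_le MN hu) _).1.
exact: order_ge_le hv.
Qed.

Lemma star_add k M N (f g u v : Shat (dsum V k)) (x y : Shat (dsum V k)) :
  (M <= N)%N -> (1 < N)%N -> order_ge 2 x -> order_ge 2 y ->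
  order_ge 2 f -> order_ge 2 g -> order_ge N u -> order_ge N v ->
  G k M x = G k M f + rh k M u -> G k M y = G k M g + rh k M v ->
  G k M (star k x y) = G k M (star k f g) + rh k M (u + v).
Proof.
move=> MN N1 hx hy hf hg hu hv ex ey; rewrite !(grp_star K0) // ex ey linearD.
apply: perturbed_mul; first exact: (rhoM_le MN hu hg).1.
  exact: (rhoM_le MN hv hf).2.
exact: rho_rho hu hv.
Qed.

Section PentAdd.
Variables (M N : nat) (phi v : Shat (dsum V 3)).
Hypotheses (MN : (M <= N)%N) (N1 : (1 < N)%N).
Hypotheses (phi2 : order_ge 2 phi) (vN : order_ge N v).

Let v2 : order_ge 2 v := order_ge_le N1 vN.

Let Gs n s : G n M (sm n s (phi + v)) = G n M (sm n s phi) + rh n M (sm n s v).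
Proof. by rewrite linearD; apply: (grp_add_le MN N1); exact: shat_map_order. Qed.

Let o2 n s : order_ge 2 (sm n s phi). Proof. exact: shat_map_order. Qed.
Let o2' n s : order_ge 2 (sm n s (phi + v)).
Proof. by apply: shat_map_order; exact: order_geD. Qed.
Let oN n s : order_ge N (sm n s v). Proof. exact: shat_map_order. Qed.

(** The three factors of the right side and the two of the left side are the even and the odd faces,
    so the first-order variation of the defect is the coboundary of v. *)
Lemma pent_add : G 4 M (pent_r mu (phi + v)) - G 4 M (pent_l mu (phi + v)) =
  G 4 M (pent_r mu phi) - G 4 M (pent_l mu phi) + rh 4 M (cob v).
Proof.
pose L4 := lie_sum_lie mu_lie 4.
have el := star_add MN N1 (o2' _ _) (o2' _ _) (o2 _ _) (o2 _ _) (oN _ _) (oN _ _)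
  (Gs 4 [:: 1; 2; 3; 3]%N) (Gs 4 [:: 1; 1; 2; 3]%N).
have er1 := star_add MN N1 (o2' _ _) (o2' _ _) (o2 _ _) (o2 _ _) (oN _ _) (oN _ _)
  (Gs 4 [:: 0; 1; 2; 3]%N) (Gs 4 [:: 1; 2; 2; 3]%N).
have er := star_add MN N1 (order_ge_cbh L4 (o2' _ _) (o2' _ _)) (o2' _ _)
  (order_ge_cbh L4 (o2 _ _) (o2 _ _)) (o2 _ _)
  (order_geD (oN _ _) (oN _ _)) (oN _ _) er1 (Gs 4 [:: 1; 2; 3; 0]%N).
rewrite [G 4 M (pent_l mu (phi + v))]el [G 4 M (pent_r mu (phi + v))]er.
rewrite opprD addrACA; congr (_ + _); rewrite -linearN -linearD; congr (rh 4 M _).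
rewrite /cob big_map /=.
rewrite !big_cons big_nil /= !scale1r !scaleN1r addr0 opprD !addrA.
by rewrite [LHS](ACl (1*5*2*4*3)).
Qed.
End PentAdd.

(** In order, the labels are 2,3 then 1,23 then 12,3 and 1,2. *)
Definition twist (f : Shat (dsum V 2)) (phi : Shat (dsum V 3)) : Shat (dsum V 3) :=
  star 3 (star 3 (star 3 (star 3 (sm 3 [:: 0; 1; 2]%N f) (sm 3 [:: 1; 2; 2]%N f)) phi)
    (- sm 3 [:: 1; 1; 2]%N f)) (- sm 3 [:: 1; 2; 0]%N f).

Lemma order_ge_star k (f g : Shat (dsum V k)) :
  order_ge 2 f -> order_ge 2 g -> order_ge 2 (star k f g).
Proof. exact: (order_ge_cbh (lie_sum_lie mu_lie k)). Qed.

Lemma order_ge_twist f phi : order_ge 2 f -> order_ge 2 phi -> order_ge 2 (twist f phi).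
Proof.
move=> hf hp; have o n s : order_ge 2 (sm n s f) by exact: shat_map_order.
by do 4?[apply: order_ge_star]; do ?[apply: order_geN]; do ?[exact: o]; exact: hp.
Qed.

Lemma shat_inv_twist f phi : shat_inv mu_lie f -> shat_inv mu_lie phi ->
  shat_inv mu_lie (twist f phi).
Proof.
move=> hf hp; have i n s : shat_inv mu_lie (sm n s f) by exact: shat_inv_map.
by do 4?[apply: shat_inv_cbh]; do ?[apply: shat_invN]; do ?[exact: i]; exact: hp.
Qed.

Lemma twist_agree N f f' phi : order_ge 2 f -> order_ge 2 f' -> order_ge 2 phi ->
  agree N f f' -> agree N (twist f phi) (twist f' phi).
Proof.
move=> hf hf' hp ff'.
have o n s : order_ge 2 (sm n s f) by exact: shat_map_order.
have o' n s : order_ge 2 (sm n s f') by exact: shat_map_order.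
have oN n s : order_ge 2 (- sm n s f) by exact: order_geN.
have oN' n s : order_ge 2 (- sm n s f') by exact: order_geN.
have a n s : agree N (sm n s f) (sm n s f') by exact: shat_map_agree.
have aN n s : agree N (- sm n s f) (- sm n s f').
  by move=> k kN; rewrite !shat_oppE a.
do 4?[apply: (star_agree K0 mu_lie)]; do ?[exact: a | exact: aN | exact: agree_refl];
  do 3?[apply: order_ge_star];
  do ?[exact: o | exact: o' | exact: oN | exact: oN' | exact: hp].
Qed.

Lemma pent_l_agree N phi phi' : order_ge 2 phi -> order_ge 2 phi' -> agree N phi phi' ->
  agree N (pent_l mu phi) (pent_l mu phi').
Proof.
move=> hp hp' pp'; apply: (star_agree K0 mu_lie);
  do ?[exact: shat_map_order]; exact: shat_map_agree.
Qed.

Lemma pent_r_agree N phi phi' : order_ge 2 phi -> order_ge 2 phi' -> agree N phi phi' ->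
  agree N (pent_r mu phi) (pent_r mu phi').
Proof.
move=> hp hp' pp'; do 2?[apply: (star_agree K0 mu_lie)]; do 1?[apply: order_ge_star];
  do ?[exact: shat_map_order]; exact: shat_map_agree.
Qed.

(** The factors [f] and [- f] of the twist carry the signs of the faces in the coboundary of a
    two-slot cochain. *)
Lemma twist_add M N f v phi : (M <= N)%N -> (1 < N)%N ->
  order_ge 2 f -> order_ge 2 phi -> order_ge N v ->
  G 3 M (twist (f + v) phi) = G 3 M (twist f phi) + rh 3 M (cob v).
Proof.
move=> MN N1 hf hp hv; have hfv : order_ge 2 (f + v).
  by apply: order_geD => //; exact: order_ge_le hv.
have o n s : order_ge 2 (sm n s f) by exact: shat_map_order.
have o' n s : order_ge 2 (sm n s (f + v)) by exact: shat_map_order.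
have oN n s : order_ge 2 (- sm n s f) by exact: order_geN.
have oN' n s : order_ge 2 (- sm n s (f + v)) by exact: order_geN.
have v1 n s : order_ge N (sm n s v) by exact: shat_map_order.
have vN n s : order_ge N (- sm n s v) by exact: order_geN.
have Gs n s : G n M (sm n s (f + v)) = G n M (sm n s f) + rh n M (sm n s v).
  by rewrite linearD; apply: (grp_add_le MN N1); [exact: v1|exact: o].
have GsN n s : G n M (- sm n s (f + v)) = G n M (- sm n s f) + rh n M (- sm n s v).
  by rewrite linearD opprD; apply: (grp_add_le MN N1); [exact: vN|exact: oN].
have Gp : G 3 M phi = G 3 M phi + rh 3 M 0 by rewrite linear0 addr0.
have e1 := star_add MN N1 (o' _ _) (o' _ _) (o _ _) (o _ _) (v1 _ _) (v1 _ _)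
  (Gs 3 [:: 0; 1; 2]%N) (Gs 3 [:: 1; 2; 2]%N).
have e2 := star_add MN N1 (order_ge_star (o' _ _) (o' _ _)) hp
  (order_ge_star (o _ _) (o _ _)) hp (order_geD (v1 _ _) (v1 _ _)) (@order_ge0 K _ N) e1 Gp.
have e3 := star_add MN N1 (order_ge_star (order_ge_star (o' _ _) (o' _ _)) hp) (oN' _ _)
  (order_ge_star (order_ge_star (o _ _) (o _ _)) hp) (oN _ _)
  (order_geD (order_geD (v1 _ _) (v1 _ _)) (@order_ge0 K _ N)) (vN _ _) e2
  (GsN 3 [:: 1; 1; 2]%N).
have e4 := star_add MN N1
  (order_ge_star (order_ge_star (order_ge_star (o' _ _) (o' _ _)) hp) (oN' _ _)) (oN' _ _)
  (order_ge_star (order_ge_star (order_ge_star (o _ _) (o _ _)) hp) (oN _ _)) (oN _ _)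
  (order_geD (order_geD (order_geD (v1 _ _) (v1 _ _)) (@order_ge0 K _ N)) (vN _ _)) (vN _ _) e3
  (GsN 3 [:: 1; 2; 0]%N).
rewrite [LHS]e4; congr (_ + rh 3 M _); rewrite /cob big_map /=.
rewrite !big_cons big_nil /= !scale1r !scaleN1r !addr0 !addrA.
by rewrite [RHS](ACl (1*3*2*4)).
Qed.

Lemma agree_perturb k N (x y : Shat (dsum V k)) : (1 < N)%N -> order_ge 2 x ->
  agree N x y -> forall M, (M <= N)%N -> G k M y = G k M x + rh k M (y - x).
Proof.
move=> N1 hx xy M MN; rewrite -(grp_add_le MN N1 _ hx) ?[x + _]addrC ?subrK //.
by apply/order_ge_sub/agree_sym.
Qed.

Lemma twist_step N f v phi phi' : (1 < N)%N -> order_ge 2 f -> order_ge 2 phi ->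
  order_ge 2 phi' -> order_ge N v -> agree N (twist f phi) phi' ->
  cob v N = (phi' - twist f phi) N -> agree N.+1 (twist (f + v) phi) phi'.
Proof.
move=> N1 hf hp hp' hv a e.
have hfv : order_ge 2 (f + v) by apply: order_geD => //; exact: order_ge_le hv.
have ht := order_ge_twist hf hp.
apply: (grp_agree K0 (mu_lie := lie_sum_lie mu_lie 3)) => //; first exact: order_ge_twist.
move=> M MN; rewrite (twist_add MN N1) // (agree_perturb N1 ht a MN).
congr (_ + _); apply: rho_agree => k kM.
have [kN|Nk] := ltnP k N.
  by rewrite (cob_order hv kN) shat_subE (a k kN) subrr.
by have -> : k = N by apply/eqP; rewrite eqn_leq Nk (leq_trans _ MN).
Qed.

Lemma pent_step N phi v : (1 < N)%N -> order_ge 2 phi -> order_ge N v ->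
  agree N (pent_l mu phi) (pent_r mu phi) -> cob v N = - (pent_r mu phi - pent_l mu phi) N ->
  agree N.+1 (pent_l mu (phi + v)) (pent_r mu (phi + v)).
Proof.
move=> N1 hp hv a e.
have hpv : order_ge 2 (phi + v) by apply: order_geD => //; exact: order_ge_le hv.
apply: (grp_agree K0 (mu_lie := lie_sum_lie mu_lie 4)).
- exact: (order_ge_pent_l mu_lie).
- exact: (order_ge_pent_r mu_lie).
move=> M MN; apply/eqP; rewrite eq_sym -subr_eq0 (pent_add MN N1) //.
rewrite (agree_perturb N1 (order_ge_pent_l mu_lie hp) a MN)
  [X in X + rh 4 M (cob v)]addrAC subrr add0r.
rewrite -linearD; apply/eqP; apply: rho0 => k kM; rewrite shat_addE.
have [kN|Nk] := ltnP k N.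
  by rewrite (cob_order hv kN) shat_subE (a k kN) subrr addr0.
by have -> : k = N; [apply/eqP; rewrite eqn_leq Nk (leq_trans _ MN)|rewrite e subrr].
Qed.

Lemma pent_diff N phi v : (1 < N)%N -> order_ge 2 phi -> order_ge N v ->
  pent_l mu phi = pent_r mu phi -> pent_l mu (phi + v) = pent_r mu (phi + v) -> cob v N = 0.
Proof.
move=> N1 hp hv e e'; apply: (rho_inj K0 (mu_lie := lie_sum_lie mu_lie 4) N1).
  exact: cob_order.
have := pent_add (leqnn N) N1 hp hv; rewrite e e' !subrr add0r.
by move/esym.
Qed.

Lemma twist_pentagon f phi : order_ge 2 f -> order_ge 2 phi ->
  shat_inv mu_lie f -> shat_inv mu_lie phi ->
  pent_l mu phi = pent_r mu phi -> pent_l mu (twist f phi) = pent_r mu (twist f phi).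
Proof.
move=> hf hp fi pi e; have ht := order_ge_twist hf hp.
pose L4 := lie_sum_lie mu_lie 4.
apply: (grp_inj K0 (mu_lie := L4)).
- exact: (order_ge_pent_l mu_lie).
- exact: (order_ge_pent_r mu_lie).
move=> N; have o s : order_ge 2 (sm 4 s f) by exact: shat_map_order.
have oN s : order_ge 2 (- sm 4 s f) by exact: order_geN.
have op s : order_ge 2 (sm 4 s phi) by exact: shat_map_order.
have ot s : order_ge 2 (sm 4 s (twist f phi)) by exact: shat_map_order.
(* Index 0 is the twist, 1 its inverse, 2 the associator, as in [twist_labels]. *)
pose X (a : nat) s : Shat (dsum V 4) :=
  if a is a'.+1 then if a' is 0%N then - sm 4 s f else sm 4 s phi else sm 4 s f.
have oX a s : order_ge 2 (X a s).
  by case: a => [|[|a]]; [exact: o|exact: oN|exact: op].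
have comm a b s t l : (forall j, (j < 4)%N -> nth 0%N s j = 0%N \/ nth 0%N t j = l) ->
    G 4 N (X a s) * G 4 N (X b t) = G 4 N (X b t) * G 4 N (X a s).
  move=> h; apply: (grp_commute L4) => //.
  have XE c u : exists m (F : Shat (dsum V m)), shat_inv mu_lie F /\ X c u = sm 4 u F.
    case: c => [|[|c]]; [by exists 2, f|exists 2, (- f)|by exists 3, phi].
    by split; [exact: shat_invN|rewrite /X linearN].
  have [m [F [Fi ->]]] := XE a s; have [m' [F' [_ ->]]] := XE b t.
  exact: (kk_invariant (l := l) _ Fi h).
have tw s : G 4 N (sm 4 s (twist f phi)) =
    G 4 N (X 0%N (label_comp s [:: 0; 1; 2]%N)) * G 4 N (X 0%N (label_comp s [:: 1; 2; 2]%N))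
    * G 4 N (X 2 s) * G 4 N (X 1%N (label_comp s [:: 1; 1; 2]%N))
    * G 4 N (X 1%N (label_comp s [:: 1; 2; 0]%N)).
  rewrite /twist !(sm_star mu_lie) !linearN /= !sm_comp //.
  rewrite !(grp_star K0) //; do 3?[apply: order_ge_star];
    do ?[exact: o | exact: oN | exact: op].
rewrite /pent_l /pent_r !(grp_star K0) //; last exact: order_ge_star.
rewrite !tw; apply: (@twist_labels _ (fun a s => G 4 N (X a s))) => //.
  by move=> s; exact: (grpN K0).
have := congr1 (G 4 N) e; rewrite /pent_l /pent_r !(grp_star K0) //.
exact: order_ge_star.
Qed.

(** The product of the images of two elements of order 3 raises orders to at least 5, beyond a
    cutoff of at most 4: there the group law is addition. *)
Lemma star_small k M (x y u v : Shat (dsum V k)) : (M <= 4)%N ->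
  order_ge 2 x -> order_ge 2 y -> order_ge 3 u -> order_ge 3 v ->
  G k M x = 1 + rh k M u -> G k M y = 1 + rh k M v ->
  G k M (star k x y) = 1 + rh k M (u + v).
Proof.
pose Lk := lie_sum_lie mu_lie k; move=> M4 hx hy hu hv ex ey.
rewrite (grp_star K0) // ex ey mulrDl mul1r mulrDr mulr1 linearD.
have -> : rh k M u * rh k M v = 0.
  apply: linEndP => m; rewrite leME !rhoE le0E; apply: cutoff0.
  apply: (@order_ge_le _ _ _ 5) => //.
  apply: (order_ge_rep Lk (a := 3) (b := 3) hu); apply: order_ge_cutoff.
  exact: (order_ge_rep1 Lk).
by rewrite addr0 -addrA [rh k M v + _]addrC.
Qed.

Lemma grp_small k M (u : Shat (dsum V k)) : (M <= 4)%N -> order_ge 3 u ->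
  G k M u = 1 + rh k M u.
Proof.
pose Lk := lie_sum_lie mu_lie k; move=> M4 hu; apply: linEndP => m.
rewrite leDE le1E; apply: nexp_killed => //; rewrite !rhoE; apply: cutoff0.
apply: (@order_ge_le _ _ _ 5) => //.
apply: (order_ge_rep Lk (a := 3) (b := 3) hu); apply: order_ge_cutoff.
exact: (order_ge_rep1 Lk).
Qed.

(** In degrees up to 4 the pentagon is linear and its defect is the coboundary of [phi], which gives
    the start of the induction in degree 5. *)
Lemma pent_small phi : order_ge 3 phi -> cob phi = 0 ->
  agree 5 (pent_l mu phi) (pent_r mu phi).
Proof.
move=> h3 cp; have hp : order_ge 2 phi by exact: order_ge_le h3.
have o s : order_ge 2 (sm 4 s phi) by exact: shat_map_order.
have o3 s : order_ge 3 (sm 4 s phi) by exact: shat_map_order.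
apply: (grp_agree K0 (mu_lie := lie_sum_lie mu_lie 4)).
- exact: (order_ge_pent_l mu_lie).
- exact: (order_ge_pent_r mu_lie).
move=> M M4; have Gs s := grp_small M4 (o3 s).
have el := star_small M4 (o _) (o _) (o3 _) (o3 _) (Gs [:: 1; 2; 3; 3]%N)
  (Gs [:: 1; 1; 2; 3]%N).
have er1 := star_small M4 (o _) (o _) (o3 _) (o3 _) (Gs [:: 0; 1; 2; 3]%N)
  (Gs [:: 1; 2; 2; 3]%N).
have er := star_small M4 (order_ge_star (o _) (o _)) (o _) (order_geD (o3 _) (o3 _))
  (o3 _) er1 (Gs [:: 1; 2; 3; 0]%N).
rewrite [LHS]el [RHS]er; congr (1 + rh 4 M _); apply/eqP; rewrite eq_sym -subr_eq0 -cp.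
rewrite /cob big_map /= !big_cons big_nil /= !scale1r !scaleN1r addr0 opprD !addrA.
by rewrite [X in X == _](ACl (1*5*2*4*3)).
Qed.

End Perturbation.

(** * Limits, and tensor powers of the maximal ideal as common kernels of counits *)

Section Limit.
Variables (K : fieldType) (V : lmodType K) (c : nat) (F : nat -> Shat V).
Hypothesis F_step : forall k, agree (k + c) (F k.+1) (F k).

Fact shat_limit_homog n : homog n (F n.+1 n). Proof. exact: scomp_homog. Qed.
(** Component n is read at index n + 1, from which on it is stationary whatever the offset c. *)
Definition shat_limit : Shat V := MkShat shat_limit_homog.

Lemma agree_limit k : agree (k + c) shat_limit (F k).
Proof.
have st i j : agree (i + c) (F (i + j)%N) (F i).
  elim: j => [|j IH]; first by rewrite addn0.
  move=> n hn; rewrite addnS F_step ?IH // (leq_trans hn) // leq_add2r leq_addr //.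
move=> n nk /=; have [nk'|kn] := leqP n.+1 k.
  by rewrite -(subnKC nk') st // (leq_trans (ltnSn n)) // leq_addr.
by rewrite -(subnKC (ltnW kn)) st.
Qed.
End Limit.

Section ErasedSlots.
Variables (K : fieldType) (V : lmodType K) (k : nat).

Fact inj_is_linear (i : 'I_k) : linear (@inj K V k i).
Proof.
move=> c u v; apply/ffunP => j; rewrite !ffunE.
by case: eqP => _; rewrite ?scaler0 ?addr0.
Qed.
HB.instance Definition _ (i : 'I_k) :=
  GRing.isLinear.Build _ _ _ _ (@inj K V k i) (inj_is_linear i).

Lemma sum_inj (v : dsum V k) : v = \sum_i inj i (v i).
Proof.
apply/ffunP => j; rewrite sum_ffunE (bigD1 j) //= ffunE eqxx big1 ?addr0 // => i /negPf ij.
by rewrite ffunE eq_sym ij.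
Qed.

Definition slot_monomial (s : seq ('I_k * V)) : symAlg (dsum V k) :=
  \prod_(q <- s) sym_var (inj q.1 q.2).

Lemma homog_monomials n x : homog n x ->
  Defs.span (fun y => exists2 s, size s = n & y = slot_monomial s) x.
Proof.
elim/homog_ind => [|y z hy hz|c y hy|s].
- exact: span0.
- exact: spanD.
- elim: hy => [|y1 y2 _ h1 _ h2|d _ [s sn ->]]; first by rewrite scaler0; exact: span0.
    by rewrite scalerDr; exact: spanD.
  by rewrite scalerA; apply: spanZ; exists s.
elim: s n => [|v s IH] n sn.
  rewrite big_nil -[1]scale1r; apply: spanZ; exists [::]; first by rewrite -sn.
  by rewrite /slot_monomial big_nil.
case: n sn => // n [sn]; rewrite big_cons; elim: (IH n sn) => [|y z _ hy _ hz|c _ [t tn ->]].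
- by rewrite mulr0; exact: span0.
- by rewrite mulrDr; exact: spanD.
rewrite (sum_inj v) linear_sum mulr_suml /=.
apply: (big_ind (Defs.span _)) => [|y z hy hz|i _]; first exact: span0.
  exact: spanD.
rewrite -scalerAr; apply: spanZ; exists ((i, v i) :: t); first by rewrite /= tn.
by rewrite /slot_monomial big_cons.
Qed.

Lemma erase_monomial (p : 'I_k) s : sym_map (blk k (erase k p.+1)) (slot_monomial s) =
  if p \in [seq q.1 | q <- s] then 0 else slot_monomial s.
Proof.
have e (q : 'I_k * V) : sym_map (blk k (erase k p.+1)) (sym_var (inj q.1 q.2)) =
    if p == q.1 then 0 else sym_var (inj q.1 q.2).
  rewrite sym_map_var; case: (p =P q.1) => [pq|pq]; rewrite -?[X in _ = X](linear0 sym_var);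
    congr sym_var; apply/ffunP => j; rewrite blk_eraseE eqSS -[(_ == _ :> nat)]/(j == p) !ffunE.
    by rewrite -pq; case: (j == p).
  by case: eqP => // ->; case: eqP.
elim: s => [|q s IH]; first by rewrite /slot_monomial big_nil rmorph1.
rewrite /slot_monomial big_cons rmorphM -/(slot_monomial s) [X in _ * X]IH [X in X * _]e in_cons.
by case: (p == q.1); rewrite ?mul0r //=; case: ifP; rewrite ?mulr0.
Qed.

(** The product of the projections 1 - (counit of slot p): it keeps the monomials that meet every
    slot of the list and kills the others. *)
Definition keep_slots (ps : seq 'I_k) (x : symAlg (dsum V k)) :=
  foldr (fun (p : 'I_k) y => y - sym_map (blk k (erase k p.+1)) y) x ps.

Fact keep_slots_is_linear ps : linear (keep_slots ps).
Proof.
move=> c x y; elim: ps => //= p ps ->.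
by rewrite linearP opprD scalerBr addrACA.
Qed.
HB.instance Definition _ ps :=
  GRing.isLinear.Build _ _ _ _ (keep_slots ps) (keep_slots_is_linear ps).

Lemma keep_slots_monomial ps s : keep_slots ps (slot_monomial s) =
  if all (fun p => p \in [seq q.1 | q <- s]) ps then slot_monomial s else 0.
Proof.
elim: ps => //= p ps ->; case: ifP => _; last by rewrite linear0 subr0 andbF.
by rewrite erase_monomial andbT; case: ifP; rewrite ?subr0 ?subrr.
Qed.

Lemma keep_slots_erased ps x : slots_erased x -> keep_slots ps x = x.
Proof.
move=> ex; elim: ps => //= p ps ->; rewrite ex ?subr0 //=.
Qed.

(** [keep_slots] for all slots fixes x; applied to any expansion of x into monomials it discards
    those that miss a slot. *)
Lemma erased_monomials n x : homog n x -> slots_erased x ->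
  Defs.span (fun y => exists2 s, (size s = n) /\ (forall p, p \in [seq q.1 | q <- s])
    & y = slot_monomial s) x.
Proof.
move=> hx ex; rewrite -(keep_slots_erased (enum 'I_k) ex).
move: x {hx ex}(homog_monomials hx) => x; elim=> [|y z _ hy _ hz|c _ [s sn ->]].
- by rewrite linear0; exact: span0.
- by rewrite linearD; exact: spanD.
rewrite linearZ /= keep_slots_monomial; case: allP => full.
  by apply: spanZ; exists s => //; split=> // p; apply: full; rewrite mem_enum.
by rewrite scaler0; exact: span0.
Qed.

Lemma slot_monomial_prod s : slot_monomial s =
  \prod_i sym_inj i (\prod_(q <- s | q.1 == i) sym_var q.2).
Proof.
rewrite /slot_monomial (partition_big (fun q => q.1) xpredT) //=.
apply: eq_bigr => i _; rewrite -[sym_inj i]/(sym_map (inj i)) rmorph_prod.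
by apply: eq_bigr => q /eqP <-; rewrite [RHS]sym_map_var.
Qed.

Lemma erased_order (f : Shat (dsum V k)) : (forall n, slots_erased (f n)) -> order_ge k f.
Proof.
move=> ef n nk; move: (f n) (erased_monomials (scomp_homog f n) (ef n)) => x.
elim=> {x} //.
- by move=> x y _ hx _ hy; rewrite hx hy addr0.
move=> c x [s [sn full] _]; have := nk; rewrite ltnNge -sn => /negP[].
rewrite -(size_map (fun q => q.1) s) -[X in (X <= _)%N](size_enum_ord k).
by apply: uniq_leq_size (enum_uniq _) _ => p _.
Qed.

(** Together with [max_ideal_erased], this replaces membership in the tensor power of the maximal
    ideal by the vanishing of linear maps, which passes through all the constructions. *)
Lemma erased_max_ideal (f : Shat (dsum V k)) :
  (forall n, slots_erased (f n)) -> max_ideal_tensor f.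
Proof.
move=> ef n; move: (f n) (erased_monomials (scomp_homog f n) (ef n)) => x0.
elim=> {x0} [|x y _ hx _ hy|].
- exact: span0.
- exact: spanD.
move=> c _ [s [sn full] ->]; apply: spanZ.
exists (fun i => \prod_(q <- s | q.1 == i) sym_var q.2); last exact: slot_monomial_prod.
move=> i; exists (size [seq q <- s | q.1 == i]).
  rewrite -has_predT has_filter filter_predT -has_filter.
  have /mapP[q qs ->] := full i; apply/hasP; exists q => //=.
by rewrite -big_filter -(big_map (fun q => q.2) xpredT sym_var) -(size_map (fun q => q.2));
  exact: homog_prod.
Qed.

Lemma sym_map0_homog (W : lmodType K) (A : {linear V -> W}) d x :
  (forall v, A v = 0) -> (0 < d)%N -> homog d x -> sym_map A x = 0.
Proof.
move=> A0 d0; elim/homog_ind => [|y z hy hz|c y hy|[|v s] sn].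
- exact: linear0.
- by rewrite linearD /= hy hz addr0.
- by rewrite linearZ /= hy scaler0.
- by rewrite -sn in d0.
by rewrite big_cons rmorphM /= sym_map_var A0 linear0 mul0r.
Qed.

Lemma max_ideal_erased (f : Shat (dsum V k)) :
  max_ideal_tensor f -> forall n, slots_erased (f n).
Proof.
move=> hf n [//|p] pk; move: (f n) (hf n) => x0; elim=> {x0} [|x y _ hx _ hy|c _ [t ht ->]].
- exact: linear0.
- by rewrite linearD /= hx hy addr0.
rewrite linearZ rmorph_prod (bigD1 (Ordinal pk)) //=.
rewrite -[sym_inj _]/(sym_map (inj (Ordinal pk))) sym_map_comp.
have [d d0 td] := ht (Ordinal pk).
rewrite (sym_map0_homog _ d0 td) ?mul0r ?scaler0 // => v /=.
apply/ffunP => j; rewrite blk_eraseE !ffunE eqSS -[p]/(val (Ordinal pk)) (inj_eq val_inj).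
by case: eqP.
Qed.

(** A monomial with k factors that meets all k slots has exactly one factor in each. *)
Lemma erased_tensor (x : symAlg (dsum V k)) : homog k x -> slots_erased x -> tensor x.
Proof.
move=> hx ex; move: x {hx ex}(erased_monomials hx ex) => x.
elim=> {x} [|y z _ hy _ hz|c _ [s [sn full] ->]].
- exact: span0.
- exact: spanD.
apply: spanZ; rewrite slot_monomial_prod.
have one i : exists v, \prod_(q <- s | q.1 == i) sym_var q.2 = sym_var v :> symAlg V.
  have u : uniq [seq q.1 | q <- s].
    apply: leq_size_uniq (enum_uniq 'I_k) _ _; first by move=> p _.
    by rewrite size_map sn size_enum_ord.
  have /mapP[q qs qi] := full i; exists q.2.
  have us : uniq s by exact: map_uniq u.
  rewrite big_mkcond (bigD1_seq q) //= qi eqxx big1_seq ?mulr1 // => r /andP[rq rs].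
  case: eqP => // ri; case/eqP: rq; apply: contraTeq isT => rq.
  have := perm_uniq (perm_map (fun q : 'I_k * V => q.1) (perm_to_rem qs)).
  rewrite u => /esym/andP[/negP[]].
  by apply/mapP; exists r; rewrite // mem_rem_uniq // inE rq.
pose t i := projT1 (cid (one i)); exists t; apply: eq_bigr => i _.
rewrite /t; case: (cid (one i)) => v /= ->.
exact: (sym_map_var (inj i)).
Qed.

End ErasedSlots.

(** * Lifts with primitive coproduct *)

Section StandardMaps.
Variables (K : fieldType) (V : lmodType K).

Definition diag k (v : V) : dsum V k := [ffun=> v].

Fact diag_is_linear k : linear (@diag k).
Proof. by move=> c u v; apply/ffunP => i; rewrite !ffunE. Qed.
HB.instance Definition _ k := GRing.isLinear.Build _ _ _ _ (@diag k) (@diag_is_linear k).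

Definition coord k (i : 'I_k) (v : dsum V k) : V := v i.

Fact coord_is_linear k i : linear (@coord k i).
Proof. by move=> c u v; rewrite /coord !ffunE. Qed.
HB.instance Definition _ k i :=
  GRing.isLinear.Build _ _ _ _ (@coord k i) (@coord_is_linear k i).

Lemma blk_diag m n s (v : V) : (0 < m)%N ->
  (forall j, (j < n)%N -> 0 < nth 0%N s j <= m)%N -> blk n s (diag m v) = diag n v.
Proof.
move=> m0 hs; apply/ffunP => j; rewrite !ffunE.
have := hs j (ltn_ord j); case: (nth 0%N s j) => //= l lm.
by rewrite -[l]/(val (Ordinal lm)) slot_ord ffunE.
Qed.

Lemma shat_map_id (W : lmodType K) (A : {linear W -> W}) f : A =1 id -> shat_map A f = f.
Proof.
move=> A1; apply: shatP => n; rewrite shat_mapE -[RHS](congr1 (@^~ (f n)) (sym_map_idfun W)).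
exact: eq_sym_map.
Qed.

Lemma sm_iota k (f : Shat (dsum V k)) : shat_map (blk k (iota 1 k)) f = f.
Proof. by apply: shat_map_id => v; exact: blk_iota. Qed.

Lemma shat_push_map m n (s : 'I_m -> 'I_n) : shat_push s =1 shat_map (@push K V m n s).
Proof. by apply: shat_lift_var => v. Qed.

Lemma shat_inj_map k (i : 'I_k) : shat_inj i =1 shat_map (@inj K V k i).
Proof. by apply: shat_lift_var => v. Qed.

Lemma shat_proj_map k (i : 'I_k) : @shat_proj K V k i =1 shat_map (coord i).
Proof. by apply: shat_lift_var => v. Qed.

Local Notation D := (@primitive_coproduct K V).

Lemma primitive_coproductE : D =1 shat_map (diag 2).
Proof.
apply: shat_lift_var => v; rewrite -[RHS]/(shat_var (diag 2 v)) (sum_inj (diag 2 v)) linear_sum.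
by apply: eq_bigr => i _; rewrite shat_inj_map shat_map_var ffunE.
Qed.

Lemma face_nth k m j : (m <= k)%N -> (j <= k)%N ->
  nth 0%N (face k k m) j = if (j < m)%N then j.+1 else j.
Proof.
move=> mk jk; rewrite /face (nth_map 0%N) ?size_iota // nth_iota // mk add1n.
by case: ltnP.
Qed.

(** The primitive coproduct doubles the vector in the chosen slot. Ordinals count slots from 0 and
    labels from 1, hence the face i + 1. *)
Lemma coproduct_at_face k (i : 'I_k) :
  coproduct_at D i =1 shat_map (@blk K V k k.+1 (face k k i.+1)).
Proof.
pose skip (j : 'I_k) : 'I_k.+1 := lift (lift ord0 i) j.
pose pair (j : 'I_2) : 'I_k.+1 := if j == ord0 then skip i else lift ord0 i.
pose u (v : dsum V k) j := if j == i then push pair (diag 2 (v j)) else inj (skip j) (v j).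
apply: shat_lift_var => v.
transitivity (shat_var (\sum_j u v j)).
  rewrite linear_sum; apply: eq_bigr => j _; rewrite /u; case: (j == i).
    by rewrite primitive_coproductE shat_map_var shat_push_map shat_map_var.
  by rewrite shat_inj_map shat_map_var.
congr shat_var; apply/ffunP => q; rewrite sum_ffunE [RHS]ffunE /slot.
rewrite (face_nth (ltn_ord i) (ltn_ord q : (q <= k)%N)).
apply: eq_bigr => j _; rewrite /u; case: (j =P i) => [->|ji]; rewrite !ffunE.
  rewrite big_mkcond /= !big_ord_recl big_ord0 !ffunE addr0 /pair /=.
  rewrite -!(inj_eq val_inj) /= /bump leqNgt ltnS leqnn add0n /= add1n.
  have [qi|qi] := leqP q i.
    rewrite eqSS eq_sym; case: eqP => [qi'|_]; rewrite ?scale1r ?scale0r ?add0r.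
      by rewrite -qi' gtn_eqF ?addr0.
    by rewrite gtn_eqF.
  by rewrite ltn_eqF // add0r eq_sym; case: eqP; rewrite ?scale1r ?scale0r.
rewrite /skip -(inj_eq val_inj) /= /bump /=.
have -> : (q == ((i.+1 <= j)%N + j)%N :> nat) = ((if (q < i.+1)%N then q.+1 else q) == j.+1).
  have {}ji : (j != i :> nat) by apply/eqP => e; apply: ji; exact: val_inj.
  by case: (ltnP q i.+1) ji; case: (ltnP i j); lia.
by case: eqP; rewrite ?scale1r ?scale0r.
Qed.

Lemma push_lift0 k : shat_push (lift ord0) =1 shat_map (@blk K V k k.+1 (face k k 0)).
Proof.
move=> f; rewrite shat_push_map; apply: eq_shat_map => v.
apply: push_blk => [|i|j]; first exact: lift_inj.
  by rewrite (face_nth _ (ltn_ord (lift ord0 i) : (lift ord0 i <= k)%N)) // lift0.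
rewrite (face_nth _ (ltn_ord j : (j <= k)%N)) //; by case: (unliftP ord0 j) => [i -> /(_ i)/eqP|->].
Qed.

Lemma push_lift_max k : shat_push (lift ord_max) =1 shat_map (@blk K V k k.+1 (face k k k.+1)).
Proof.
have fE (j : 'I_k.+1) : nth 0%N (face k k k.+1) j = if j == ord_max then 0%N else j.+1.
  rewrite /face (nth_map 0%N) ?size_iota // nth_iota // add1n eqSS ltnn.
  rewrite -(inj_eq val_inj) /=; case: eqP => // /eqP jk.
  by rewrite ltn_neqAle jk -ltnS ltn_ord.
move=> f; rewrite shat_push_map; apply: eq_shat_map => v.
apply: push_blk => [|i|j]; first exact: lift_inj.
  by rewrite fE eq_sym (negPf (neq_lift _ _)) lift_max.
by rewrite fE; case: (unliftP ord_max j) => [i -> /(_ i)/eqP|->]; rewrite ?eqxx.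
Qed.

End StandardMaps.

Section PrimitiveLifts.
Variables (K : fieldType) (V : lmodType K) (mu : V -> V -> V).
Hypothesis K0 : [pchar K] =i pred0.
Hypothesis mu_lie : lie_bracket mu.
Local Notation P := (kostant_kirillov mu).
Local Notation D := (@primitive_coproduct K V).
Local Notation kk k := (kostant_kirillov (@lie_sum K V mu k)).
Local Notation sm n s := (shat_map (blk n s)).

Lemma tensor_bracket_kk k : tensor_bracket P (k:=k) = kk k.
Proof.
congr shat_bider; apply/funext => v; apply/funext => w.
rewrite [lie_sum mu v w]sum_inj linear_sum; apply: eq_bigr => i _.
rewrite -[shat_var (v i)](sym_ext_var (@shat_var K V)).
rewrite -[shat_var (w i)](sym_ext_var (@shat_var K V)).
rewrite kk_shat_of // sym_poisson_var // [X in shat_inj i X](sym_ext_var (@shat_var K V)).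
by rewrite shat_inj_map shat_map_var ffunE.
Qed.

Lemma diag_lie k u v : diag k (mu u v) = lie_sum mu (diag k u) (diag k v).
Proof. by apply/ffunP => i; rewrite !ffunE. Qed.

Lemma kk_diag k (f : Shat (dsum V k)) a : shat_inv mu_lie f -> kk k f (shat_map (diag k) a) = 0.
Proof.
move=> hf; rewrite -(sm_iota f).
have -> : shat_map (diag k) a = sm k (nseq k 1%N) (shat_map (diag 1) a).
  rewrite shat_map_comp; apply: eq_shat_map => v /=.
  by rewrite blk_diag // => j jk; rewrite nth_nseq jk.
by apply: (kk_invariant (l := 1%N) _ hf) => j jk; right; rewrite nth_nseq jk.
Qed.

Lemma bexp_fix (W : lmodType K) (Q : Shat W -> Shat W -> Shat W) f b :
  Q f 0 = 0 -> Q f b = 0 -> bexp Q f b = b.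
Proof.
move=> Q0 Qb; apply: shatP => n /=; rewrite shat_sumE big_ord_recl /= invr1 scale1r big1 ?addr0 //.
move=> i _; rewrite -[Q f _]/(iter (val i).+1 (Q f) b) iterSr Qb iter_fix // scaler0 //.
Qed.

(** Iterating the bracket with f strictly raises the order, so the lowest component of P(f, b)
    cannot be cancelled by the later terms of the exponential. *)
Lemma bexp_fixed (f : Shat (dsum V 3)) b : order_ge 3 f -> bexp (kk 3) f b = b -> kk 3 f b = 0.
Proof.
set L := lie_sum_lie mu_lie 3.
move=> f3 fb; apply: agree_eq; elim=> [//|n IH] m.
rewrite ltnS leq_eqVlt => /orP[/eqP ->|]; last exact: IH.
case: n IH m => [|n] IH _; first exact: kk_max_ideal.
have hi i : order_ge (n.+1 + i) (iter i.+1 (kk 3 f) b).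
  elim: i => [|i Hi]; first by move=> j; rewrite addn0; exact: IH.
  apply: (@order_ge_le _ _ _ (3 + (n.+1 + i)).-1); first by rewrite addnS leqnSn.
  by apply: (order_ge_kk L f3) => l /andP[_]; exact: Hi.
have : (\sum_(k < n.+2) k`!%:R^-1 *: iter k (kk 3 f) b) n.+1 = b n.+1.
  by rewrite -[in RHS]fb.
rewrite shat_sumE !big_ord_recl big1 => [|i _].
  rewrite !shat_scaleE addr0 invr1 !scale1r => /eqP.
  by rewrite -subr_eq0 addrAC subrr add0r => /eqP.
rewrite shat_scaleE -[iter _ _ _]/(iter (val i).+2 (kk 3 f) b) (hi (val i).+1) ?scaler0 //.
by rewrite addnS ltnS leq_addr.
Qed.

Lemma kk_var (W : lmodType K) (nu : W -> W -> W) (nu_lie : lie_bracket nu) f w n :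
  kostant_kirillov nu f (shat_var w) n = sym_poisson nu (f n) (sym_var w).
Proof.
have vE l : shat_var w l = if l == 1%N then sym_var w else 0 by case: l => [|[|l]].
have n2 : (n < n.+2)%N by [].
rewrite kkE // (bigD1 (Ordinal n2)) //= (bigD1 (Ordinal (isT : (1 < n.+2)%N))) //=.
rewrite addn1 eqxx ?vE ?eqxx big1 ?addr0 => [|l l1]; last first.
  rewrite ?vE -[l == 1%N :> nat]/(l == Ordinal (isT : (1 < n.+2)%N)) (negPf l1).
  by rewrite sym_poisson0r ?if_same.
rewrite big1 ?addr0 // => k kn; apply: big1 => l _; case: eqP => // kl.
rewrite ?vE; case: eqP => l1; last exact: sym_poisson0r.
by case/eqP: kn; apply: val_inj => /=; move: kl; rewrite l1 addn1 => -[].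
Qed.

(** The case where a is a generator z suffices: by [bexp_fixed] f commutes with the diagonal z, and
    that bracket is, up to sign, the action of z. *)
Lemma coassoc_invariant (f : Shat (dsum V 3)) : order_ge 3 f ->
  (forall a, bexp (kk 3) f (shat_map (diag 3) a) = shat_map (diag 3) a) -> shat_inv mu_lie f.
Proof.
move=> f3 hf n z; have := bexp_fixed f3 (hf (shat_var z)).
rewrite shat_map_var => /(congr1 (fun g : Shat _ => g n)).
rewrite kk_var; last exact: lie_sum_lie.
rewrite sym_poisson_anti; last exact: lie_sum_lie.
by rewrite -poisson_diag => /eqP; rewrite oppr_eq0 => /eqP.
Qed.

End PrimitiveLifts.

Section LiftsAsPentagons.
Variables (K : fieldType) (V : lmodType K) (mu : V -> V -> V).
Hypothesis K0 : [pchar K] =i pred0.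
Hypothesis mu_lie : lie_bracket mu.
Local Notation P := (kostant_kirillov mu).
Local Notation D := (@primitive_coproduct K V).
Local Notation kk k := (kostant_kirillov (@lie_sum K V mu k)).
Local Notation sm n s := (shat_map (blk n s)).

Lemma coproduct_at_primitive (i : 'I_2) a :
  coproduct_at D i (D a) = shat_map (diag 3) a.
Proof.
rewrite coproduct_at_face primitive_coproductE shat_map_comp; apply: eq_shat_map => v.
apply: blk_diag => // j; case: i => [[|[|//]] ?];
by case: j => [|[|[|]]].
Qed.

Lemma shat_alt3E (f : Shat (dsum V 3)) n :
  shat_alt3 f n = 6%:R^-1 *: smap_op 3 alt_labels (f n).
Proof.
rewrite shat_scaleE shat_sumE -sum_S3; congr (_ *: _); apply: eq_bigr => s _.
by rewrite shat_scaleE shat_push_map.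
Qed.

Lemma exterior_alt (x : symAlg (dsum V 3)) : exterior x ->
  6%:R^-1 *: smap_op 3 alt_labels x = x.
Proof.
case=> _ hx; rewrite -sum_S3.
have -> : \sum_(s : 'S_3) (-1) ^+ s *: sym_map (push s) x = \sum_(s : 'S_3) x.
  apply: eq_bigr => s _; rewrite -[sym_map _ _]/(sym_perm s x) hx scalerA.
  by rewrite -expr2 sqrr_sign scale1r.
rewrite sumr_const -scaler_nat card_Sn scalerA mulVf ?scale1r //.
exact: (natS_neq0 K0 5).
Qed.

Lemma max_ideal_order k (f : Shat (dsum V k)) : max_ideal_tensor f -> order_ge k f.
Proof. by move=> hf; apply: erased_order; exact: max_ideal_erased. Qed.

Lemma twist_associatorE (f : Shat (dsum V 2)) (phi : Shat (dsum V 3)) :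
  twist_associator P D f phi = twist mu f phi.
Proof.
by rewrite /twist_associator tensor_bracket_kk // !coproduct_at_face push_lift0 push_lift_max.
Qed.

Lemma twist_coproductE (f : Shat (dsum V 2)) : shat_inv mu_lie f -> twist_coproduct P D f =1 D.
Proof.
move=> hf a; rewrite /twist_coproduct tensor_bracket_kk // primitive_coproductE.
apply: bexp_fix; first by apply: kk0r; exact: lie_sum_lie.
exact: kk_diag.
Qed.

Lemma pent_lE phi : cbh (kk 4) (coproduct_at D ord_max phi) (coproduct_at D ord0 phi) =
  pent_l mu phi.
Proof. by rewrite !coproduct_at_face. Qed.

Lemma pent_rE phi : cbh (kk 4) (cbh (kk 4) (shat_push (lift ord0) phi)
    (coproduct_at D (Ordinal (isT : (1 < 3)%N)) phi)) (shat_push (lift ord_max) phi) =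
  pent_r mu phi.
Proof. by rewrite !coproduct_at_face push_lift0 push_lift_max. Qed.

(** With the converse [lift_pentagon], lifts of the prescribed form become invariant solutions of
    the pentagon with given antisymmetrization in degree 3. *)
Lemma pentagon_lift phit phi : max_ideal_tensor phit -> shat_inv mu_lie phit ->
  pent_l mu phit = pent_r mu phit ->
  6%:R^-1 *: smap_op 3 alt_labels (phit 3) = phi ->
  is_lift P D phit mu (fun=> 0) phi.
Proof.
move=> hm hi hp ha; split; split.
- exact: kk_poisson_structure.
- exact: kk_max_ideal.
- by move=> c f g; rewrite !primitive_coproductE linearP.
- by rewrite primitive_coproductE shat_map1.
- by move=> f g; rewrite !primitive_coproductE shat_map_mul.
- by move=> n; exists n => f hf; rewrite primitive_coproductE; exact: shat_map_order.
- move=> f g; rewrite tensor_bracket_kk // !primitive_coproductE.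
  by apply: shat_map_kk => //; [exact: lie_sum_lie|exact: diag_lie].
- move=> f; rewrite shat_proj_map primitive_coproductE shat_map_comp.
  by apply: shat_map_id => v; rewrite /= /coord ffunE.
- move=> f; rewrite shat_proj_map primitive_coproductE shat_map_comp.
  by apply: shat_map_id => v; rewrite /= /coord ffunE.
- exact: hm.
- move=> a; rewrite !coproduct_at_primitive tensor_bracket_kk // bexp_fix //.
    by apply: kk0r; exact: lie_sum_lie.
  exact: kk_diag.
- by rewrite tensor_bracket_kk // pent_lE pent_rE.
- move=> a b u v a0 b0 a1 b1; rewrite kkE // !big_ord_recl !big_ord0 /= a0 b0 a1 b1.
  by rewrite !sym_poisson0l // !sym_poisson0r // sym_poisson_var // !addr0 !add0r.
- move=> a u _ _; rewrite shat_push_map primitive_coproductE shat_map_comp shat_subE.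
  rewrite [X in _ - scomp X _](_ : _ = shat_map (diag 2) a) ?subrr //.
  apply: eq_shat_map => v; apply/ffunP => j; rewrite !ffunE (big_pred1 (rev_ord j)) ?ffunE //.
  by move=> i /=; rewrite (can2_eq (@rev_ordK 2) (@rev_ordK 2)).
- by rewrite shat_alt3E.
Qed.

Lemma lift_pentagon phit phi : is_lift P D phit mu (fun=> 0) phi ->
  [/\ max_ideal_tensor phit, shat_inv mu_lie phit, pent_l mu phit = pent_r mu phit &
      6%:R^-1 *: smap_op 3 alt_labels (phit 3) = phi].
Proof.
case=> -[_ _ _ _ _ _ _ _ _ hm hc hp] [_ _ ha]; split.
- exact: hm.
- apply: coassoc_invariant; first exact: max_ideal_order.
  by move=> a; have := hc a; rewrite !coproduct_at_primitive tensor_bracket_kk.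
- by move: hp; rewrite tensor_bracket_kk // pent_lE pent_rE.
- by rewrite -shat_alt3E.
Qed.

End LiftsAsPentagons.

(** * Construction of associators and twists degree by degree *)

Section Corrections.
Variables (K : fieldType) (V : lmodType K) (mu : V -> V -> V).
Hypothesis K0 : [pchar K] =i pred0.
Hypothesis mu_lie : lie_bracket mu.
Local Notation kk k := (kostant_kirillov (@lie_sum K V mu k)).
Local Notation star k := (cbh (kk k)).
Local Notation sm n s := (shat_map (blk n s)).

Definition erased k (f : Shat (dsum V k)) := forall n, slots_erased (f n).

Lemma erasedP k (f : Shat (dsum V k)) :
  erased f <-> forall p, (0 < p <= k)%N -> sm k (erase k p) f = 0.
Proof.
split=> ef => [p pk|n p pk]; first by apply: shatP => n; exact: ef.
by rewrite -shat_mapE ef.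
Qed.

Lemma erased_missing m n p s (f : Shat (dsum V m)) : erased f -> (0 < p <= m)%N ->
  label_comp s (erase m p) = s -> sm n s f = 0.
Proof.
move=> /erasedP ef pm es; rewrite -es -(@sm_comp _ _ m m) ?ef ?linear0 //.
by rewrite size_map size_iota.
Qed.

Lemma star0l k (f : Shat (dsum V k)) : order_ge 2 f -> star k 0 f = f.
Proof.
move=> f2; pose L := lie_sum_lie mu_lie k.
apply: (grp_inj K0 (mu_lie := L)) => // [|N]; first by apply: order_ge_cbh => //; exact: order_ge0.
by rewrite (grp_star K0) ?grp0 ?mul1r //; exact: order_ge0.
Qed.

Lemma star0r k (f : Shat (dsum V k)) : order_ge 2 f -> star k f 0 = f.
Proof.
move=> f2; pose L := lie_sum_lie mu_lie k.
apply: (grp_inj K0 (mu_lie := L)) => // [|N]; first by apply: order_ge_cbh => //; exact: order_ge0.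
by rewrite (grp_star K0) ?grp0 ?mulr1 //; exact: order_ge0.
Qed.

Lemma starN k (f : Shat (dsum V k)) : order_ge 2 f -> star k f (- f) = 0.
Proof.
move=> f2; pose L := lie_sum_lie mu_lie k; have n2 := order_geN f2.
apply: (grp_inj K0 (mu_lie := L)) => [||N]; [exact: order_ge_cbh|exact: order_ge0|].
by rewrite (grp_star K0) // grp0 -[X in grp L N X * _]opprK grpN.
Qed.

(** A counit kills one factor on the left and two on the right of the pentagon; the two survivors
    coincide. *)
Lemma erased_pent_defect (phi : Shat (dsum V 3)) :
  erased phi -> erased (pent_r mu phi - pent_l mu phi).
Proof.
move=> ep; have p3 := erased_order ep; have p2 := order_ge_le (isT : (2 <= 3)%N) p3.
have o s : order_ge 2 (sm 4 s phi) by exact: shat_map_order.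
have Z p s : (0 < p <= 3)%N -> label_comp s (erase 3 p) = s -> sm 4 s phi = 0.
  exact: erased_missing.
apply/erasedP => p; rewrite linearB /= /pent_l /pent_r !(sm_star mu_lie) !sm_comp //.
case: p => [//|[|[|[|[|//]]]]] _; rewrite /label_comp /erase /=.
- rewrite (Z 1%N [:: 0; 2; 3; 3]%N) // (Z 1%N [:: 0; 2; 2; 3]%N) // (Z 1%N [:: 0; 2; 3; 0]%N) //.
  by rewrite !star0r ?star0l ?subrr.
- rewrite (Z 2%N [:: 1; 0; 3; 3]%N) // (Z 1%N [:: 0; 0; 2; 3]%N) // (Z 2%N [:: 1; 0; 3; 0]%N) //.
  by rewrite !star0l ?star0r ?subrr.
- rewrite (Z 2%N [:: 1; 1; 0; 3]%N) // (Z 2%N [:: 0; 1; 0; 3]%N) // (Z 3%N [:: 1; 2; 0; 0]%N) //.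
  by rewrite star0r // star0l // star0r // subrr.
rewrite (Z 3%N [:: 1; 1; 2; 0]%N) // (Z 3%N [:: 0; 1; 2; 0]%N) // (Z 3%N [:: 1; 2; 2; 0]%N) //.
rewrite [star 4 0 0]star0l; last exact: order_ge0.
by rewrite star0l // star0r // subrr.
Qed.

(** A counit kills the associator and two of the four factors of the twist; the remaining two are
    inverse to each other. *)
Lemma erased_twist (f : Shat (dsum V 2)) (phi : Shat (dsum V 3)) :
  erased f -> erased phi -> erased (twist mu f phi).
Proof.
move=> ef ep; have f2 := erased_order ef.
have o s : order_ge 2 (sm 3 s f) by exact: shat_map_order.
have Z p s : (0 < p <= 2)%N -> label_comp s (erase 2 p) = s -> sm 3 s f = 0.
  exact: erased_missing.
move/erasedP: (ep) => ep'; apply/erasedP => p p3; have := ep' p p3.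
rewrite /twist !(sm_star mu_lie) => ->; rewrite !linearN /= !sm_comp //.
case: p p3 => [//|[|[|[|//]]]] _; rewrite /label_comp /erase /=.
- rewrite (Z 1%N [:: 0; 2; 2]%N) // (Z 1%N [:: 0; 2; 0]%N) // oppr0.
  by rewrite !(star0r (o _)) starN // star0r //; exact: order_ge0.
- rewrite (Z 1%N [:: 0; 0; 2]%N) // (Z 2%N [:: 1; 0; 0]%N) // oppr0.
  by rewrite star0l // star0r // starN // star0r //; exact: order_ge0.
rewrite (Z 2%N [:: 0; 1; 0]%N) // (Z 2%N [:: 1; 1; 0]%N) // oppr0.
by rewrite star0l // star0r // star0r // starN.
Qed.

Lemma twist0 phi : order_ge 2 phi -> twist mu 0 phi = phi.
Proof.
move=> p2; rewrite /twist !linear0 [star 3 0 0]star0l; last exact: order_ge0.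
by rewrite star0l // !star0r.
Qed.

Definition good k (f : Shat (dsum V k)) := shat_inv mu_lie f /\ erased f.

Lemma good0 k : good (0 : Shat (dsum V k)).
Proof. by split=> [|n p _]; [exact: shat_inv0|exact: linear0]. Qed.

Lemma goodD k (f g : Shat (dsum V k)) : good f -> good g -> good (f + g).
Proof.
case=> fi fe [gi ge]; split; first exact: shat_invD.
move/erasedP: fe => fe; move/erasedP: ge => ge; apply/erasedP => p pk.
by rewrite linearD /= fe ?ge ?addr0.
Qed.

Lemma goodN k (f : Shat (dsum V k)) : good f -> good (- f).
Proof.
case=> fi fe; split; first exact: shat_invN.
by apply/erasedP => p pk; move/erasedP: fe => fe; rewrite linearN /= fe ?oppr0.
Qed.

Lemma good_order k (f : Shat (dsum V k)) : good f -> order_ge k f.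
Proof. by case=> _; exact: erased_order. Qed.

Lemma good_of k d (z : symAlg (dsum V k)) : homog d z -> invariant mu_lie z ->
  slots_erased z -> good (shat_of z).
Proof.
move=> hz iz ez; split=> n; rewrite (shat_of_homog n hz); case: eqP => // _.
  exact: invariant0.
by move=> p _; exact: linear0.
Qed.

Lemma good_limit k (F : nat -> Shat (dsum V k)) : (forall n, good (F n)) -> good (shat_limit F).
Proof. by move=> hF; split=> n; have [hi he] := hF n.+1; [exact: hi|exact: he]. Qed.

Lemma contract_good n N (h : Shat (dsum V n.+1)) : n \in [:: 2; 3]%N -> good h ->
  let z := contract n.+1 N%:R (h N) in
  [/\ homog N z, order_ge N (shat_of z) & good (shat_of z)].
Proof.
move=> n23 [hi he] z; have hz : homog N z by apply: contract_homog => //; exact: scomp_homog.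
split=> //.
  by move=> j jN; rewrite (shat_of_homog j hz) ltn_eqF.
apply: (good_of hz); last exact: erased_contract.
by move=> u; exact: (contract_invariant _ n23 (leqnn _) (hi N u)).
Qed.

(** The residue matters only in degree n + 1, hence the form of the last hypothesis; in higher
    degrees it vanishes by [cochain_residue]. *)
Lemma cob_contract n N (h : Shat (dsum V n.+1)) : n \in [:: 2; 3]%N -> (n < N)%N ->
  smap_op n.+2 (cobound n.+1 n.+1) (h N) = 0 ->
  (N = n.+1 -> all_to_end n.+1 (h N) = 0) ->
  cob (shat_of (contract n.+1 N%:R (h N))) N = h N.
Proof.
move=> n23 nN hN res; have hh := scomp_homog h N.
rewrite cobE (shat_of_homog N (contract_homog N%:R n23 (leqnn _) hh)) eqxx.
have [e r] := cochain_residue K0 n23 hh nN hN.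
rewrite [RHS]e [all_to_end _ _](_ : _ = 0) ?scaler0 ?addr0 //.
by have [/r//|Nn] := ltnP n.+1 N; apply: res; apply/eqP; rewrite eqn_leq Nn.
Qed.

End Corrections.

Section Construction.
Variables (K : fieldType) (V : lmodType K) (mu : V -> V -> V).
Hypothesis K0 : [pchar K] =i pred0.
Hypothesis mu_lie : lie_bracket mu.

Lemma agree_limits (W : lmodType K) c (x y : Shat W) :
  (forall k, agree (k + c) x y) -> x = y.
Proof. by move=> h; apply: agree_eq => n; apply: agree_le (h n); exact: leq_addr. Qed.

Section Associator.
Variable phi : symAlg (dsum V 3).
Hypotheses (phi_tensor : tensor phi) (phi_inv : invariant mu_lie phi).

Lemma tensor_homog k (x : symAlg (dsum V k)) : tensor x -> homog k x.
Proof.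
elim=> [|y z _ hy _ hz|c _ [t ->]]; [exact: homog0|exact: homogD|apply: homogZ].
have := homog_prod [seq inj i (t i) | i : 'I_k].
by rewrite size_map size_enum_ord big_map big_enum.
Qed.

Lemma tensor_erased k (x : symAlg (dsum V k)) : tensor x -> slots_erased x.
Proof.
move=> hx [//|p] pk; elim: hx => [|y z _ hy _ hz|c _ [t ->]].
- exact: linear0.
- by rewrite linearD /= hy hz addr0.
have z : sym_map (blk k (erase k p.+1)) (sym_var (inj (Ordinal pk) (t (Ordinal pk)))) = 0.
  rewrite sym_map_var -[RHS](linear0 sym_var); congr sym_var; apply/ffunP => j.
  rewrite blk_eraseE !ffunE eqSS -[p]/(val (Ordinal pk)) (inj_eq val_inj).
  by case: eqP.
by rewrite (bigD1 (Ordinal pk)) //= linearZ rmorphM /= [X in X * _]z mul0r scaler0.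
Qed.

(** Step k removes the defect in degree k + 5. The second argument of [contract] is this degree, the
    Euler eigenvalue when all four slots are active. *)
Fixpoint assoc_seq k : Shat (dsum V 3) :=
  if k is k'.+1 then
    assoc_seq k' - shat_of (contract 4 (k' + 5)%:R
      ((pent_r mu (assoc_seq k') - pent_l mu (assoc_seq k')) (k' + 5)%N))
  else shat_of phi.

Lemma assoc_seqP k : good mu_lie (assoc_seq k) /\
  agree (k + 5) (pent_l mu (assoc_seq k)) (pent_r mu (assoc_seq k)).
Proof.
have n3 : 3%N \in [:: 2; 3]%N by [].
elim: k => [|k [IHg IHa]].
  have g0 : good mu_lie (shat_of phi).
    by apply: good_of (tensor_homog phi_tensor) phi_inv (tensor_erased phi_tensor).
  split=> //; apply: (pent_small K0 mu_lie (good_order g0)); apply: shatP => n.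
  rewrite cobE (shat_of_homog n (tensor_homog phi_tensor)).
  by case: eqP => _; [exact: tensor_cocycle|exact: linear0].
have k5 : (4 < k + 5)%N by rewrite leq_addl.
have k1 : (1 < k + 5)%N by apply: leq_trans k5.
have o2 := order_ge_le (isT : (2 <= 3)%N) (good_order IHg).
set h := pent_r mu (assoc_seq k) - pent_l mu (assoc_seq k).
have gh : good mu_lie h.
  split; last by apply: erased_pent_defect => //; case: IHg.
  case: IHg => hi _; apply: shat_invD; first exact: shat_inv_pent_r.
  by apply: shat_invN; exact: shat_inv_pent_l.
have [hz oz gz] := contract_good (k + 5) n3 gh.
split; first by rewrite /= -/h; apply: goodD => //; exact: goodN.
rewrite addSn -[assoc_seq k.+1]/(assoc_seq k - shat_of (contract 4 (k + 5)%:R (h (k + 5)%N))).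
apply: (pent_step K0 mu_lie) => //; first exact: order_geN.
have hc : smap_op 5 (cobound 4 4) (h (k + 5)%N) = 0.
  by case: IHg => hi _; exact: (pentagon_cocycle K0 o2 hi k1 IHa).
rewrite cobE shat_oppE linearN; congr (- _).
(* A residue could only occur in degree 4, below the degrees corrected here. *)
rewrite -[RHS](cob_contract K0 n3 (ltnW k5) hc) ?cobE // => k4.
by rewrite k4 in k5.
Qed.

Lemma assoc_seq_step k : agree (k + 5) (assoc_seq k.+1) (assoc_seq k).
Proof.
have n3 : 3%N \in [:: 2; 3]%N by [].
move=> n nk; rewrite -[assoc_seq _.+1]/(_ - _) shat_subE; set z := contract _ _ _.
have hz : homog (k + 5) z by apply: contract_homog => //; exact: scomp_homog.
by rewrite (shat_of_homog n hz) ltn_eqF ?subr0.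
Qed.

Lemma associator_exists : exists phit : Shat (dsum V 3),
  [/\ good mu_lie phit, pent_l mu phit = pent_r mu phit & phit 3 = phi].
Proof.
have gl : good mu_lie (shat_limit assoc_seq) by apply: good_limit => n; case: (assoc_seqP n).
have ag := agree_limit assoc_seq_step.
have o2 := order_ge_le (isT : (2 <= 3)%N) (good_order gl).
exists (shat_limit assoc_seq); split=> //; last first.
  by rewrite (ag 0%N) // (shat_of_homog 3 (tensor_homog phi_tensor)).
apply: (@agree_limits _ 5) => k; have [gk ak] := assoc_seqP k.
have ok := order_ge_le (isT : (2 <= 3)%N) (good_order gk).
apply: agree_trans (agree_trans (pent_l_agree K0 mu_lie o2 ok (ag k)) ak) _.
exact/agree_sym/(pent_r_agree K0 mu_lie o2 ok (ag k)).
Qed.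

End Associator.

Section Gauge.
Variables phi1 phi2 : Shat (dsum V 3).
Hypotheses (good1 : good mu_lie phi1) (good2 : good mu_lie phi2).
Hypotheses (pent1 : pent_l mu phi1 = pent_r mu phi1) (pent2 : pent_l mu phi2 = pent_r mu phi2).
Hypothesis alt12 : smap_op 3 alt_labels (phi1 3) = smap_op 3 alt_labels (phi2 3).

(** The start is in degree 3, below which both associators vanish. *)
Fixpoint gauge_seq k : Shat (dsum V 2) :=
  if k is k'.+1 then
    gauge_seq k' + shat_of (contract 3 (k' + 3)%:R
      ((phi2 - twist mu (gauge_seq k') phi1) (k' + 3)%N))
  else 0.

Lemma gauge_seqP k : good mu_lie (gauge_seq k) /\
  agree (k + 3) (twist mu (gauge_seq k) phi1) phi2.
Proof.
have n2 : 2%N \in [:: 2; 3]%N by [].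
have p1 := order_ge_le (isT : (2 <= 3)%N) (good_order good1).
have p2 := order_ge_le (isT : (2 <= 3)%N) (good_order good2).
elim: k => [|k [IHg IHa]].
  split; first exact: good0.
  by rewrite [gauge_seq 0]/= twist0 // => n n3; rewrite (good_order good1) ?(good_order good2).
have k3 : (2 < k + 3)%N by rewrite leq_addl.
have k1 : (1 < k + 3)%N by apply: leq_trans k3.
have o2 := good_order IHg.
have gt : good mu_lie (twist mu (gauge_seq k) phi1).
  case: IHg good1 => fi fe [i1 e1]; split; first exact: shat_inv_twist.
  exact: erased_twist.
set h := phi2 - twist mu (gauge_seq k) phi1.
have gh : good mu_lie h by apply: goodD => //; exact: goodN.
have [hz oz gz] := contract_good (k + 3) n2 gh.
split; first exact: goodD.
rewrite addSn -[gauge_seq k.+1]/(gauge_seq k + shat_of (contract 3 (k + 3)%:R (h (k + 3)%N))).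
apply: (twist_step K0 mu_lie) => //.
apply: (cob_contract K0 n2 k3).
  rewrite -cobE; apply: (pent_diff K0 mu_lie (phi := twist mu (gauge_seq k) phi1)) => //.
  - exact: order_ge_twist.
  - by apply/order_ge_sub; exact: agree_sym.
  - by apply: (twist_pentagon K0) => //; [case: IHg|case: good1].
  - by rewrite /h addrC subrK.
(* Degree 3 is the only one where a residue can occur. No twist has been applied yet, and the
   residue of the difference of the two associators is its antisymmetrization, which is zero. *)
move=> e3; have k0 : k = 0%N by apply/eqP; rewrite -(eqn_add2r 3) e3.
have [_ he] := gh; rewrite all_to_end_tensor; last first.
  by apply: erased_tensor => //; rewrite e3; exact: (scomp_homog h 3).
by rewrite /h k0 twist0 // shat_subE linearB /= alt12 subrr.
Qed.

Lemma gauge_seq_step k : agree (k + 3) (gauge_seq k.+1) (gauge_seq k).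
Proof.
have n2 : 2%N \in [:: 2; 3]%N by [].
move=> n nk; rewrite -[gauge_seq _.+1]/(_ + _) shat_addE; set z := contract _ _ _.
have hz : homog (k + 3) z by apply: contract_homog => //; exact: scomp_homog.
by rewrite (shat_of_homog n hz) ltn_eqF ?addr0.
Qed.

Lemma gauge_exists : exists2 f : Shat (dsum V 2), good mu_lie f & twist mu f phi1 = phi2.
Proof.
have gl : good mu_lie (shat_limit gauge_seq) by apply: good_limit => n; case: (gauge_seqP n).
have p1 := order_ge_le (isT : (2 <= 3)%N) (good_order good1).
have ag := agree_limit gauge_seq_step.
exists (shat_limit gauge_seq) => //; apply: (@agree_limits _ 3) => k.
have [gk ak] := gauge_seqP k; apply: agree_trans (_ : agree _ _ _) ak.
exact: (twist_agree K0 mu_lie (good_order gl) (good_order gk) p1 (ag k)).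
Qed.

End Gauge.
End Construction.

Theorem theorem1p8 (K : fieldType) (K_char0 : [pchar K] =i pred0)
    (g : lmodType K) (mu : g -> g -> g) (mu_lie : lie_bracket mu)
    (phi : symAlg (dsum g 3)) (phi_ext : exterior phi)
    (phi_inv : sym_invariant mu phi) :
  let P := kostant_kirillov mu in
  let Delta0 := @primitive_coproduct K g in
  let lift_of (phit : Shat (dsum g 3)) :=
    is_lift P Delta0 phit mu (fun=> 0) phi in
  (exists phit, lift_of phit) /\
  (forall phit1 phit2, lift_of phit1 -> lift_of phit2 ->
    exists f : Shat (dsum g 2),
      [/\ max_ideal_tensor f, shat_invariant mu f,
          twist_coproduct P Delta0 f =1 Delta0 &
          twist_associator P Delta0 f phit1 = phit2]).
Proof.
move=> P Delta0 lift_of; split.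
  have /(sym_invariantE mu_lie) inv := phi_inv.
  have [phit [[hi he] hp h3]] := associator_exists K_char0 (proj1 phi_ext) inv.
  exists phit; apply: pentagon_lift => //; first exact: erased_max_ideal.
  by rewrite h3 exterior_alt.
move=> phit1 phit2 /(lift_pentagon mu_lie)[m1 i1 p1 a1] /(lift_pentagon mu_lie)[m2 i2 p2 a2].
have good1 : good mu_lie phit1 by split=> //; exact: max_ideal_erased.
have good2 : good mu_lie phit2 by split=> //; exact: max_ideal_erased.
have alt12 : smap_op 3 alt_labels (phit1 3%N) = smap_op 3 alt_labels (phit2 3%N).
  (* Both lifts have the same normalized antisymmetrization; the factor 1 / 6 cancels in
     characteristic 0. *)
  by apply: (scalerI (invr_neq0 (natS_neq0 K_char0 5))); rewrite a1 a2.
have [f [fi fe] ef] := gauge_exists K_char0 good1 good2 p1 p2 alt12.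
exists f; split.
- exact: erased_max_ideal.
- by move=> n; apply/(sym_invariantE mu_lie).
- exact: twist_coproductE.
- by rewrite twist_associatorE.
Qed.
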